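(* Let $H$ be an infinitely divisible distribution supported on $[0,\infty)$ with Laplace transform $$\int_0^\infty e^{-\lambda y}H(dy)=\exp\Big\{-a\lambda-\int_0^\infty(1-e^{-\lambda y})\upsilon(dy)\Big\},$$ with Lévy spectral distribution $F$ and decomposition $H=H_1*H_2$ (as in the context). For some positive constant $T_0$ and all $k\ge1$, assume that $$\liminf_{x\to\infty}\frac{F^{*k}(x-t+\Delta_{T_0})}{F^{*k}(x+\Delta_{T_0})}\ge1\quad\text{for all } t>0 .$$ Suppose that $H\in\mathcal L_{loc}\cap\mathcal{OS}_{loc}$ and $H_1(x+\Delta_{T_0})=o\big(H_2(x+\Delta_{T_0})\big)$. Then $$H_2\in\mathcal L_{loc}\cap\mathcal{OS}_{loc}\quad\text{and}\quad H_2(x+\Delta_T)\approx H(x+\Delta_T)\ \text{ for all } 0<T\le\infty .$$ And there exists an integer $n_0\ge1$ such that $F^{*n}\in\mathcal L_{loc}\cap\mathcal{OS}_{loc}$ for all $n\ge n_0$. Further, if $n_0\ge2$ and if there exists an integer $1\le l_0\le n_0-1$ such that $F^{*l_0}\in\mathcal{OS}_{loc}$, then $F^{*n}\in\mathcal L_{loc}\cap\mathcal{OS}_{loc}$ for all $n\ge l_0$. In particular, if $l_0=1$, that is, $F\in\mathcal{OS}_{loc}$, then $F\in\mathcal L_{loc}\,(\cap\,\mathcal{OS}_{loc})$.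
   Context: All limits are as $x\to\infty$. $\overline V=1-V$; $V^{*k}$ is the $k$-fold convolution of $V$ with itself, $V^{*0}$ being degenerate at $0$. $f\approx g$ means $f=O(g)$ and $g=O(f)$; $f\sim g$ means $f/g\to1$. Lévy data: $a\ge0$ is a constant; $\upsilon$ is a Borel measure on $(0,\infty)$ with $\mu:=\upsilon((1,\infty))\in(0,\infty)$ and $\int_0^1y\,\upsilon(dy)<\infty$. The Lévy spectral distribution is $F(x)=\frac{\upsilon((1,x])}{\mu}\mathbf 1(x>1)$. In the decomposition $H=H_1*H_2$, $H_2(x)=e^{-\mu}\sum_{k=0}^\infty F^{*k}(x)\mu^k/k!$ and $H_1$ is the infinitely divisible distribution with drift $a$ and Lévy measure $\upsilon$ restricted to $(0,1]$; it satisfies $\overline{H_1}(x)=O(e^{-\beta x})$ for some constant $\beta>0$. Local notation: $V(x+\Delta_T)=V((x,x+T])$ for $0<T<\infty$ and $V(x+\Delta_\infty)=\overline V(x)$; $V(x-t+\Delta_T)$ is the same with $x$ replaced by $x-t$. Classes: $V\in\mathcal L_{loc}$ if for all $0<T\le\infty$, $V(x+\Delta_T)>0$ for all $x>0$ and $V(x-t+\Delta_T)\sim V(x+\Delta_T)$ for all $t>0$. $V\in\mathcal{OS}_{loc}$ if for all $0<T\le\infty$, $\limsup V^{*2}(x+\Delta_T)/V(x+\Delta_T)<\infty$.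
   Formalization: In the definition of L_loc, the positivity V(x+Δ_T)>0 is required for all sufficiently large x (depending on T), not for all x>0: F lives on (1,∞), so F^{*n} and H_2 give no mass to (1/4,3/4] and could never satisfy the literal condition. *)

(* Defs.v *)
From HB Require Import structures.
From mathcomp Require Import all_boot all_order all_algebra.
From mathcomp Require Import all_classical all_reals all_analysis.

Set Implicit Arguments.
Unset Strict Implicit.
Unset Printing Implicit Defensive.

Import Order.TTheory GRing.Theory Num.Theory.
Import numFieldNormedType.Exports.

Local Open Scope classical_set_scope.
Local Open Scope ring_scope.

Section convolution_measure.
Context {R : realType}.
Local Open Scope ereal_scope.
Variables P Q : probability R R.

Definition convolution (A : set R) : \bar R :=
  pushforward (P \x Q) (fun z : R * R => (z.1 + z.2)%R) A.

Let mplus : measurable_fun [set: R * R] (fun z : R * R => (z.1 + z.2)%R).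
Proof. exact: measurable_realfun.measurable_funD. Qed.

Let convolution0 : convolution set0 = 0.
Proof. by rewrite /convolution /pushforward preimage_set0 measure0. Qed.

Let convolution_ge0 A : 0 <= convolution A.
Proof. exact: measure_ge0. Qed.

Let convolution_sigma_additive : semi_sigma_additive convolution.
Proof.
move=> F mF tF mUF; rewrite /convolution /pushforward preimage_bigcup.
apply: measure_semi_sigma_additive.
- by move=> n; rewrite -[X in measurable X]setTI; exact: mplus.
- apply/trivIsetP => /= i j _ _ ij; rewrite -preimage_setI.
  by move/trivIsetP : tF => /(_ _ _ _ _ ij) ->//; rewrite preimage_set0.
- by rewrite -preimage_bigcup -[X in measurable X]setTI; exact: mplus.
Qed.

HB.instance Definition _ := isMeasure.Build _ _ _
  convolution convolution0 convolution_ge0 convolution_sigma_additive.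

Let convolution_setT : convolution setT = 1.
Proof.
rewrite /convolution /pushforward preimage_setT -setXTT product_measure1E//.
by rewrite [LHS](_ : _ = P setT * Q setT)// !probability_setT mule1.
Qed.

HB.instance Definition _ :=
  Measure_isProbability.Build _ _ _ convolution convolution_setT.

End convolution_measure.

(* [iterop] makes [convpow P 1] and [convpow P 2] convertible to [P] and
   [convolution P P]. *)
Definition convpow {R : realType} (P : probability R R) (k : nat) :
    probability R R :=
  iterop k (fun P Q => convolution P Q : probability R R) P (\d_(0 : R)).

Section compound_poisson.
Context {R : realType}.
Local Open Scope ereal_scope.
Variables (m : {nonneg R}) (P : probability R R).

Definition compound_poisson (A : set R) : \bar R :=
  (expR (- m%:num))%:E *
  \sum_(0 <= k <oo) (m%:num ^+ k / k`!%:R)%:E * convpow P k A.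

Let weight_ge0 k : (0 <= m%:num ^+ k / k`!%:R)%R.
Proof. by rewrite divr_ge0// exprn_ge0. Qed.

Let cp : {measure set R -> \bar R} :=
  mscale (NngNum (expR_ge0 (- m%:num)))
    (mseries (fun k => mscale (NngNum (weight_ge0 k)) (convpow P k)) 0).

HB.instance Definition _ := isMeasure.Build _ _ _ compound_poisson
  (measure0 cp) (measure_ge0 cp) (@measure_semi_sigma_additive _ _ _ cp).

Let compound_poisson_setT : compound_poisson setT = 1.
Proof.
rewrite /compound_poisson; under eq_eseriesr do rewrite probability_setT mule1.
rewrite -[RHS](_ : (expR (- m%:num))%:E * (expR m%:num)%:E = 1); last first.
  by rewrite -EFinM expRN mulVf ?gt_eqF ?expR_gt0.
congr *%E; rewrite expRE -EFin_lim; last first.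
  rewrite /pseries/=; under eq_fun do rewrite mulrC.
  exact: is_cvg_series_exp_coeff.
apply/congr_lim/funext => n/=; rewrite /pseries/= /series/= -sumEFin//.
by under eq_bigr do rewrite mulrC.
Qed.

HB.instance Definition _ :=
  Measure_isProbability.Build _ _ _ compound_poisson compound_poisson_setT.

End compound_poisson.

Section asymptotics.
Context {R : realType}.
Local Open Scope ereal_scope.
Implicit Types f g : R -> \bar R.

Definition bigO_pinfty f g : Prop :=
  exists C : R, \forall x \near +oo%R, `|f x| <= C%:E * `|g x|.

Definition littleo_pinfty f g : Prop :=
  forall e : R, (0 < e)%R -> \forall x \near +oo%R, `|f x| <= e%:E * `|g x|.

Definition same_order f g : Prop := bigO_pinfty f g /\ bigO_pinfty g f.

Definition equivalent_pinfty f g : Prop := f x / g x @[x --> +oo%R] --> 1.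

End asymptotics.

Section levy.
Context {R : realType}.
Local Open Scope ereal_scope.
Implicit Types nu : {measure set R -> \bar R}.

Definition infinitely_divisible (H : probability R R) : Prop :=
  forall n, (0 < n)%N -> exists P : probability R R,
    forall A, measurable A -> H A = convpow P n A.

Definition id_law (a : R) nu (H : probability R R) : Prop :=
  [/\ H `]-oo, 0%R[%classic = 0,
      infinitely_divisible H
    & forall l : R, (0 <= l)%R ->
        \int[H]_(y in `[0%R, +oo[) (expR (- (l * y)))%:E =
        expeR (- (a * l)%:E
               - \int[nu]_(y in `]0%R, +oo[) (1 - expR (- (l * y)))%:E)].

(* [fine] makes this the real number nu (]1, +oo[) when the latter is finite. *)
Definition levy_mass nu : {nonneg R} :=
  NngNum (fine_ge0 (measure_ge0 nu `]1%R, +oo[%classic)).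

(* The Dirac mass is the default value of [mnormalize]: it is irrelevant when
   nu (]1, +oo[) is positive and finite. See [levy_spectralE] for the distribution
   function. *)
Definition levy_spectral nu : probability R R :=
  mnormalize (mrestr nu (measurable_itv `]1%R, +oo[)) \d_(0%R : R).

Definition small_jumps nu : {measure set R -> \bar R} :=
  mrestr nu (measurable_itv `]0%R, 1%R]).

End levy.

Lemma levy_spectralE {R : realType} (nu : {measure set R -> \bar R}) (x : R) :
  (0 < nu `]1%R, +oo[%classic < +oo)%E ->
  levy_spectral nu `]-oo, x]%classic =
  (if (1 < x)%R then (fine (nu `]1%R, x]%classic) / (levy_mass nu)%:num)%:E
   else 0)%E.
Proof.
move=> /andP[nu0 nuoo]; rewrite /= /mnormalize /= {1 2}/mrestr setTI.
rewrite gt_eqF// lt_eqF//= /mrestr setTI.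
have [x1|x1] := ltP 1 x; last first.
  rewrite (_ : _ `&` _ = set0) ?measure0 ?mul0e//.
  apply/seteqP; split => // y /=; rewrite !in_itv/= andbT => -[yx y1].
  by have := lt_le_trans y1 (le_trans yx x1); rewrite ltxx.
rewrite (_ : _ `&` _ = `]1%R, x]%classic); last first.
  apply/seteqP; split => y /=; rewrite !in_itv/= andbT.
    by move=> [-> ->].
  by move=> /andP[-> ->].
rewrite EFinM fineK// ge0_fin_numE// (le_lt_trans _ nuoo)//.
apply: le_measure; rewrite ?inE//.
by move=> y /=; rewrite !in_itv/= => /andP[-> _].
Qed.

Section local_classes.
Context {R : realType}.
Local Open Scope ereal_scope.
Implicit Types V : probability R R.

(* ]x, x + T] if T is finite, ]x, +oo[ if T = +oo: see [delta_fin] and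
   [delta_pinfty]. *)
Definition delta (T : \bar R) (x : R) : set R :=
  [set y | (x < y)%R /\ y%:E <= x%:E + T].

Definition local_mass V (T : \bar R) (x : R) : \bar R := V (delta T x).

(* Positivity is required for all large x only: the law [levy_spectral nu] charges
   no subset of ]-oo, 1], so that asking for positivity at every x > 0 and every
   T > 0 would exclude it, its convolution powers and its compound Poisson law. *)
Definition in_Lloc V : Prop :=
  forall T : \bar R, 0 < T ->
    (\forall x \near +oo%R, 0 < local_mass V T x) /\
    (forall t : R, (0 < t)%R ->
      equivalent_pinfty (fun x => local_mass V T (x - t)) (local_mass V T)).

(* The quotient is in [\bar R], where r / 0 = +oo for r > 0 and 0 / 0 = 0. *)
Definition in_OSloc V : Prop :=
  forall T : \bar R, 0 < T ->
    limf_esup (fun x => local_mass (convpow V 2) T x / local_mass V T x) +oo%R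
    < +oo.

Definition in_Lloc_OSloc V : Prop := in_Lloc V /\ in_OSloc V.

End local_classes.

Lemma delta_fin {R : realType} (x T : R) : delta T%:E x = `]x, x + T]%classic.
Proof.
by apply/seteqP; split => y /=; rewrite /delta/= in_itv/= -EFinD lee_fin;
  [move=> [-> ->] | move=> /andP[]].
Qed.

Lemma delta_pinfty {R : realType} (x : R) : delta +oo%E x = `]x, +oo[%classic.
Proof.
by apply/seteqP; split => y /=; rewrite /delta/= in_itv/= andbT addey// leey;
  [case|].
Qed.

(* Main.v *)
Require Import Defs.
From mathcomp Require Import all_boot all_order all_algebra.
From mathcomp Require Import all_classical all_reals all_analysis.
From mathcomp Require Import measurable_realfun.
From mathcomp Require Import ring lra.

Set Implicit Arguments.
Unset Strict Implicit.
Unset Printing Implicit Defensive.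

Import Order.TTheory GRing.Theory Num.Theory.
Import numFieldNormedType.Exports.

Local Open Scope classical_set_scope.
Local Open Scope ring_scope.

(* Fix the window length T = T0 and write w V x = V(]x, x + T]). The gauge is
   h = w H; it is long-tailed, and the measures V with w V = O(h) are stable under
   convolution. Since H1 is negligible, H2 and all the F^{*k} belong to this class,
   h = O(w H2), and exp(mu) H2 is a limit of sums of the F^{*k} up to o(h).

   The liminf conditions give w F^{*k}(x) <= w F^{*k}(x - t) + o(h), hence the same
   for H2; as H = H1 * H2 has two-sided increments o(h), so does H2, and then every
   F^{*k}, because a sum of one-sided increments that is o(h) has o(h) terms.

   Window lengths other than T are reached by equidistribution: V(]x, x + t]) is
   (t / T) w V x + o(h) as soon as V is slowly varying at scale h and, for every
   frequency om = 2 pi j / T, the integral of cos (om y + th) over ]x, x + T]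
   against V is o(h). For H this follows from local long-tailedness at small
   windows. For H2 one divides by the characteristic function of H1, which does not
   vanish by infinite divisibility. For F^{*k} one uses the logarithmic derivative
   of the compound Poisson exponential, that is, the size-bias identity y H2(dy) =
   mu (y F(dy)) * H2, and inverts H2 by the series exp(mu) exp(-mu F). With sizes
   truncated at order x this gives an o(x h) bound for F^{*k} weighted by one of its
   summands; by exchangeability the weights add up to the total size, which is about
   x on the window, so the factor x cancels.

   A slowly varying equidistributed V with c h <= w V is in L_loc and OS_loc. For
   V = F^{*n} with n large the lower bound comes from h = O(w H2) and from
   w F^{*k} <= 2 w F^{*n} for k <= n. If F^{*l} is in OS_loc then
   w F^{*(jl)} = O(w F^{*l}) for all j, so the lower bound descends to n = l. *)

(** * Means of bounded measurable functions *)

(** Slow variation at the single scale [T] says nothing about how mass is spread inside a window: a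
    law carried by a lattice of span [T] can satisfy it. The nonzero Fourier modes of period [T] are
    exactly the missing information, which is why they must be carried from [H] to its factors.

    Slow variation and equidistribution are stated with errors o(h) and not relative to the law at
    hand, because F^{*k} may be far smaller than h for small k; relative statements return only once
    c h <= w V is known.

    Series in the convolution powers are truncated by one device: 2^k m^k / k! is the coefficient
    for intensity 2 m, so the terms beyond K cost 2^-K times a window of the law of intensity 2 m.
    That law is H2 * H2, whose windows are still O(h). *)

Section bounded_measurable.
Context {R : realType} d {T : measurableType d}.
Implicit Types f g : T -> R.

Definition bmf f := measurable_fun setT f /\ exists M : R, forall x, `|f x| <= M.

Lemma bmf_cst (c : R) : bmf (fun=> c).
Proof. by split; [exact: measurable_cst|exists `|c|]. Qed.

Lemma bmfD f g : bmf f -> bmf g -> bmf (fun x => f x + g x).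
Proof.
move=> [mf [M fM]] [mg [N gN]]; split; first exact: measurable_funD.
by exists (M + N) => x; rewrite (le_trans (ler_normD _ _))// lerD.
Qed.

Lemma bmfN f : bmf f -> bmf (fun x => - f x).
Proof.
move=> [mf [M fM]]; split; first exact: measurable_funN.
by exists M => x; rewrite normrN.
Qed.

Lemma bmfB f g : bmf f -> bmf g -> bmf (fun x => f x - g x).
Proof. by move=> bf bg; apply: bmfD => //; exact: bmfN. Qed.

Lemma bmfM f g : bmf f -> bmf g -> bmf (fun x => f x * g x).
Proof.
move=> [mf [M fM]] [mg [N gN]]; split; first exact: measurable_funM.
by exists (M * N) => x; rewrite normrM ler_pM.
Qed.

Lemma bmf_norm f : bmf f -> bmf (fun x => `|f x|).
Proof.
move=> [mf [M fM]]; split; first exact: measurableT_comp.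
by exists M => x; rewrite normr_id.
Qed.

Lemma bmfX f n : bmf f -> bmf (fun x => f x ^+ n).
Proof.
move=> bf; elim: n => [|n ih].
  by under [X in bmf X]funext do rewrite expr0; exact: bmf_cst.
by under [X in bmf X]funext do rewrite exprS; exact: bmfM.
Qed.

Lemma bmf_sum (I : Type) (r : seq I) (P : pred I) (F : I -> T -> R) :
  (forall i, bmf (F i)) -> bmf (fun x => \sum_(i <- r | P i) F i x).
Proof.
move=> bF; elim: r => [|i r ih].
  by under [X in bmf X]funext do rewrite big_nil; exact: bmf_cst.
under [X in bmf X]funext do rewrite big_cons.
by case: (P i) => //; exact: bmfD.
Qed.

Lemma bmf_integrable (P : probability T R) f : bmf f ->
  P.-integrable setT (EFin \o f).
Proof.
move=> [mf [M fM]]; apply: measurable_bounded_integrable => //.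
  by rewrite (le_lt_trans (probability_le1 _ _))// ltry.
exists M; split; first exact: num_real.
by move=> x Mx y _ /=; rewrite (le_trans (fM y))// ltW.
Qed.

End bounded_measurable.

Lemma bmf_comp {R : realType} d d' (T : measurableType d) (U : measurableType d')
    (f : T -> R) (g : U -> T) :
  bmf f -> measurable_fun setT g -> bmf (fun x => f (g x)).
Proof.
move=> [mf [M fM]] mg; split; first exact: (measurableT_comp mf).
by exists M.
Qed.

Section mean.
Context {R : realType} d {T : measurableType d}.
Implicit Types (P : probability T R) (f g : T -> R).

Definition mean P f : R := \int[P]_x f x.

Lemma mean_cst P c : mean P (fun=> c) = c.
Proof.
rewrite /mean Rintegral_cst// -[RHS](mulr1 c); congr (_ * _).
exact: (congr1 fine (probability_setT P)).
Qed.

Lemma meanD P f g : bmf f -> bmf g ->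
  mean P (fun x => f x + g x) = mean P f + mean P g.
Proof. by move=> bf bg; rewrite /mean RintegralD//; exact: bmf_integrable. Qed.

Lemma meanB P f g : bmf f -> bmf g ->
  mean P (fun x => f x - g x) = mean P f - mean P g.
Proof. by move=> bf bg; rewrite /mean RintegralB//; exact: bmf_integrable. Qed.

Lemma meanZ P c f : bmf f -> mean P (fun x => c * f x) = c * mean P f.
Proof. by move=> bf; rewrite /mean RintegralZl//; exact: bmf_integrable. Qed.

Lemma mean_sum P (I : Type) (r : seq I) (F : I -> T -> R) :
  (forall i, bmf (F i)) ->
  mean P (fun x => \sum_(i <- r) F i x) = \sum_(i <- r) mean P (F i).
Proof.
move=> bF; elim: r => [|i r ih].
  by under [X in mean P X]funext do rewrite big_nil; rewrite big_nil mean_cst.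
under [X in mean P X]funext do rewrite big_cons.
by rewrite big_cons meanD ?ih//; exact: bmf_sum.
Qed.

Lemma ler_mean P f g : bmf f -> bmf g -> (forall x, f x <= g x) ->
  mean P f <= mean P g.
Proof. by move=> bf bg fg; apply: le_Rintegral => //; exact: bmf_integrable. Qed.

Lemma mean_ge0 P f : (forall x, 0 <= f x) -> 0 <= mean P f.
Proof. by move=> f0; apply: Rintegral_ge0. Qed.

Lemma ler_norm_mean P f : bmf f -> `|mean P f| <= mean P (fun x => `|f x|).
Proof. by move=> bf; apply: le_normr_Rintegral => //; exact: bmf_integrable. Qed.

Lemma mean_indic P A : measurable A -> mean P (\1_A) = fine (P A).
Proof. by move=> mA; rewrite /mean /Rintegral integral_indic// setIT. Qed.

Lemma mean_bound P f M : bmf f -> (forall x, `|f x| <= M) -> `|mean P f| <= M.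
Proof.
move=> bf fM; rewrite (le_trans (ler_norm_mean P bf))// -[leRHS](mean_cst P).
by apply: ler_mean => //; [exact: bmf_norm|exact: bmf_cst].
Qed.

End mean.

Section fubini.
Context {R : realType} d1 d2 {T1 : measurableType d1} {T2 : measurableType d2}.
Implicit Types (P : probability T1 R) (Q : probability T2 R) (f : T1 -> T2 -> R).

Lemma bmf_pair1 f x : bmf (fun z : T1 * T2 => f z.1 z.2) -> bmf (f x).
Proof. by move=> bf; exact: (bmf_comp bf (pair1_measurable x)). Qed.

Lemma bmf_pair2 f y : bmf (fun z : T1 * T2 => f z.1 z.2) -> bmf (f ^~ y).
Proof. by move=> bf; exact: (bmf_comp bf (pair2_measurable y)). Qed.

Lemma bmf_mean Q f :
  bmf (fun z : T1 * T2 => f z.1 z.2) -> bmf (fun x => mean Q (f x)).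
Proof.
move=> bf; have [mf [M fM]] := bf.
split; last first.
  by exists M => x; apply: mean_bound => [|y]; [exact: bmf_pair1|exact: (fM (x, y))].
(* Measurability of the inner integral is extracted from integrability on a product, so some
   probability on [T1] is wanted: a Dirac mass at any point will do, and an empty [T1] is
   trivial. *)
have [[x0]|nx] := pselect (inhabited T1); last first.
  move=> _ B mB; rewrite (_ : _ `&` _ = set0)//.
  by apply/seteqP; split => // x; case: nx; constructor.
pose P1 : probability T1 R := \d_ x0.
have if_ : (P1 \x Q)%E.-integrable setT (EFin \o (fun z : T1 * T2 => f z.1 z.2)).
  exact: (@bmf_integrable _ _ _ (P1 \x Q)%E).
have mfine : measurable_fun [set: \bar R] (fine : \bar R -> R).
  by apply: fine_measurable; exact: measurableT.
exact: (measurableT_comp mfine (measurable_fubini_F if_)).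
Qed.

Lemma mean_fubini P Q f :
  bmf (fun z : T1 * T2 => f z.1 z.2) ->
  mean P (fun x => mean Q (f x)) = mean Q (fun y => mean P (f ^~ y)).
Proof.
move=> bf.
have if_ : (P \x Q)%E.-integrable setT (EFin \o (fun z : T1 * T2 => f z.1 z.2)).
  exact: (@bmf_integrable _ _ _ (P \x Q)%E).
have := Fubini if_; rewrite /= => h.
rewrite /mean /Rintegral; congr fine.
rewrite -[LHS]/(\int[P]_x (mean Q (f x))%:E)%E -[RHS]/(\int[Q]_y (mean P (f ^~ y))%:E)%E.
transitivity (\int[P]_x \int[Q]_y (f x y)%:E)%E.
  apply: eq_integral => x _; rewrite /mean /Rintegral fineK//.
  by apply: integrable_fin_num => //; apply: bmf_integrable; exact: bmf_pair1.
rewrite h; apply: eq_integral => y _; rewrite /mean /Rintegral fineK//.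
by apply: integrable_fin_num => //; apply: bmf_integrable; exact: bmf_pair2.
Qed.

Lemma mean_prod P Q f :
  bmf (fun z : T1 * T2 => f z.1 z.2) ->
  mean (P \x Q)%E (fun z => f z.1 z.2) = mean P (fun x => mean Q (f x)).
Proof.
move=> bf.
have if_ : (P \x Q)%E.-integrable setT (EFin \o (fun z : T1 * T2 => f z.1 z.2)).
  exact: (@bmf_integrable _ _ _ (P \x Q)%E).
rewrite /mean /Rintegral; congr fine.
rewrite -(integral12_prod_meas1 if_).
apply: eq_integral => x _; rewrite /fubini_F/= /Rintegral fineK//.
by apply: integrable_fin_num => //; apply: bmf_integrable; exact: bmf_pair1.
Qed.

End fubini.

Section real_line.
Context {R : realType}.
Implicit Types (P Q : probability R R) (f g : R -> R).

Lemma eq_probability_mean P Q f : (forall A, measurable A -> P A = Q A) ->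
  mean P f = mean Q f.
Proof.
move=> PQ; rewrite /mean /Rintegral; congr fine.
by apply: eq_measure_integral => A mA _; exact: PQ.
Qed.

Definition convp P Q : probability R R := convolution P Q.

Lemma mean_convolution P Q f : bmf f ->
  mean (convp P Q) f = mean P (fun x => mean Q (fun y => f (x + y))).
Proof.
move=> bf.
have mD : measurable_fun [set: R * R] (fun z : R * R => z.1 + z.2).
  exact: measurable_funD.
have bfD := bmf_comp bf mD.
rewrite -(mean_prod P Q (f := fun x y => f (x + y)))//.
have if_ : (P \x Q)%E.-integrable setT (EFin \o (fun z : R * R => f (z.1 + z.2))).
  exact: (@bmf_integrable _ _ _ (P \x Q)%E).
rewrite /mean /Rintegral; congr fine.
rewrite (eq_measure_integral (pushforward (P \x Q)%E (fun z : R * R => z.1 + z.2)))//.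
by rewrite integral_pushforward//; apply/measurable_EFinP; case: bf.
Qed.

Lemma mean_dirac (a : R) f : bmf f -> mean (\d_ a : probability R R) f = f a.
Proof.
move=> [mf _]; rewrite /mean /Rintegral integral_dirac//; first by rewrite diracT mul1e.
exact/measurable_EFinP.
Qed.

Definition supp_ge0 P := P `]-oo, 0[%classic = 0%E.

Lemma ler_mean_supp P f g : supp_ge0 P -> bmf f -> bmf g ->
  (forall x, 0 <= x -> f x <= g x) -> mean P f <= mean P g.
Proof.
move=> P0 bf bg fg.
have bi : bmf (\1_(`]-oo, 0[%classic : set R) : R -> R).
  split; first exact: measurable_indic.
  by exists 1 => x; rewrite indicE; case: (_ \in _); rewrite /= ?normr1 ?normr0.
have [_ [M fM]] := bf; have [_ [N gN]] := bg.
(* Negative arguments have mass zero, so adding [M + N] there leaves the mean unchanged and makes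
   the inequality hold everywhere. *)
have -> : mean P g = mean P (fun x => g x + (M + N) * \1_(`]-oo, 0[%classic : set R) x).
  rewrite meanD//; last by apply: bmfM => //; exact: bmf_cst.
  by rewrite meanZ// mean_indic// P0 mulr0 addr0.
apply: ler_mean => //.
  by apply: bmfD => //; apply: bmfM => //; exact: bmf_cst.
move=> x; rewrite indicE; have [x0|x0] := leP 0 x.
  by rewrite memNset ?mulr0 ?addr0 ?fg//= in_itv/=; lra.
rewrite mem_set/= ?in_itv//= mulr1.
have := fM x; have := gN x; rewrite !ler_norml => /andP[? ?] /andP[? ?]; lra.
Qed.

Lemma eq_mean_supp P f g : supp_ge0 P -> bmf f -> bmf g ->
  (forall x, 0 <= x -> f x = g x) -> mean P f = mean P g.
Proof.
move=> P0 bf bg fg; apply/eqP; rewrite eq_le.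
by rewrite !ler_mean_supp// => x x0; rewrite fg.
Qed.

Lemma supp_ge0_convolution P Q : supp_ge0 P -> supp_ge0 Q ->
  supp_ge0 (convp P Q).
Proof.
move=> P0 Q0.
pose I : R -> R := \1_(`]-oo, 0[%classic : set R).
have bi : bmf I.
  split; first exact: measurable_indic.
  by exists 1 => x; rewrite /I indicE; case: (_ \in _); rewrite /= ?normr1 ?normr0.
have mD : measurable_fun [set: R * R] (fun z : R * R => z.1 + z.2).
  exact: measurable_funD.
have h : mean (convp P Q) I = 0.
  rewrite mean_convolution//.
  transitivity (mean P (fun=> 0)); last by rewrite mean_cst.
  apply: eq_mean_supp => //.
  - have h := (@bmf_mean R _ _ R R Q (fun x y => I (x + y)) (bmf_comp bi mD)). refine h.
  - exact: bmf_cst.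
  move=> x x0; transitivity (mean Q (fun=> 0)); last by rewrite mean_cst.
  apply: eq_mean_supp => //.
  - by apply: bmf_comp => //; exact: measurable_funD.
  - exact: bmf_cst.
  move=> y y0; rewrite /I indicE memNset//= in_itv/= => ?; lra.
rewrite /supp_ge0; move: h; rewrite mean_indic// => h.
rewrite -[LHS]fineK ?h//.
by rewrite ge0_fin_numE// (le_lt_trans (probability_le1 _ _))// ltry.
Qed.

Definition win (a b x : R) : R := ((a < x) && (x <= b))%:R.

Lemma winE a b : win a b = \1_(`]a, b]%classic : set R).
Proof. by apply/funext => x; rewrite indicE mem_setE in_itv/= /win. Qed.

Lemma win_ge0 a b x : 0 <= win a b x. Proof. exact: ler0n. Qed.

Lemma win_le1 a b x : win a b x <= 1. Proof. by rewrite /win; case: andP. Qed.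

Lemma bmf_win d (T : measurableType d) (a b : R) (f : T -> R) :
  measurable_fun setT f -> bmf (fun x => win a b (f x)).
Proof.
move=> mf; split; last first.
  by exists 1 => x; rewrite ger0_norm ?win_ge0// win_le1.
rewrite winE; apply: (measurableT_comp _ mf).
exact: measurable_indic.
Qed.

Lemma bmf_win0 (a b : R) : bmf (win a b).
Proof. by have := bmf_win a b (@measurable_id _ R setT). Qed.

Lemma mean_win P a b : mean P (win a b) = fine (P `]a, b]%classic).
Proof. by rewrite winE mean_indic. Qed.

Lemma mean_cvg0 P (k : nat -> R -> R) (C : R) :
  (forall n, measurable_fun setT (k n)) ->
  (\forall n \near \oo, forall x, `|k n x| <= C) ->
  (forall x, k n x @[n --> \oo] --> (0 : R)) ->
  mean P (k n) @[n --> \oo] --> (0 : R).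
Proof.
move=> mk [N _ kC] k0.
rewrite -(cvg_shiftn N).
have [] := @dominated_convergence _ _ _ P setT measurableT
  (fun n => EFin \o k (n + N)%N) (fun=> 0%E) (fun=> C%:E).
- by move=> n; apply/measurable_EFinP.
- exact: measurable_cst.
- apply: aeW => x _ /=; apply: (@cvg_EFin _ _ _ _ (fun n => (k (n + N)%N x)%:E)).
    by near=> n.
  by rewrite /= (@cvg_shiftn N _ (fun n => k n x)).
- by apply: (@bmf_integrable _ _ _ P (fun=> C)); exact: bmf_cst.
- apply: aeW => x n _ /=; rewrite lee_fin; apply: kC; exact: leq_addl.
move=> _ _; rewrite integral0 => h.
by apply: (@cvg_comp _ _ _ _ fine _ _ _ h); exact: fine_cvg.
Unshelve. all: by end_near. Qed.

End real_line.

Lemma mf_cos {R : realType} d (T : measurableType d) (f : T -> R) :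
  measurable_fun setT f -> measurable_fun setT (fun x => cos (f x)).
Proof.
move=> mf; apply: (measurableT_comp _ mf).
by apply: continuous_measurable_fun; exact: continuous_cos.
Qed.

Lemma bmf_cos {R : realType} d (T : measurableType d) (f : T -> R) :
  measurable_fun setT f -> bmf (fun x => cos (f x)).
Proof. by move=> mf; split; [exact: mf_cos|exists 1 => x; exact: cos_max]. Qed.

Lemma bmf_sin {R : realType} d (T : measurableType d) (f : T -> R) :
  measurable_fun setT f -> bmf (fun x => sin (f x)).
Proof.
move=> mf; split; last by exists 1 => x; exact: sin_max.
apply: (measurableT_comp _ mf).
by apply: continuous_measurable_fun; exact: continuous_sin.
Qed.

Section measurable_fun_pointwise.
Context {R : realType} d {T : measurableType d} d1 d2 {T1 : measurableType d1}
  {T2 : measurableType d2}.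
Implicit Types f g : T -> R.

Lemma mfD f g : measurable_fun setT f -> measurable_fun setT g ->
  measurable_fun setT (fun x => f x + g x).
Proof. exact: measurable_funD. Qed.

Lemma mfB f g : measurable_fun setT f -> measurable_fun setT g ->
  measurable_fun setT (fun x => f x - g x).
Proof. exact: measurable_funB. Qed.

Lemma mfM f g : measurable_fun setT f -> measurable_fun setT g ->
  measurable_fun setT (fun x => f x * g x).
Proof. exact: measurable_funM. Qed.

Lemma mfN f : measurable_fun setT f -> measurable_fun setT (fun x => - f x).
Proof. exact: measurable_funN. Qed.

Lemma mf1 (f : T -> T1 * T2) : measurable_fun setT f ->
  measurable_fun setT (fun x => (f x).1).
Proof. exact: (measurableT_comp measurable_fst). Qed.

Lemma mf2 (f : T -> T1 * T2) : measurable_fun setT f ->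
  measurable_fun setT (fun x => (f x).2).
Proof. exact: (measurableT_comp measurable_snd). Qed.

End measurable_fun_pointwise.

Ltac mf :=
  cbv beta;
  first
  [ assumption
  | exact: measurable_cst
  | exact: measurable_id
  | exact: measurable_fst
  | exact: measurable_snd
  | refine (mfB _ _); mf
  | refine (mfD _ _); mf
  | refine (mfM _ _); mf
  | refine (mfN _); mf
  | refine (mf1 _); mf
  | refine (mf2 _); mf ].

Ltac bm :=
  cbv beta;
  first
  [ assumption
  | lazymatch goal with |- bmf (fun x => mean ?Q (@?f x)) =>
      refine (@bmf_mean _ _ _ _ _ Q f _); bm end
  | exact: bmf_cst
  | refine (bmfB _ _); bm
  | refine (bmfD _ _); bm
  | refine (bmfM _ _); bm
  | refine (bmfN _); bm
  | refine (bmf_norm _); bm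
  | exact: bmf_win0
  | refine (bmf_win _ _ _); mf
  | refine (bmf_cos _); mf
  | refine (bmf_sin _); mf
  | refine (bmf_sum _ _ _); intro; bm
  | match goal with H : bmf ?f |- bmf (fun x => ?f (@?g x)) =>
      refine (@bmf_comp _ _ _ _ _ f g H _); mf end
  | match goal with H : forall i, bmf _ |- _ => refine (@bmf_comp _ _ _ _ _ _ _ (H _) _); mf end
  ].

(** * Orders of magnitude at infinity *)

Section near_pinfty.
Context {R : realType}.
Implicit Types (P : R -> Prop) (f g h : R -> R).

Lemma pinfty_ex P : (\forall x \near +oo, P x) ->
  exists2 M : R, 0 <= M & forall x, M <= x -> P x.
Proof.
move=> [M [_ MP]]; exists (`|M| + 1); first by rewrite addr_ge0.
by move=> x Mx; apply: MP; have := ler_norm M; lra.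
Qed.

Lemma pinfty_near M P : (forall x, M <= x -> P x) -> \forall x \near +oo, P x.
Proof. by move=> MP; exists M; split; [exact: num_real|move=> x /ltW /MP]. Qed.

Lemma near_ge (M : R) : \forall x \near +oo, M <= x.
Proof. by apply: (@pinfty_near M). Qed.

Lemma pinfty_shift (t : R) P :
  (\forall x \near +oo, P x) -> \forall x \near +oo, P (x + t).
Proof.
move=> /pinfty_ex[M _ MP]; apply: (@pinfty_near (M - t)) => x Mx.
by apply: MP; lra.
Qed.

End near_pinfty.
Arguments pinfty_ex {R P}.
Arguments pinfty_near {R} M {P}.
Arguments pinfty_shift {R} t {P}.

Section orders.
Context {R : realType} (h : R -> R) (h0 : forall x, 0 <= h x).
Implicit Types f g : R -> R.

(** There is no absolute value on [f]: the liminf hypotheses control increments from one side only.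
    A two-sided statement is [upo] of a norm. *)
Definition upo f := forall e : R, 0 < e -> \forall x \near +oo, f x <= e * h x.

Definition bigo f := exists2 C : R, 0 <= C & \forall x \near +oo, f x <= C * h x.

Lemma upo_le f g : (\forall x \near +oo, f x <= g x) -> upo g -> upo f.
Proof.
move=> fg og e e0; have {}og := og _ e0; near=> x.
by rewrite (@le_trans _ _ (g x))//; near: x.
Unshelve. all: by end_near. Qed.

Lemma bigo_le f g : (\forall x \near +oo, f x <= g x) -> bigo g -> bigo f.
Proof.
move=> fg [C C0 gC]; exists C => //; near=> x.
by rewrite (@le_trans _ _ (g x))//; near: x.
Unshelve. all: by end_near. Qed.

Lemma upoD f g : upo f -> upo g -> upo (fun x => f x + g x).
Proof.
move=> of_ og e e0; have e20 : 0 < e / 2 by lra.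
have {}of_ := of_ _ e20; have {}og := og _ e20; near=> x.
have : f x <= e / 2 * h x by near: x.
have : g x <= e / 2 * h x by near: x.
lra.
Unshelve. all: by end_near. Qed.

Lemma bigoD f g : bigo f -> bigo g -> bigo (fun x => f x + g x).
Proof.
move=> [C C0 fC] [D D0 gD]; exists (C + D); first by lra.
near=> x.
have : f x <= C * h x by near: x.
have : g x <= D * h x by near: x.
rewrite mulrDl; lra.
Unshelve. all: by end_near. Qed.

Lemma upo0 : upo (fun=> 0).
Proof. by move=> e e0; apply: nearW => x; rewrite mulr_ge0// ltW. Qed.

Lemma bigo0 : bigo (fun=> 0).
Proof. by exists 0 => //; apply: nearW => x; rewrite mul0r. Qed.

Lemma upoZ c f : 0 <= c -> upo f -> upo (fun x => c * f x).
Proof.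
rewrite le_eqVlt => /predU1P[<-|c0] of_ e e0.
  by apply: nearW => x; rewrite mul0r mulr_ge0// ltW.
have /of_{}of_ : 0 < e / c by exact: divr_gt0.
near=> x; rewrite -ler_pdivlMl// mulrA (mulrC c^-1).
by near: x.
Unshelve. all: by end_near. Qed.

Lemma bigoZ c f : 0 <= c -> bigo f -> bigo (fun x => c * f x).
Proof.
move=> c0 [C C0 fC]; exists (c * C); first exact: mulr_ge0.
near=> x; rewrite -mulrA ler_wpM2l//.
by near: x.
Unshelve. all: by end_near. Qed.

Lemma upo_sum (n : nat) (F : nat -> R -> R) :
  (forall i, (i < n)%N -> upo (F i)) -> upo (fun x => \sum_(i < n) F i x).
Proof.
elim: n => [|n ih] oF.
  by under [X in upo X]funext do rewrite big_ord0; exact: upo0.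
under [X in upo X]funext do rewrite big_ord_recr/=.
by apply: upoD; [apply: ih => i /ltnW; exact: oF|exact: oF].
Qed.

Lemma bigo_sum (n : nat) (F : nat -> R -> R) :
  (forall i, (i < n)%N -> bigo (F i)) -> bigo (fun x => \sum_(i < n) F i x).
Proof.
elim: n => [|n ih] oF.
  by under [X in bigo X]funext do rewrite big_ord0; exact: bigo0.
under [X in bigo X]funext do rewrite big_ord_recr/=.
by apply: bigoD; [apply: ih => i /ltnW; exact: oF|exact: oF].
Qed.

Lemma upo_bigo f : upo f -> bigo f.
Proof. by move=> of_; exists 1 => //; exact: of_. Qed.

(** Lets an estimate be proved up to a fixed multiple of the target error. The division is by
    [C + 1] because [C] may be zero. *)
Lemma upo_eps f (C : R) : 0 <= C ->
  (forall e, 0 < e -> \forall x \near +oo, f x <= (C * e) * h x) -> upo f.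
Proof.
move=> C0 hf e e0; have e'0 : 0 < e / (C + 1) by apply: divr_gt0 => //; lra.
have {}hf := hf _ e'0; near=> x.
rewrite (@le_trans _ _ ((C * (e / (C + 1))) * h x))//; first by near: x.
rewrite ler_wpM2r// mulrCA -[leRHS]mulr1 ler_wpM2l ?ltW//.
by rewrite ltr_pdivrMr; lra.
Unshelve. all: by end_near. Qed.

End orders.

Section windows.
Context {R : realType}.
Implicit Types (P Q A B G : probability R R) (x y z a b c : R).

Lemma winD a b c x : a <= b -> b <= c -> win a b x + win b c x = win a c x.
Proof.
move=> ab bc; rewrite /win.
have [|] := leP x a; have [|] := leP x b; have [|] := leP x c => /=; lra.
Qed.

Lemma le_win a b c d x : c <= a -> b <= d -> win a b x <= win c d x.
Proof.
move=> ca bd; rewrite /win.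
case: ltP => ?; case: (leP x b) => ?; rewrite ?ler0n//=.
have -> : c < x by lra.
by have -> : x <= d by lra.
Qed.

Lemma win_shift a b x y : win a b (x + y) = win (a - y) (b - y) x.
Proof. by rewrite /win ltrBlDr lerBrDr. Qed.

Lemma mean_winD P a b c : a <= b -> b <= c ->
  mean P (win a b) + mean P (win b c) = mean P (win a c).
Proof.
move=> ab bc; rewrite -meanD; [|exact: bmf_win0..].
by congr mean; apply/funext => x; rewrite winD.
Qed.

Lemma le_mean_win P a b c d : c <= a -> b <= d ->
  mean P (win a b) <= mean P (win c d).
Proof. by move=> ca bd; apply: ler_mean => [||x]; [exact: bmf_win0..|exact: le_win]. Qed.

Lemma mean_win_ge0 P a b : 0 <= mean P (win a b).
Proof. by apply: mean_ge0 => x; exact: win_ge0. Qed.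

Lemma mean_win_le1 P a b : mean P (win a b) <= 1.
Proof.
rewrite -(mean_cst P 1); apply: ler_mean => [||x]; [exact: bmf_win0|exact: bmf_cst|].
exact: win_le1.
Qed.

Lemma mean_win_lt0 P a b : supp_ge0 P -> b < 0 -> mean P (win a b) = 0.
Proof.
move=> P0 b0; transitivity (mean P (fun=> 0)); last by rewrite mean_cst.
apply: eq_mean_supp => [//|||x x0]; [exact: bmf_win0|exact: bmf_cst|].
by rewrite /win; rewrite (_ : (x <= b) = false) ?andbF//; apply/negbTE; rewrite -ltNge; lra.
Qed.

Lemma mean_conv2 P Q (f : R -> R) : bmf f ->
  mean (convp P Q) f = mean Q (fun y => mean P (fun x => f (x + y))).
Proof.
move=> bf; rewrite mean_convolution//.
by refine (mean_fubini P Q (f := fun x y => f (x + y)) _); bm.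
Qed.

Lemma mean_convC P Q (f : R -> R) : bmf f ->
  mean (convp P Q) f = mean (convp Q P) f.
Proof.
move=> bf; rewrite mean_conv2// mean_convolution//; congr mean; apply/funext => y.
by congr mean; apply/funext => x; rewrite addrC.
Qed.

Lemma mean_conv_win P Q a b :
  mean (convp P Q) (win a b) = mean Q (fun y => mean P (win (a - y) (b - y))).
Proof.
rewrite mean_conv2; last exact: bmf_win0.
congr mean; apply/funext => y; congr mean; apply/funext => x; exact: win_shift.
Qed.

Lemma mean_win_sum P z T n : 0 <= T ->
  mean P (win z (z + T *+ n)) = \sum_(i < n) mean P (win (z + T *+ i) (z + T *+ i + T)).
Proof.
move=> T0; elim: n => [|n ih].
  rewrite mulr0n addr0 big_ord0 -[RHS](mean_cst P); congr mean; apply/funext => x.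
  by rewrite /win; have [|] := leP x z.
rewrite big_ord_recr/= -ih mean_winD; last 2 first.
  by rewrite lerDl mulrn_wge0.
  by rewrite lerDl.
by rewrite -addrA -mulrSr.
Qed.

Lemma bmf_winB P (a b : R) : bmf (fun y => mean P (win (a - y) (b - y))).
Proof.
have -> : (fun y => mean P (win (a - y) (b - y))) =
          fun y => mean P (fun x => win a b (x + y)).
  by apply/funext => y; congr mean; apply/funext => x; rewrite win_shift.
bm.
Qed.

End windows.

(** * Window masses and the gauge *)

Definition wmass {R : realType} (T : R) (P : probability R R) (x : R) : R :=
  mean P (win x (x + T)).

Lemma wmass_ge0 {R : realType} (T : R) (P : probability R R) x : 0 <= wmass T P x.
Proof. exact: mean_win_ge0. Qed.

Section gauge.
Context {R : realType} (T : R) (T0 : 0 < T) (H : probability R R).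
Local Notation w := (wmass T).
Local Notation h := (w H).
Hypothesis H0 : supp_ge0 H.
Hypothesis h_long : forall t e : R, 0 < e ->
  \forall x \near +oo, `|h x - h (x + t)| <= e * h x.
Hypothesis h_conv : bigo h (w (convp H H)).
Implicit Types (A B G : probability R R) (f : R -> R).

Lemma h_shift_le (t : R) : \forall x \near +oo, h (x + t) <= 2 * h x.
Proof.
have := h_long t ltr01; apply: filterS => x; rewrite ler_norml; lra.
Qed.

Lemma bigo_shift (t : R) f : bigo h f -> bigo h (fun x => f (x + t)).
Proof.
move=> [C C0 fC]; exists (C * 2); first by rewrite mulr_ge0.
have := pinfty_shift t fC; have := h_shift_le t.
apply: filterS2 => x hx /le_trans; apply.
by rewrite -mulrA ler_wpM2l.
Qed.

Lemma upo_shift (t : R) f : upo h f -> upo h (fun x => f (x + t)).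
Proof.
move=> of_ e e0; have e20 : 0 < e / 2 by lra.
have := pinfty_shift t (of_ _ e20); have := h_shift_le t.
apply: filterS2 => x hx /le_trans; apply.
have := ler_wpM2l (ltW e20) hx; lra.
Qed.

Lemma win_cover A (a b : R) : exists n : nat,
  forall x, mean A (win (x + a) (x + b)) <= \sum_(i < n) w A (x + (a + T *+ i)).
Proof.
exists (Num.bound `|(b - a) / T|) => x.
set n := Num.bound _.
have bn : b - a <= T *+ n.
  have : (b - a) / T <= n%:R.
    by rewrite (le_trans (ler_norm _))// ltW// archi_boundP.
  by rewrite ler_pdivrMr// mulr_natl.
rewrite (@le_trans _ _ (mean A (win (x + a) (x + a + T *+ n))))//.
  by apply: le_mean_win => //; lra.
rewrite (mean_win_sum _ _ _ (ltW T0)) le_eqVlt; apply/predU1l/eq_bigr => i _.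
by rewrite /wmass addrA.
Qed.

Lemma bigo_win A (a b : R) : bigo h (w A) ->
  bigo h (fun x => mean A (win (x + a) (x + b))).
Proof.
move=> dA; have [n hn] := win_cover A a b.
apply: bigo_le; first exact: nearW hn.
apply: (@bigo_sum _ _ n (fun i x => w A (x + (a + T *+ i)))) => i _.
exact: bigo_shift.
Qed.

Lemma upo_win A (a b : R) : upo h (w A) ->
  upo h (fun x => mean A (win (x + a) (x + b))).
Proof.
move=> dA; have [n hn] := win_cover A a b.
apply: upo_le; first exact: nearW hn.
apply: (@upo_sum _ _ _ n (fun i x => w A (x + (a + T *+ i)))) => [x|i _].
  exact: wmass_ge0.
exact: upo_shift.
Qed.

Lemma wmass_convE A B (x : R) : w (convp A B) x = mean B (fun y => w A (x - y)).
Proof.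
rewrite /wmass mean_conv_win; congr mean; apply/funext => y.
by rewrite addrAC.
Qed.

Lemma wmass_convC A B (x : R) : w (convp A B) x = w (convp B A) x.
Proof. by rewrite /wmass mean_convC//; exact: bmf_win0. Qed.

Lemma bmf_wmass A (x : R) : bmf (fun y : R => w A (x - y)).
Proof.
have := bmf_winB A x (x + T); congr bmf; apply/funext => y.
by rewrite /wmass addrAC.
Qed.

(** The common pattern of the convolution estimates: for y <= x - x0 the window of [G] at x - y
    starts beyond x0, where an asymptotic bound applies; the other y contribute only through a
    window of [B] of fixed length around x. *)
Lemma mean_split G B (psi : R -> R) (x x0 b c K : R) :
  bmf psi -> 0 <= c -> 0 <= K ->
  (forall y, y <= x - x0 -> psi y <= c * w G (x - y)) ->
  (forall y, x - x0 < y -> psi y <= K * win (x - x0) (x + b) y) ->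
  mean B psi <= c * w (convp G B) x + K * mean B (win (x - x0) (x + b)).
Proof.
move=> bpsi c0 K0 h1 h2; rewrite wmass_convE.
have bG := bmf_wmass G x; have bw := bmf_win0 (x - x0) (x + b).
rewrite -(meanZ B c bG) -(meanZ B K bw) -meanD; [|by bm..].
apply: ler_mean => [//||y]; first by bm.
have [yx|yx] := leP y (x - x0).
  by rewrite (le_trans (h1 _ yx))// lerDl mulr_ge0// win_ge0.
by rewrite (le_trans (h2 _ yx))// lerDr mulr_ge0// wmass_ge0.
Qed.

Lemma wmass_le_win A (z x x0 : R) : supp_ge0 A -> x - x0 < z ->
  w A (x - z) <= win (x - x0) (x + T) z.
Proof.
move=> A0 zx; have [zb|zb] := leP z (x + T).
  by rewrite /win zx zb/= /wmass mean_win_le1.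
by rewrite /wmass mean_win_lt0 ?win_ge0//; lra.
Qed.

Lemma wmass_conv_split A G B (x x0 c : R) : supp_ge0 A -> 0 <= c ->
  (forall z, x0 <= z -> w A z <= c * w G z) ->
  w (convp A B) x <=
  c * w (convp G B) x + mean B (win (x - x0) (x + T)).
Proof.
move=> A0 c0 AG; rewrite wmass_convE.
rewrite -[X in _ <= _ + X]mul1r; apply: mean_split => //.
- exact: bmf_wmass.
- by move=> y yx; apply: AG; lra.
- by move=> y yx; rewrite mul1r wmass_le_win.
Qed.

(** [A] is replaced by [H] under the convolution, then, after commuting, [B] is, which leads to w (H
    * H) = O(h). Each replacement costs a window of bounded length. *)
Lemma bigo_conv A B : supp_ge0 A -> supp_ge0 B ->
  bigo h (w A) -> bigo h (w B) -> bigo h (w (convp A B)).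
Proof.
move=> A0 B0 [C C0 /pinfty_ex[x0 x00 AC]] dB.
have [D D0 /pinfty_ex[x1 x10 BD]] := dB.
apply: (@bigo_le _ _ _ (fun x => C * (D * w (convp H H) x +
    mean H (win (x + - x1) (x + T))) + mean B (win (x + - x0) (x + T)))).
  apply: nearW => x.
  rewrite (le_trans (wmass_conv_split _ _ A0 C0 AC))// lerD2r ler_wpM2l//.
  by rewrite wmass_convC; exact: wmass_conv_split.
apply: bigoD; last exact: bigo_win.
apply: bigoZ => //; apply: bigoD; first exact: bigoZ.
by apply: bigo_win; exists 1 => //; apply: nearW => x; rewrite mul1r.
Qed.

End gauge.

Lemma exchange_triangle {V : nmodType} (a : nat -> nat -> V) (K : nat) :
  \sum_(N < K) \sum_(i < N.+1) a i (N - i)%N =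
  \sum_(i < K) \sum_(j < K - i) a i j.
Proof.
elim: K => [|K ih]; first by rewrite !big_ord0.
rewrite big_ord_recr/= ih [RHS]big_ord_recr/= subSnn.
rewrite [X in _ = _ + X]big_ord_recl big_ord0 addr0.
rewrite [X in _ + X = _]big_ord_recr/= subnn addrA; congr +%R.
rewrite -big_split/=; apply: eq_bigr => i _.
by rewrite subSn 1?ltnW// big_ord_recr.
Qed.

(** * Compound Poisson laws as exponential series *)

Section compound_poisson_mean.
Context {R : realType}.
Implicit Types (P Q F : probability R R) (f g : R -> R) (m : {nonneg R}).

Lemma mean_convpow0 P f : bmf f -> mean (convpow P 0) f = f 0.
Proof. exact: mean_dirac. Qed.

Lemma mean_convpowS P n f : bmf f ->
  mean (convpow P n.+1) f =
  mean P (fun x => mean (convpow P n) (fun y => f (x + y))).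
Proof.
move=> bf; case: n => [|n].
  congr mean; apply/funext => x; rewrite mean_convpow0 ?addr0//; bm.
by rewrite -mean_convolution.
Qed.

Lemma mean_convpowD P i j f : bmf f ->
  mean (convpow P (i + j)) f =
  mean (convpow P i) (fun x => mean (convpow P j) (fun y => f (x + y))).
Proof.
elim: i f => [|i ih] f bf.
  rewrite mean_convpow0 ?add0n; last by bm.
  by congr mean; apply/funext => y; rewrite add0r.
rewrite addSn mean_convpowS// mean_convpowS; last by bm.
congr mean; apply/funext => x; rewrite ih; last by bm.
congr mean; apply/funext => y; congr mean; apply/funext => z.
by rewrite addrA.
Qed.

Lemma supp_ge0_convpow P n : supp_ge0 P -> supp_ge0 (convpow P n).
Proof.
move=> P0; case: n => [|n].
  by rewrite /supp_ge0/= diracE memNset//= in_itv/= ltxx.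
by elim: n => [//|n ih]; exact: supp_ge0_convolution.
Qed.

Definition cpois m F : probability R R := compound_poisson m F.

Definition expcoeff (t : R) (k : nat) : R := t ^+ k / k`!%:R.

Lemma expcoeff_ge0 t k : 0 <= t -> 0 <= expcoeff t k.
Proof. by move=> t0; rewrite divr_ge0// exprn_ge0. Qed.

Lemma expcoeffD (s t : R) N :
  \sum_(i < N.+1) expcoeff s i * expcoeff t (N - i) = expcoeff (s + t) N.
Proof.
rewrite /expcoeff [s + t]addrC exprDn mulr_suml; apply: eq_bigr => i _.
have iN : (i <= N)%N by rewrite -ltnS.
have /(congr1 (fun n : nat => n%:R : R)) := bin_fact iN.
rewrite !natrM => <-.
have i0 : i`!%:R != 0 :> R by rewrite pnatr_eq0 -lt0n fact_gt0.
have j0 : (N - i)`!%:R != 0 :> R by rewrite pnatr_eq0 -lt0n fact_gt0.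
have b0 : 'C(N, i)%:R != 0 :> R by rewrite pnatr_eq0 -lt0n bin_gt0.
rewrite -mulr_natr; field.
by rewrite i0 j0 b0.
Qed.

Lemma expcoeffZ (c t : R) k : expcoeff (c * t) k = c ^+ k * expcoeff t k.
Proof. by rewrite /expcoeff exprMn mulrA. Qed.

Lemma mean_compound_poisson_cvg m F f : bmf f ->
  (\sum_(k < K) expcoeff m%:num k * mean (convpow F k) f) @[K --> \oo] -->
  expR m%:num * mean (cpois m F) f.
Proof.
have ge0_cvg g : bmf g -> (forall x, 0 <= g x) ->
    (\sum_(k < K) expcoeff m%:num k * mean (convpow F k) g) @[K --> \oo] -->
    expR m%:num * mean (cpois m F) g.
  move=> bg g0.
  have ig P : (\int[P]_x (g x)%:E = (mean P g)%:E)%E.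
    rewrite /mean /Rintegral fineK//; apply: integrable_fin_num => //.
    exact: bmf_integrable.
  have wt0 k : 0 <= expcoeff m%:num k by exact: expcoeff_ge0.
  pose nu := mscale (NngNum (expR_ge0 (- m%:num)))
    (mseries (fun k => mscale (NngNum (wt0 k)) (convpow F k)) 0).
  have mg : measurable_fun setT (EFin \o g) by apply/measurable_EFinP; case: bg.
  have : ((mean (cpois m F) g)%:E = (expR (- m%:num))%:E *
      \sum_(0 <= k <oo) (expcoeff m%:num k * mean (convpow F k) g)%:E)%E.
    rewrite -ig (eq_measure_integral nu); last by [].
    rewrite ge0_integral_mscale//; last by move=> x _; rewrite lee_fin.
    rewrite ge0_integral_measure_series//; last by move=> x _; rewrite lee_fin.
    congr (_ * _)%E; apply: eq_eseriesr => k _.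
    rewrite ge0_integral_mscale//; last by move=> x _; rewrite lee_fin.
    by rewrite ig EFinM.
  move/(congr1 (fun z => (expR m%:num)%:E * z)%E).
  rewrite muleA -!EFinM -expRD subrr expR0 mul1e => sE.
  have := @is_cvg_nneseries R (fun k => (expcoeff m%:num k * mean (convpow F k) g)%:E)
    xpredT 0%N.
  move=> /(_ _)/wrap[k _ _|].
    by rewrite lee_fin mulr_ge0// mean_ge0.
  rewrite -sE => /fine_cvg.
  apply: cvg_trans; apply: near_eq_cvg; apply: nearW => K /=.
  by rewrite sumEFin/= big_mkord.
(* A bounded [f] is the difference of the nonnegative functions [f + M] and [M], to which [ge0_cvg]
   applies. *)
move=> bf; have [_ [M fM]] := bf.
have M0 : 0 <= M by rewrite (le_trans _ (fM 0)).
have bfM : bmf (fun x => f x + M) by bm; exact: bmf_cst.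
have bM : bmf (fun _ : R => M) by exact: bmf_cst.
have fM0 x : 0 <= f x + M by have := fM x; rewrite ler_norml; lra.
have := cvgB (ge0_cvg _ bfM fM0) (ge0_cvg _ bM (fun=> M0)).
rewrite -mulrBr -meanB//.
under [X in mean _ X]funext do rewrite addrK.
move=> /(_ _) h; apply: cvg_trans h; apply: near_eq_cvg; apply: nearW => K /=.
rewrite !fctE/= -sumrB; apply: eq_bigr => k _.
rewrite -mulrBr -meanB//; congr (_ * mean _ _).
by apply/funext => x; rewrite addrK.
Qed.

Lemma mean_compound_poisson_ge m F g K : bmf g -> (forall x, 0 <= g x) ->
  \sum_(k < K) expcoeff m%:num k * mean (convpow F k) g <=
  expR m%:num * mean (cpois m F) g.
Proof.
move=> bg g0; have /cvgr_to_ge := @mean_compound_poisson_cvg m F g bg; apply.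
near=> N; have KN : (K <= N)%N by near: N; exact: nbhs_infty_ge.
rewrite -(subnKC KN) big_split_ord/= lerDl sumr_ge0// => i _.
by rewrite mulr_ge0 ?expcoeff_ge0// mean_ge0.
Unshelve. all: by end_near. Qed.

(** For k >= K the k-th coefficient for intensity [m] is 2^-k times the one for [m2], hence at most
    2^-K times it: doubling the intensity pays for the truncation. *)
Lemma mean_compound_poisson_tail m m2 F g K : bmf g -> m2%:num = 2 * m%:num ->
  `|expR m%:num * mean (cpois m F) g -
    \sum_(k < K) expcoeff m%:num k * mean (convpow F k) g| <=
  2 ^- K * (expR m2%:num * mean (cpois m2 F) (fun x => `|g x|)).
Proof.
move=> bg m2E; have bng := bmf_norm bg.
have := @mean_compound_poisson_cvg m F g bg.
move=> /cvgB => /(_ _ _ (cvg_cst (\sum_(k < K) expcoeff m%:num k * mean (convpow F k) g))).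
move=> /cvg_norm/cvgr_to_le; apply.
near=> N; have KN : (K <= N)%N by near: N; exact: nbhs_infty_ge.
rewrite !fctE/= -(subnKC KN) big_split_ord/= addrAC subrr add0r.
rewrite (le_trans (ler_norm_sum _ _ _))//.
have h := @mean_compound_poisson_ge m2 F _ (K + (N - K))%N bng (fun x => normr_ge0 (g x)).
rewrite -ler_pdivrMl ?invr_gt0 ?exprn_gt0// invrK (le_trans _ h)//.
rewrite big_split_ord/= (@le_trans _ _ (\sum_(i < N - K) expcoeff m2%:num (K + i) *
    mean (convpow F (K + i)) (fun x => `|g x|)))//; last first.
  by rewrite lerDr sumr_ge0// => i _; rewrite mulr_ge0 ?expcoeff_ge0// mean_ge0.
rewrite mulr_sumr; apply: ler_sum => i _.
rewrite normrM m2E expcoeffZ (ger0_norm (expcoeff_ge0 _ _))// mulrA.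
rewrite ler_pM ?ler_norm_mean ?mulr_ge0 ?expcoeff_ge0 ?exprn_ge0//.
by rewrite ler_wpM2r ?expcoeff_ge0// ler_eXn2l ?leq_addr// ltr1n.
Unshelve. all: by end_near. Qed.

(** The law of intensity [m2] is the convolution square of the law of intensity [m]. Only an
    inequality is proved: the sums over the triangle i + j < K are bounded by the product of the two
    series. *)
Lemma mean_compound_poisson_double m m2 F g : bmf g -> (forall x, 0 <= g x) ->
  m2%:num = 2 * m%:num ->
  mean (cpois m2 F) g <=
  mean (convp (cpois m F) (cpois m F)) g.
Proof.
move=> bg g0 m2E.
rewrite -(ler_pM2l (expR_gt0 m2%:num)).
have /cvgr_to_le := @mean_compound_poisson_cvg m2 F g bg; apply; apply: nearW => K.
have -> : expR m2%:num = expR m%:num * expR m%:num.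
  by rewrite m2E -expRD mulrDl mul1r.
rewrite mean_convolution//.
set G := fun x => mean (cpois m F) (fun y => g (x + y)).
have bG : bmf G by rewrite /G; bm.
rewrite -mulrA (@le_trans _ _ (expR m%:num * \sum_(i < K) expcoeff m%:num i *
   mean (convpow F i) G))//; last first.
  rewrite ler_wpM2l ?expR_ge0// mean_compound_poisson_ge// => x.
  exact: mean_ge0.
rewrite (eq_bigr (fun N : 'I_K => \sum_(i < N.+1) expcoeff m%:num i *
   (expcoeff m%:num (N - i) * mean (convpow F (i + (N - i))) g))); last first.
  move=> N _; rewrite m2E mulrDl mul1r -expcoeffD mulr_suml.
  apply: eq_bigr => i _; rewrite -mulrA subnKC//.
  by rewrite -ltnS.
rewrite (exchange_triangle (fun i j => expcoeff m%:num i *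
   (expcoeff m%:num j * mean (convpow F (i + j)) g))).
rewrite mulr_sumr; apply: ler_sum => i _.
rewrite -mulr_sumr mulrCA ler_wpM2l ?expcoeff_ge0//.
rewrite -meanZ//; last first.
under eq_bigr do (rewrite mean_convpowD// -meanZ; last by bm).
rewrite -mean_sum; last first.
  by move=> j; bm; exact: bmf_cst.
apply: ler_mean => [||x]; [by bm; exact: bmf_cst..|].
rewrite /G; apply: mean_compound_poisson_ge => //; bm.
Qed.

End compound_poisson_mean.

Section one_sided_fatou.
Context {R : realType}.
Implicit Types (P : probability R R).

(** A one-sided reverse Fatou lemma. The positive part of k x y / g x is bounded on [B] and tends to
    0 at each y, so dominated convergence applies along every sequence tending to +oo; the smallness
    need not be uniform in y. *)
Lemma mean_upo (P : probability R R) (B : set R) (k : R -> R -> R) (g : R -> R) (C : R) :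
  measurable B -> (forall x, bmf (k x)) -> (\forall x \near +oo, 0 < g x) ->
  (\forall x \near +oo, forall y, B y -> k x y <= C * g x) ->
  (forall y, B y -> upo g (k ^~ y)) ->
  upo g (fun x => mean P (fun y => \1_B y * k x y)).
Proof.
move=> mB bk g0 kC ok.
have b1 : bmf (\1_B : R -> R).
  split; first exact: measurable_indic.
  by exists 1 => x; rewrite indicE; case: (_ \in _); rewrite /= ?normr1 ?normr0.
pose pp (a : R) := (`|a| + a) / 2.
have pp_ge0 a : 0 <= pp a by rewrite /pp; have := ler_norm (- a); rewrite normrN; lra.
have pp_ge a : a <= pp a by rewrite /pp; have := ler_norm a; lra.
have pp_le a c : 0 <= c -> a <= c -> pp a <= c.
  by rewrite /pp => c0 ac; have [a0|a0] := ger0P a; lra.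
pose r x y : R := \1_B y * pp ((g x)^-1 * k x y).
have br x : bmf (r x).
  rewrite /r /pp; have bkx := bk x; bm.
have r0 x y : 0 <= r x y by rewrite /r mulr_ge0// indicE ler0n.
have rC : mean P (r x) @[x --> +oo] --> (0 : R).
  apply/cvg_pinftyP => u uoo; apply: (mean_cvg0 P (C := `|C|)).
  - by move=> n; case: (br (u n)).
  - have : \forall n \near \oo, 0 < g (u n) /\ forall y, B y -> k (u n) y <= C * g (u n).
      exact: (uoo _ (filterI g0 kC)).
    apply: filterS => n /= [gn kn] y; rewrite ger0_norm// /r indicE.
    have [/set_mem By|_] := boolP (y \in B); rewrite ?mul0r// mul1r.
    apply: pp_le => //; rewrite mulrC ler_pdivrMr//.
    by rewrite (le_trans (kn _ By))// ler_wpM2r ?ler_norm// ltW.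
  - move=> y; have [yB|yB] := boolP (y \in B); last first.
      by rewrite /r indicE (negbTE yB) (_ : (fun _ => _) = cst 0);
        [exact: cvg_cst|apply/funext => n; rewrite mul0r].
    apply/cvgrPdist_le => e e0.
    have : \forall n \near \oo, 0 < g (u n) /\ k (u n) y <= e * g (u n).
      exact: (uoo _ (filterI g0 (ok _ (set_mem yB) _ e0))).
    apply: filterS => n /= [gn kn]; rewrite sub0r normrN ger0_norm//.
    rewrite /r indicE yB mul1r; apply: pp_le; first exact: ltW.
    by rewrite mulrC ler_pdivrMr.
move=> e e0; move/cvgrPdist_le : rC => /(_ _ e0) rC.
near=> x; have bkx := bk x; have gx : 0 < g x by near: x.
have rx : mean P (r x) <= e.
  have : `|0 - mean P (r x)| <= e by near: x.
  by rewrite sub0r normrN; exact: le_trans (ler_norm _).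
rewrite mulrC -ler_pdivrMl// (le_trans _ rx)// -meanZ; last by bm.
apply: ler_mean => [||y]; [by bm|by []|].
by rewrite /r mulrCA ler_wpM2l.
Unshelve. all: by end_near. Qed.

End one_sided_fatou.

Lemma bmf_indic {R : realType} (B : set R) : measurable B -> bmf (\1_B : R -> R).
Proof.
move=> mB; split; first exact: measurable_indic.
by exists 1 => x; rewrite indicE; case: (_ \in _); rewrite /= ?normr1 ?normr0.
Qed.

Lemma mass_bounded {R : realType} (P : probability R R) (e M : R) : 0 < e ->
  exists2 A : R, M <= A & 1 - e <= mean P (win (- A) A).
Proof.
move=> e0.
have h : mean P (fun x => 1 - win (- n%:R) n%:R x) @[n --> \oo] --> (0 : R).
  apply: (mean_cvg0 P (C := 1)).
  - by move=> n; have [] : bmf (fun x : R => 1 - win (- n%:R) n%:R x) by bm.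
  - apply: nearW => n x; rewrite ger0_norm ?subr_ge0 ?win_le1//.
    by rewrite gerBl win_ge0.
  - move=> x; apply: cvg_near_cst; near=> n.
    have : `|x| < n%:R by near: n; exact: nbhs_infty_gtr.
    by rewrite ltr_norml => /andP[xn /ltW nx]; rewrite /win xn nx subrr.
have : \forall n \near \oo, `|mean P (fun x => 1 - win (- n%:R) n%:R x)| <= e.
  by move/cvgr0_norm_le : h; apply.
move=> h'; near \oo => n; exists n%:R; first by near: n; exact: nbhs_infty_ger.
have : `|mean P (fun x => 1 - win (- n%:R) n%:R x)| <= e by near: n.
rewrite meanB ?mean_cst; [|exact: bmf_cst|exact: bmf_win0].
rewrite ger0_norm ?subr_ge0 ?mean_win_le1//; lra.
Unshelve. all: by end_near. Qed.

Lemma ler_norm_cosB {R : realType} (u v : R) : `|cos u - cos v| <= `|u - v|.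
Proof.
wlog uv : u v / u <= v => [hw|].
  have [/hw//|/ltW/hw] := leP u v; by rewrite distrC (distrC v).
have [c _ h] := @MVT_segment R cos (fun x => - sin x) u v uv
  (fun x _ => is_derive_cos x) (continuous_subspaceT (@continuous_cos R)).
rewrite distrC h normrM normrN (distrC u) -[leRHS]mul1r ler_wpM2r//.
exact: sin_max.
Qed.

(** On a cell of length [d] a function with Lipschitz constant [L] varies by at most [L * d]. This
    converts statements on masses of short windows into statements on Fourier modes. *)
Lemma mean_partition {R : realType} (V : probability R R) (c : R -> R) (L a d : R) (N : nat) :
  bmf c -> (forall u v, `|c u - c v| <= L * `|u - v|) -> 0 <= L -> 0 <= d ->
  `|mean V (fun y => win a (a + d *+ N) y * c y) -
    \sum_(i < N) c (a + d *+ i) * mean V (win (a + d *+ i) (a + d *+ i + d))| <=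
  L * d * mean V (win a (a + d *+ N)).
Proof.
move=> bc cL L0 d0.
have le_ i j : (i <= j)%N -> a + d *+ i <= a + d *+ j.
  by move=> ij; rewrite lerD2l ler_wpMn2l.
have winS y : \sum_(i < N) win (a + d *+ i) (a + d *+ i + d) y = win a (a + d *+ N) y.
  elim: N => [|N ih]; first by rewrite big_ord0 mulr0n addr0 /win; case: ltP; case: leP.
  rewrite big_ord_recr/= ih -addrA -mulrSr winD//; last exact: le_.
  by rewrite -[leLHS]addr0 -[0](mulr0n d) le_.
have -> : \sum_(i < N) c (a + d *+ i) * mean V (win (a + d *+ i) (a + d *+ i + d)) =
    mean V (fun y => \sum_(i < N) c (a + d *+ i) * win (a + d *+ i) (a + d *+ i + d) y).
  rewrite mean_sum; last by move=> i; bm.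
  by apply: eq_bigr => i _; rewrite meanZ//; exact: bmf_win0.
rewrite -meanB; [|by bm..].
rewrite -meanZ; last exact: bmf_win0.
rewrite (le_trans (ler_norm_mean _ _))//; first by bm.
apply: ler_mean => [||y]; [by bm..|].
rewrite -winS mulr_suml -sumrB mulr_sumr (le_trans (ler_norm_sum _ _ _))//.
apply: ler_sum => i _; rewrite [X in _ - X]mulrC -mulrBr normrM ger0_norm ?win_ge0//.
rewrite /win; case: andP => [[y1 y2]|_]; last by rewrite mul0r mulr0.
rewrite mul1r mulr1 (le_trans (cL _ _))// ler_wpM2l// ler_norml; lra.
Qed.

(** * Fourier modes of a window *)

Section oscillation.
Context {R : realType} (T : R) (T0 : 0 < T) (H : probability R R).
Local Notation w := (wmass T).
Local Notation h := (w H).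
Hypothesis h_long : forall t e : R, 0 < e ->
  \forall x \near +oo, `|h x - h (x + t)| <= e * h x.
Let h_ge0 x : 0 <= h x := wmass_ge0 T H x.

(** A Fourier coefficient of [V] on the window in real form: phase 0 gives the real part and phase
    pi / 2 minus the imaginary part. By [oscD] two phases at distance pi / 2 determine all the
    others. *)
Definition osc (V : probability R R) (om th x : R) : R :=
  mean V (fun y => win x (x + T) y * cos (om * y + th)).

Lemma bmf_osc (om th x : R) : bmf (fun y => win x (x + T) y * cos (om * y + th)).
Proof. bm. Qed.

Lemma ler_norm_osc V om th x : `|osc V om th x| <= w V x.
Proof.
rewrite (le_trans (ler_norm_mean _ (bmf_osc _ _ _)))//.
have := bmf_osc om th x => ?.
apply: ler_mean => [||y]; [by bm|exact: bmf_win0|].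
rewrite normrM ger0_norm ?win_ge0// -[leRHS]mulr1 ler_wpM2l ?win_ge0//.
exact: cos_max.
Qed.

Lemma oscD V om th b x :
  osc V om (th + b) x = cos b * osc V om th x + sin b * osc V om (th + pi / 2) x.
Proof.
have b1 := bmf_osc om th x; have b2 := bmf_osc om (th + pi / 2) x.
rewrite /osc -!meanZ// -meanD; [|by bm..].
congr mean; apply/funext => y; rewrite !addrA cosDpihalf cosD; ring.
Qed.

Lemma osc_shift V om th x u :
  osc V om (om * u + th) (x - u) =
  mean V (fun v => win x (x + T) (u + v) * cos (om * (u + v) + th)).
Proof.
congr mean; apply/funext => v; rewrite [u + v]addrC win_shift (addrAC x T).
by congr (_ * cos _); ring.
Qed.

Variables (om : R) (omT : forall y th : R, cos (om * (y + T) + th) = cos (om * y + th)).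

Lemma lip_cos th u v : `|cos (om * u + th) - cos (om * v + th)| <= `|om| * `|u - v|.
Proof.
by rewrite -normrM (le_trans (ler_norm_cosB _ _))// mulrBr opprD addrACA subrr addr0.
Qed.

(** The difference of the two modes is the integral over ]x, x + t] minus the one over its translate
    by [T], on which the cosine takes the same values by [omT]. The masses of a cell ]z, z + d] and
    of its translate differ by w V z - w V (z + d), which slow variation makes small; short cells
    make the cosine nearly constant. *)
Lemma osc_slow V (th t : R) : bigo h (w V) ->
  (forall t, upo h (fun x => `|w V x - w V (x + t)|)) -> 0 <= t ->
  upo h (fun x => `|osc V om th x - osc V om th (x + t)|).
Proof.
move=> bV sV t0.
have [C C0 hC] := bigo_win T0 h_long 0 t bV.
have [C1 C10 hC1] := bigo_win T0 h_long T (T + t) bV.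
apply: (@upo_eps _ _ h_ge0 _ (C + C1 + 1)) => [|e e0]; first by lra.
pose N := (Num.bound (`|om| * t / e)).+1; pose d := t / N%:R.
have N0 : 0 < N%:R :> R by rewrite ltr0n.
have d0 : 0 <= d by rewrite divr_ge0.
have dN : d *+ N = t by rewrite -mulr_natr divfK ?gt_eqF.
have omd : `|om| * d <= e.
  rewrite /d mulrA ler_pdivrMr// -ler_pdivrMl// mulrC.
  have q0 : 0 <= `|om| * t / e by rewrite !mulr_ge0 ?invr_ge0// ltW.
  by rewrite (le_trans (ltW (archi_boundP q0)))// ler_nat.
have o1 : upo h (fun x => \sum_(i < N) `|w V (x + d *+ i) - w V (x + d *+ i + d)|).
  apply: (@upo_sum _ _ h_ge0 N (fun i x => `|w V (x + d *+ i) - w V (x + d *+ i + d)|)).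
  by move=> i _; exact: (upo_shift h_long (d *+ i) (sV d)).
have {}o1 := o1 _ e0.
near=> x.
pose c y := cos (om * y + th).
have bc : bmf c by rewrite /c; bm.
have P1 := mean_partition V x N bc (lip_cos th) (normr_ge0 om) d0.
have P2 := mean_partition V (x + T) N bc (lip_cos th) (normr_ge0 om) d0.
rewrite dN in P1 P2.
have E : osc V om th x - osc V om th (x + t) =
    mean V (fun y => win x (x + t) y * c y) -
    mean V (fun y => win (x + T) (x + T + t) y * c y).
  rewrite /osc -!meanB; [|by bm..]; congr mean; apply/funext => y.
  rewrite -!mulrBl; congr *%R.
  have := @winD _ x (x + T) (x + T + t) y; have := @winD _ x (x + t) (x + t + T) y.
  rewrite (addrAC x t T) => h1 h2.
  have {}h1 : win x (x + t) y + win (x + t) (x + T + t) y = win x (x + T + t) y.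
    by apply: h1; [rewrite lerDl|rewrite (addrAC x T t) lerDl ltW].
  have {}h2 : win x (x + T) y + win (x + T) (x + T + t) y = win x (x + T + t) y.
    by apply: h2; [rewrite lerDl ltW|rewrite lerDl].
  lra.
rewrite E; set a1 := mean V _ in P1 *; set a2 := mean V _ in P2 *.
set s1 := \sum_(i < N) _ in P1; set s2 := \sum_(i < N) _ in P2.
have s12 : `|s1 - s2| <= \sum_(i < N) `|w V (x + d *+ i) - w V (x + d *+ i + d)|.
  rewrite /s1 /s2 -sumrB (le_trans (ler_norm_sum _ _ _))//; apply: ler_sum => i _.
  have -> : c (x + T + d *+ i) = c (x + d *+ i) by rewrite addrAC /c omT.
  rewrite -mulrBr normrM -[leRHS]mul1r ler_pM ?cos_max//.
  set z := x + d *+ i; rewrite (_ : x + T + d *+ i = z + T); last by rewrite addrAC.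
  rewrite /wmass.
  have h1 : mean V (win z (z + d)) + mean V (win (z + d) (z + d + T)) =
      mean V (win z (z + d + T)) by apply: mean_winD; rewrite lerDl// ltW.
  have h2 : mean V (win z (z + T)) + mean V (win (z + T) (z + T + d)) =
      mean V (win z (z + T + d)) by apply: mean_winD; rewrite lerDl// ltW.
  rewrite (addrAC z d T) in h1 *.
  rewrite le_eqVlt; apply/predU1l; congr (`| _ |); move: h1 h2; lra.
have s12e : \sum_(i < N) `|w V (x + d *+ i) - w V (x + d *+ i + d)| <= e * h x by near: x.
have c1 : mean V (win x (x + t)) <= C * h x.
  by rewrite -[X in win X _]addr0; near: x.
have c2 : mean V (win (x + T) (x + T + t)) <= C1 * h x.
  by rewrite -(addrA x T t); near: x.
have e1 : `|om| * d * mean V (win x (x + t)) <= e * (C * h x).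
  by rewrite ler_pM ?mulr_ge0// mean_win_ge0.
have e2 : `|om| * d * mean V (win (x + T) (x + T + t)) <= e * (C1 * h x).
  by rewrite ler_pM ?mulr_ge0// mean_win_ge0.
have P1' := le_trans P1 e1; have P2' := le_trans P2 e2; have s12' := le_trans s12 s12e.
move: P1' P2' s12'; rewrite !ler_norml => /andP[p1 p2] /andP[p3 p4] /andP[p5 p6].
lra.
Unshelve. all: by end_near. Qed.

Lemma osc_le V (th x : R) :
  `|osc V om th x| <= `|osc V om 0 x| + `|osc V om (pi / 2) x|.
Proof.
have := oscD V om 0 th x; rewrite !add0r => ->.
rewrite (le_trans (ler_normD _ _))// !normrM -[X in _ <= X + _]mul1r -[X in _ <= _ + X]mul1r.
by rewrite lerD// ler_wpM2r// ?cos_max ?sin_max.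
Qed.

(* Advancing the phase by half a period [s] changes the sign of the integral,
   while the masses of short windows hardly change. *)
Lemma osc_gauge (s : R) : 0 <= s ->
  (forall y th : R, cos (om * (y + s) + th) = - cos (om * y + th)) ->
  (forall d t e : R, 0 < d -> 0 < e -> \forall x \near +oo,
     `|wmass d H x - wmass d H (x + t)| <= e * wmass d H x) ->
  forall th, upo h (fun x => `|osc H om th x|).
Proof.
move=> s0 oms loc th.
have slow : upo h (fun x => `|osc H om th x - osc H om th (x + s)|).
  apply: osc_slow s0; first by exists 1 => //; apply: nearW => x; rewrite mul1r.
  by move=> t e e0; exact: loc.
apply: (@upo_eps _ _ h_ge0 _ 5) => // e e0; have {}slow := slow _ e0.
pose N := (Num.bound (`|om| * T / e)).+1; pose d := T / N%:R.
have N0 : 0 < N%:R :> R by rewrite ltr0n.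
have d0 : 0 < d by rewrite divr_gt0.
have dN : d *+ N = T by rewrite -mulr_natr divfK ?gt_eqF.
have omd : `|om| * d <= e.
  rewrite /d mulrA ler_pdivrMr// -ler_pdivrMl// mulrC.
  have q0 : 0 <= `|om| * T / e by rewrite !mulr_ge0 ?invr_ge0// ltW.
  by rewrite (le_trans (ltW (archi_boundP q0)))// ler_nat.
have hs := h_shift_le h_long s.
have hN : \forall x \near +oo, forall i : 'I_N,
    `|wmass d H (x + d *+ i) - wmass d H (x + d *+ i + s)| <= e * wmass d H (x + d *+ i).
  apply: filter_forall => i.
  exact: (pinfty_shift (d *+ i) (loc d s e d0 e0)).
near=> x; pose c y := cos (om * y + th).
have bc : bmf c by rewrite /c; bm.
have P1 := mean_partition H x N bc (lip_cos th) (normr_ge0 om) (ltW d0).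
have P2 := mean_partition H (x + s) N bc (lip_cos th) (normr_ge0 om) (ltW d0).
rewrite dN -/(osc H om th x) -/(osc H om th (x + s)) -!/(wmass T H _) in P1 P2.
set s1 := \sum_(i < N) _ in P1; set s2 := \sum_(i < N) _ in P2.
have s12 : `|s1 + s2| <= e * h x.
  rewrite /s1 /s2 -big_split/= (le_trans (ler_norm_sum _ _ _))//.
  have -> : h x = \sum_(i < N) wmass d H (x + d *+ i).
    by rewrite -[X in wmass X]dN /wmass mean_win_sum// ltW.
  rewrite mulr_sumr; apply: ler_sum => i _.
  have -> : c (x + s + d *+ i) = - c (x + d *+ i) by rewrite addrAC /c oms.
  rewrite mulNr -mulrBr normrM; set z := x + d *+ i.
  rewrite (_ : x + s + d *+ i = z + s); last by rewrite addrAC.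
  apply: (@le_trans _ _ (`|wmass d H z - wmass d H (z + s)|)).
    by rewrite -[leRHS]mul1r ler_wpM2r// cos_max.
  by move: i @z; near: x.
have hsx : h (x + s) <= 2 * h x by near: x.
have slowx : `|osc H om th x - osc H om th (x + s)| <= e * h x by near: x.
have e1 : `|om| * d * h x <= e * h x by rewrite ler_wpM2r.
have e2 : `|om| * d * h (x + s) <= e * (2 * h x).
  by rewrite ler_pM// ?mulr_ge0// ltW.
have P1' := le_trans P1 e1; have P2' := le_trans P2 e2.
move: P1' P2' s12 slowx; rewrite !ler_norml => /andP[p1 p2] /andP[p3 p4] /andP[p5 p6] /andP[p7 p8].
have := h_ge0 x; lra.
Unshelve. all: by end_near. Qed.

End oscillation.

(** * Characteristic functions of infinitely divisible laws *)

Section characteristic_function.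
Context {R : realType}.
Implicit Types (P Q : probability R R) (t : R).

Definition cmean P t : R := mean P (fun x => cos (t * x)).
Definition smean P t : R := mean P (fun x => sin (t * x)).
(** The squared modulus of the characteristic function. It is multiplicative under convolution and,
    by [charnormE], is itself the characteristic function of the difference of two independent
    copies. *)
Definition charnorm P t : R := cmean P t ^+ 2 + smean P t ^+ 2.

Lemma bmf_cost t : bmf (fun x : R => cos (t * x)). Proof. bm. Qed.
Lemma bmf_sint t : bmf (fun x : R => sin (t * x)). Proof. bm. Qed.
#[local] Hint Resolve bmf_cost bmf_sint : core.

Lemma charnorm_conv P Q t : charnorm (convp P Q) t = charnorm P t * charnorm Q t.
Proof.
have bc := bmf_cost t; have bs := bmf_sint t.
have -> : charnorm (convp P Q) t =
    (cmean P t * cmean Q t - smean P t * smean Q t) ^+ 2 +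
    (smean P t * cmean Q t + cmean P t * smean Q t) ^+ 2.
  congr (_ ^+ 2 + _ ^+ 2).
    rewrite /cmean mean_convolution//.
    under [X in mean P X]funext => x.
      under [X in mean Q X]funext do rewrite mulrDr cosD.
      rewrite meanB; [|by bm..].
      rewrite !meanZ//.
      rewrite mulrC [X in _ - X]mulrC.
      over.
    by rewrite meanB; [|by bm..]; rewrite !meanZ// /cmean /smean; ring.
  rewrite /smean mean_convolution//.
  under [X in mean P X]funext => x.
    under [X in mean Q X]funext do rewrite mulrDr sinD.
    rewrite meanD; [|by bm..].
    rewrite !meanZ//.
    rewrite mulrC [X in _ + X]mulrC.
    over.
  by rewrite meanD; [|by bm..]; rewrite !meanZ// /cmean /smean; ring.
by rewrite /charnorm; ring.
Qed.

Lemma charnorm_pow P n t : (0 < n)%N -> charnorm (convpow P n) t = charnorm P t ^+ n.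
Proof.
case: n => // n _; elim: n => [|n ih]; first by rewrite expr1.
by rewrite [RHS]exprS -ih -charnorm_conv.
Qed.

Lemma charnormE P t :
  charnorm P t = mean P (fun x => mean P (fun y => cos (t * (x - y)))).
Proof.
have bc := bmf_cost t; have bs := bmf_sint t.
under [X in mean P X]funext => x.
  under [X in mean P X]funext do rewrite mulrBr cosB.
  rewrite meanD; [|by bm..].
  rewrite !meanZ// mulrC [X in _ + X]mulrC.
  over.
by rewrite meanD; [|by bm..]; rewrite !meanZ// -!expr2.
Qed.

Lemma charnorm_ge0 P t : 0 <= charnorm P t.
Proof. by rewrite addr_ge0// sqr_ge0. Qed.

Lemma charnorm_le1 P t : charnorm P t <= 1.
Proof.
rewrite charnormE; have b : bmf (fun z : R * R => cos (t * (z.1 - z.2))) by bm.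
rewrite (le_trans (ler_norm _))//; apply: mean_bound => [|x]; first by bm.
by apply: mean_bound => [|y]; [bm|exact: cos_max].
Qed.

(** The inequality 1 - cos (2 a) <= 4 (1 - cos a) is averaged over the difference of two independent
    copies. *)
Lemma charnorm_double P t : 1 - charnorm P (2 * t) <= 4 * (1 - charnorm P t).
Proof.
have key a : 4 * cos a - 3 <= cos (2 * a).
  rewrite [2 * a]mulr_natl cos_mulr2n; have := sqr_ge0 (1 - cos a).
  rewrite -mulr_natl; lra.
suff : 4 * charnorm P t - 3 <= charnorm P (2 * t) by lra.
rewrite !charnormE.
rewrite -[X in _ - X](mean_cst P) -meanZ -?meanB; [|by bm; exact: bmf_cst..].
apply: ler_mean => [||x]; [by bm; exact: bmf_cst|by bm|].
rewrite -[X in _ - X](mean_cst P) -meanZ -?meanB; [|by bm; exact: bmf_cst..].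
apply: ler_mean => [||y]; [by bm; exact: bmf_cst|by bm|].
by rewrite -mulrA; exact: key.
Qed.

Lemma charnorm_small P : exists2 t0 : R, 0 < t0 &
  forall t, `|t| <= t0 -> 0 < charnorm P t.
Proof.
have [A A1 hA] := @mass_bounded _ P (1 / 4) 1 ltac:(lra).
exists (2 * A)^-1; first by rewrite invr_gt0; lra.
move=> t tA; have bc := bmf_cost t.
suff : 0 < cmean P t by move=> c0; rewrite ltr_wpDr ?sqr_ge0// exprn_gt0.
(* The cosine is at least 1/2 on ]-A, A], where |t x| <= 1/2, and at least -1 elsewhere; a mass of
   3/4 leaves 9/8 - 1 > 0. *)
have : 3 / 2 * mean P (win (- A) A) - 1 <= cmean P t.
  have -> : 3 / 2 * mean P (win (- A) A) - 1 = mean P (fun x => 3 / 2 * win (- A) A x - 1).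
    rewrite meanB; [|by bm|exact: bmf_cst].
    by rewrite meanZ ?mean_cst//; exact: bmf_win0.
  apply: ler_mean => [||x]; [by bm; exact: bmf_cst|by []|].
  have := cos_geN1 (t * x); rewrite /win; case: andP => [[x1 x2] _|_ ?]; last by rewrite mulr0; lra.
  have : `|cos (t * x) - cos 0| <= 1 / 2.
    rewrite (le_trans (ler_norm_cosB _ _))// subr0 normrM.
    rewrite (@le_trans _ _ ((2 * A)^-1 * A))//; last first.
      rewrite invfM -mulrA mulVf ?mulr1; lra.
    have xA : `|x| <= A by rewrite ler_norml (ltW x1).
    by rewrite ler_pM.
  rewrite cos0 ler_norml => /andP[+ _] /=; lra.
lra.
Qed.

(** A product form of Bernoulli's inequality, which turns a lower bound on (1 - d)^n into an upper
    bound on n d. *)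
Lemma le_bernoulli (d : R) n : 0 <= d -> d <= 1 -> (1 - d) ^+ n * (1 + n%:R * d) <= 1.
Proof.
move=> d0 d1; elim: n => [|n ih]; first by rewrite expr0 mul0r addr0 mulr1.
apply: le_trans ih; rewrite exprSr -mulrA ler_wpM2l ?exprn_ge0 ?subr_ge0//.
rewrite -natr1; have : 0 <= n%:R * d ^+ 2 by rewrite mulr_ge0// sqr_ge0.
have := sqr_ge0 d; lra.
Qed.

(* If [charnorm P t > 0] then the [n]-th root of [P] has [charnorm] close to [1]
   at [t], hence positive at [2 * t]. *)
Lemma infinitely_divisible_charnorm P t : infinitely_divisible P -> 0 < charnorm P t.
Proof.
move=> idP.
have root n : (0 < n)%N -> exists Q, forall s, charnorm P s = charnorm Q s ^+ n.
  move=> n0; have [Q PQ] := idP n n0; exists Q => s; rewrite -charnorm_pow//.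
  by rewrite /charnorm /cmean /smean !(eq_probability_mean _ PQ).
have dbl s : 0 < charnorm P s -> 0 < charnorm P (2 * s).
  move=> c0; set c := charnorm P s in c0.
  (* With n > 4 / c, [le_bernoulli] gives c n d < 1, hence 4 d < 1, and [charnorm_double] leaves
     [charnorm Q (2 * s)] positive. *)
  pose n := (Num.bound (4 / c)).+1.
  have [Q PQ] := root n isT; rewrite PQ exprn_gt0//.
  pose d := 1 - charnorm Q s.
  have d0 : 0 <= d by rewrite subr_ge0 charnorm_le1.
  have d1 : d <= 1 by rewrite gerBl charnorm_ge0.
  have := le_bernoulli n d0 d1; rewrite {1}/d opprB addrCA subrr addr0 -PQ -/c => hb.
  have hn : 4 < c * n%:R.
    have q0 : 0 <= 4 / c by rewrite divr_ge0// ltW.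
    by rewrite mulrC -ltr_pdivrMr// (lt_le_trans (archi_boundP q0))// ler_nat.
  have := charnorm_double Q s; rewrite -/d => hd.
  suff : 4 * d < 1 by lra.
  have [->|dn0] := eqVneq d 0; first by lra.
  have {dn0}dp : 0 < d by rewrite lt0r dn0.
  have : 4 * d < c * n%:R * d by rewrite ltr_pM2r.
  lra.
(* Positivity near 0 reaches t by k doublings of t / 2^k. *)
have [t0 t00 small] := charnorm_small P.
pose k := Num.bound (`|t| / t0).
have hk : 0 < charnorm P (t / 2 ^+ k).
  apply: small; rewrite normrM normfV [X in _ / X]ger0_norm ?exprn_ge0//.
  rewrite ler_pdivrMr ?exprn_gt0// mulrC -ler_pdivrMr//.
  have q0 : 0 <= `|t| / t0 by rewrite divr_ge0// ltW.
  rewrite (le_trans (ltW (archi_boundP q0)))//.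
  by rewrite -natrX ler_nat ltnW// ltn_expl.
have : forall j, 0 < charnorm P (2 ^+ j * (t / 2 ^+ k)).
  by elim=> [|j ih]; rewrite ?expr0 ?mul1r// exprS -mulrA; exact: dbl.
move=> /(_ k); rewrite mulrC divfK// expf_neq0//.
Qed.

End characteristic_function.

(** * Size weights and exchangeability *)

Section size_bias.
Context {R : realType} (F : probability R R).
Hypothesis F0 : supp_ge0 F.

Definition clip (M u : R) : R := Num.max 0 (Num.min u M).

Lemma clip_ge0 M u : 0 <= clip M u. Proof. by rewrite le_max lexx. Qed.

Lemma clip_le M u : 0 <= M -> clip M u <= M.
Proof. by move=> M0; rewrite ge_max M0 ge_min lexx orbT. Qed.

Lemma clip_id M u : 0 <= u <= M -> clip M u = u.
Proof. by move=> /andP[u0 uM]; rewrite /clip min_l// max_r. Qed.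

Lemma clip_le_arg M u c : 0 <= c -> u <= c -> clip M u <= c.
Proof. by move=> c0 uc; rewrite ge_max c0 ge_min uc. Qed.

Lemma bmf_clip M d (U : measurableType d) (g : U -> R) : 0 <= M ->
  measurable_fun setT g -> bmf (fun x => clip M (g x)).
Proof.
move=> M0 mg; split; last by exists M => x; rewrite ger0_norm ?clip_ge0// clip_le.
apply: (measurableT_comp _ mg).
apply: measurable_maxr; first exact: measurable_cst.
by apply: measurable_minr; [exact: measurable_id|exact: measurable_cst].
Qed.

Variables (M : R) (M0 : 0 <= M) (Phi : R -> R) (bPhi : bmf Phi).
Hypothesis Phi0 : forall s, M < s -> Phi s = 0.
Local Notation tau := (clip M).
Local Notation Fp n := (convpow F n).

(** Of n + p independent summands with law [F], the first n carry the size weight; the others enter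
    only through the argument of [Phi]. *)
Definition bias (n p : nat) : R :=
  mean (Fp n) (fun u => mean (Fp p) (fun v => tau u * Phi (u + v))).

Lemma bmf_tau d (U : measurableType d) (g : U -> R) :
  measurable_fun setT g -> bmf (fun x => tau (g x)).
Proof. exact: bmf_clip. Qed.

(* The weight [u1 + u2] is shared between the two summands; [clip] only keeps
   the integrands bounded. *)
Lemma clipD u1 u2 v : 0 <= u1 -> 0 <= u2 -> 0 <= v ->
  tau (u1 + u2) * Phi (u1 + u2 + v) =
  tau u1 * Phi (u1 + (u2 + v)) + tau u2 * Phi (u2 + (u1 + v)).
Proof.
move=> u10 u20 v0; rewrite -(addrA u1) (addrCA u2).
have [sM|sM] := leP (u1 + (u2 + v)) M; last by rewrite Phi0// !mulr0 addr0.
rewrite !clip_id; last 3 first.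
  by apply/andP; split; lra.
  by apply/andP; split; lra.
  by apply/andP; split; lra.
by rewrite mulrDl.
Qed.

Ltac bmc := cbv beta;
  first [ bm
  | refine (bmf_tau _); mf
  | lazymatch goal with |- bmf (fun x => mean ?Q (@?f x)) =>
      refine (@bmf_mean _ _ _ _ _ Q f _); bmc end
  | refine (bmfD _ _); bmc | refine (bmfM _ _); bmc ].

(** One summand is split off the weighted block. [clipD] isolates its own share of the weight, which
    is [bias 1 (n + p)]; for the rest of the weight it acts as one more unweighted summand. *)
Lemma biasS n p : bias n.+1 p = bias 1 (n + p) + bias n p.+1.
Proof.
have F0n k : supp_ge0 (Fp k) := supp_ge0_convpow k F0.
rewrite /bias mean_convpowS; last by bmc.
have -> : mean (Fp 1) (fun u => mean (Fp (n + p)) (fun v => tau u * Phi (u + v))) =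
    mean F (fun u1 => mean (Fp n) (fun u2 => mean (Fp p) (fun v =>
      tau u1 * Phi (u1 + (u2 + v))))).
  congr mean; apply/funext => u1; rewrite mean_convpowD//; bmc.
have -> : mean (Fp n) (fun u => mean (Fp p.+1) (fun v => tau u * Phi (u + v))) =
    mean F (fun u1 => mean (Fp n) (fun u2 => mean (Fp p) (fun v =>
      tau u2 * Phi (u2 + (u1 + v))))).
  rewrite [RHS]mean_fubini; last by bmc.
  congr mean; apply/funext => u2; rewrite mean_convpowS//; bmc.
rewrite -meanD; [|by bmc..].
apply: eq_mean_supp => // [||u1 u10]; [by bmc|by bmc|].
rewrite -meanD; [|by bmc..].
apply: eq_mean_supp => // [||u2 u20]; [by bmc|by bmc|].
rewrite -meanD; [|by bmc..].
apply: eq_mean_supp => // [||v v0]; [by bmc|by bmc|].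
exact: clipD.
Qed.

(** Exchangeability: all weighted summands have the same share, which depends only on the total
    number of summands. *)
Lemma bias_mul n p : bias n.+1 p = n.+1%:R * bias 1 (n + p).
Proof.
elim: n p => [|n ih] p; first by rewrite mul1r add0n.
by rewrite biasS ih addnS addSn -[in RHS]natr1 mulrDl mul1r addrC.
Qed.

Lemma bias0 p : bias 0 p = 0.
Proof.
rewrite /bias mean_convpow0; last by bmc.
transitivity (mean (Fp p) (fun=> 0)); last by rewrite mean_cst.
by congr mean; apply/funext => v; rewrite clip_id ?mul0r// lexx.
Qed.

(** Used to pass from a bound on the share of one summand to a bound on F^{*(n+1)} weighted by its
    total size. *)
Lemma mean_clip n : mean (Fp n.+1) (fun u => tau u * Phi u) = n.+1%:R * bias 1 n.
Proof.
rewrite -[n in bias 1 n]addn0 -bias_mul /bias; congr mean; apply/funext => u.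
by rewrite mean_convpow0 ?addr0//; bmc.
Qed.

(* The coefficients [expcoeff (- m)] are those of the convolution inverse of
   [expcoeff m]. *)
Lemma expcoeff_inversion (m : R) (a : nat -> R) p K : (0 < K)%N ->
  a p = \sum_(i < K) expcoeff (- m) i * \sum_(j < K - i) expcoeff m j * a (j + (i + p))%N.
Proof.
move=> K0.
have := exchange_triangle (fun i j => expcoeff (- m) i * (expcoeff m j * a (j + (i + p))%N)) K.
under [in X in _ = X -> _]eq_bigr do rewrite -mulr_sumr.
move=> <-; case: K K0 => // K _.
rewrite big_ord_recl/= big_ord_recl big_ord0 addr0 subnn !add0n.
rewrite /expcoeff !expr0 fact0 !divr1 !mul1r big1 ?addr0// => N _.
rewrite (eq_bigr (fun i : 'I_(lift ord0 N).+1 => expcoeff (- m) i * expcoeff m (lift ord0 N - i) *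
    a (lift ord0 N + p)%N)); last first.
  by move=> i _; rewrite mulrA addnA subnK// -ltnS.
by rewrite -mulr_suml expcoeffD addNr /expcoeff expr0n/= !mul0r.
Qed.

End size_bias.

(** The Bernoulli argument of the elementary proof of the Stone-Weierstrass theorem. With s between
    a and b and M between s^-n and 2 s^-n + 1, the product M u^n is at most 2 (a / s)^n for u <= a
    (M is in fact below 2 s^-n), which puts the power near 1, and at least (b / s)^n for u >= b,
    which puts it near 0. *)
Lemma step_polynomial {R : realType} (a b e : R) : 0 <= a -> a < b -> b <= 1 -> 0 < e ->
  exists n M : nat, forall u : R, 0 <= u <= 1 ->
    (u <= a -> 1 - e <= (1 - u ^+ n) ^+ M) /\ (b <= u -> (1 - u ^+ n) ^+ M <= e).
Proof.
move=> a0 ab b1 e0; have [s [s0 as_ sb]] : exists s, [/\ 0 < s, a < s & s < b].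
  by exists ((a + b) / 2); split; lra.
have b0 : 0 < b by lra.
have s_ge0 := ltW s0; have b_ge0 := ltW b0.
have r1 : `|a / s| < 1 by rewrite (ger0_norm (divr_ge0 a0 s_ge0)) ltr_pdivrMr ?mul1r.
have r2 : `|s / b| < 1 by rewrite (ger0_norm (divr_ge0 s_ge0 b_ge0)) ltr_pdivrMr ?mul1r.
have e20 : 0 < e / 2 by lra.
have [n [n1 n2]] : exists n, (a / s) ^+ n <= e / 2 /\ (s / b) ^+ n <= e.
  have /cvgr0_norm_le/(_ _ e20) h1 := cvg_expr r1.
  have /cvgr0_norm_le/(_ _ e0) h2 := cvg_expr r2.
  near \oo => n; exists n; split.
    rewrite (le_trans (ler_norm _))//; by near: n.
  rewrite (le_trans (ler_norm _))//; by near: n.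
have sn0 : 0 < s ^+ n by rewrite exprn_gt0.
have sn1 : 1 <= s ^- n by rewrite invf_ge1// exprn_ile1 ?ltW//; lra.
pose M := (Num.truncn (s ^- n)).+1.
have M1 : s ^- n <= M%:R by rewrite ltW// truncnS_gt.
have M2 : M%:R <= 2 * s ^- n.
  have : (Num.truncn (s ^- n))%:R <= s ^- n by rewrite truncn_le// invr_ge0 ltW.
  rewrite /M -natr1; lra.
exists n, M => u /andP[u0 u1].
have un0 : 0 <= u ^+ n by rewrite exprn_ge0.
have un1 : u ^+ n <= 1 by rewrite exprn_ile1.
split => [ua|bu].
  have bern k : 1 - k%:R * u ^+ n <= (1 - u ^+ n) ^+ k.
    elim: k => [|k ih]; first by rewrite mul0r subr0 expr0.
    rewrite exprS; have := ler_wpM2l (_ : 0 <= 1 - u ^+ n) ih; rewrite subr_ge0 un1.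
    move=> /(_ isT); apply: le_trans; rewrite -natr1.
    have : 0 <= k%:R * (u ^+ n * u ^+ n) by rewrite !mulr_ge0.
    lra.
  apply: le_trans (bern M); rewrite lerD2l lerN2.
  apply: (@le_trans _ _ (2 * s ^- n * a ^+ n)).
    by rewrite ler_pM// lerXn2r ?nnegrE.
  have -> : 2 * s ^- n * a ^+ n = 2 * (a / s) ^+ n by rewrite expr_div_n -mulrA [X in _ * X]mulrC.
  lra.
have := le_bernoulli M un0 un1.
apply: contraTT; rewrite -!ltNge => ltM.
have Mv : (b / s) ^+ n <= M%:R * u ^+ n.
  rewrite expr_div_n mulrC; apply: ler_pM => //.
  - by rewrite invr_ge0 exprn_ge0.
  - by rewrite exprn_ge0.
  - by rewrite lerXn2r ?nnegrE.
have bs : 1 <= e * (b / s) ^+ n.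
  have E : (s / b) ^+ n * (b / s) ^+ n = 1.
    by rewrite -exprMn mulrA divfK ?divff ?expr1n// gt_eqF.
  rewrite -E ler_wpM2r// exprn_ge0// divr_ge0// ltW.
have q0 : 0 < (b / s) ^+ n by rewrite exprn_gt0// divr_gt0.
apply: (@le_lt_trans _ _ (e * (b / s) ^+ n)) => //.
rewrite ltr_pM ?ltW//; lra.
Unshelve. all: by end_near. Qed.

(** * Equidistribution *)

Section equidistribution.
Context {R : realType} (T : R) (T0 : 0 < T) (H : probability R R).
Local Notation w := (wmass T).
Local Notation h := (w H).
Hypothesis h_long : forall t e : R, 0 < e ->
  \forall x \near +oo, `|h x - h (x + t)| <= e * h x.
Let h_ge0 x : 0 <= h x := wmass_ge0 T H x.
Variable V : probability R R.
Hypothesis V_bigo : bigo h (w V).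
Hypothesis V_slow : forall t, upo h (fun x => `|w V x - w V (x + t)|).
Let om : R := pi *+ 2 / T.
Hypothesis V_osc : forall j th, upo h (fun x => `|osc T V (j.+1%:R * om) th x|).

Let windowed (q : R -> R) x z := mean V (fun y => win x (x + T) y * q (y - z)).

(** The window integral of a translate of q hardly depends on the translation. The error [B] is
    uniform in z and z', as the translations used later move with x. *)
Let invariant (q : R -> R) := exists2 B : R -> R, upo h B &
  forall x z z', `|windowed q x z - windowed q x z'| <= B x.

Let bq (q : R -> R) x z : bmf q -> bmf (fun y => win x (x + T) y * q (y - z)).
Proof. by move=> bq; bm. Qed.

Let invariantD (q r : R -> R) : bmf q -> bmf r -> invariant q -> invariant r ->
  invariant (fun y => q y + r y).
Proof.
move=> bmq bmr [B oB hB] [C oC hC]; exists (fun x => B x + C x); first exact: upoD.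
move=> x z z'; have E y : windowed (fun y => q y + r y) x y = windowed q x y + windowed r x y.
  rewrite /windowed -meanD; [|exact: bq..].
  by congr mean; apply/funext => t; rewrite mulrDr.
rewrite !E opprD addrACA (le_trans (ler_normD _ _))// lerD//.
Qed.

Let invariantZ (c : R) (q : R -> R) : bmf q -> invariant q -> invariant (fun y => c * q y).
Proof.
move=> bmq [B oB hB]; exists (fun x => `|c| * B x); first by apply: (upoZ h_ge0).
move=> x z z'; have E y : windowed (fun y => c * q y) x y = c * windowed q x y.
  rewrite /windowed -meanZ; last exact: bq.
  by congr mean; apply/funext => t; rewrite mulrCA.
by rewrite !E -mulrBr normrM ler_wpM2l.
Qed.

Let bcospow j i th : bmf (fun y : R => cos (om * y) ^+ j * cos (i%:R * om * y + th)).
Proof.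
have b : bmf (fun y : R => cos (om * y)) by bm.
by have := bmfX j b => ?; bm.
Qed.

(** The formula 2 cos a cos b = cos (a + b) + cos (a - b) removes the factors [cos (om * y)] one by
    one. Only pure frequencies remain: the zero one does not see the translation, the others are
    negligible by [V_osc]. *)
Let invariant_cos j i th : invariant (fun y => cos (om * y) ^+ j * cos (i%:R * om * y + th)).
Proof.
elim: j i th => [|j ih] i th.
  case: i => [|i].
    exists (fun=> 0); first exact: upo0.
    move=> x z z'.
    have E y : windowed (fun y => cos (om * y) ^+ 0 * cos (0%:R * om * y + th)) x y =
        mean V (fun y => win x (x + T) y * cos th).
      by congr mean; apply/funext => t; rewrite !mul0r add0r expr0 mul1r.
    by rewrite !E subrr normr0.
  exists (fun x => 2 * (`|osc T V (i.+1%:R * om) 0 x| + `|osc T V (i.+1%:R * om) (pi / 2) x|)).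
    by apply: (upoZ h_ge0) => //; apply: upoD; exact: V_osc.
  move=> x z z'.
  have E y : windowed (fun y => cos (om * y) ^+ 0 * cos (i.+1%:R * om * y + th)) x y =
      osc T V (i.+1%:R * om) (th - i.+1%:R * om * y) x.
    congr mean; apply/funext => t; rewrite expr0 mul1r; congr (_ * cos _); ring.
  rewrite !E (le_trans (ler_normB _ _))//.
  by have h1 := osc_le T (i.+1%:R * om) V (th - i.+1%:R * om * z) x;
    have h2 := osc_le T (i.+1%:R * om) V (th - i.+1%:R * om * z') x; lra.
have -> : (fun y => cos (om * y) ^+ j.+1 * cos (i%:R * om * y + th)) = (fun y =>
    2^-1 * (cos (om * y) ^+ j * cos (i.+1%:R * om * y + th)) +
    2^-1 * (cos (om * y) ^+ j * cos (i%:R * om * y + th - om * y))).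
  apply/funext => y.
  have -> : i.+1%:R * om * y + th = i%:R * om * y + th + om * y by rewrite -[i.+1%:R]natr1; ring.
  move: (i%:R * om * y + th) => a.
  by rewrite exprSr cosD cosB; field.
apply: invariantD.
- by have := bcospow j i.+1 th => ?; bm; exact: bmf_cst.
- have b := bcospow j 0 0.
  have b1 : bmf (fun y : R => cos (om * y) ^+ j).
    by apply: bmfX; bm.
  by bm; exact: bmf_cst.
- exact: invariantZ.
apply: invariantZ.
  have b1 : bmf (fun y : R => cos (om * y) ^+ j) by apply: bmfX; bm.
  by bm.
(* For i = 0 the lowered frequency is -1, folded to 1 by the parity of the cosine. *)
case: i => [|i].
  have := ih 1%N (- th); congr invariant; apply/funext => y; congr (_ * _).
  by rewrite -cosN; congr cos; ring.
have := ih i th; congr invariant; apply/funext => y; congr (_ * cos _).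
by rewrite -[i.+1%:R]natr1; ring.
Qed.

Let invariant_poly (p : {poly R}) : invariant (fun y => p.[cos (om * y)]).
Proof.
have b1 j : bmf (fun y : R => cos (om * y) ^+ j) by apply: bmfX; bm.
have inv1 j : invariant (fun y => cos (om * y) ^+ j).
  have := invariant_cos j 0 0; congr invariant; apply/funext => y.
  by rewrite !mul0r addr0 cos0 mulr1.
have bs n : bmf (fun y : R => \sum_(i < n) p`_i * cos (om * y) ^+ i).
  by apply: bmf_sum => i; have := b1 i => ?; bm; exact: bmf_cst.
have invs n : invariant (fun y => \sum_(i < n) p`_i * cos (om * y) ^+ i).
  elim: n => [|n ih].
    have := invariantZ 0 (b1 0%N) (inv1 0%N); congr invariant; apply/funext => y.
    by rewrite big_ord0 mul0r.
  under [X in invariant X]funext do rewrite big_ord_recr/=.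
  apply: invariantD; [exact: bs| |exact: ih|exact: invariantZ].
  by have := b1 n => ?; bm; exact: bmf_cst.
by have := invs (size p); congr invariant; apply/funext => y; rewrite horner_coef.
Qed.

Let om_gt0 : 0 < om.
Proof. by rewrite divr_gt0// mulrn_wgt0// pi_gt0. Qed.

Let cos_arc (d t : R) : 0 <= t -> t <= d -> om * d <= pi -> cos (om * d) <= cos (om * t).
Proof.
move=> t0 td dpi; have om0 := ltW om_gt0.
have a1 : om * t \in `[0, pi].
  by rewrite in_itv/= mulr_ge0//= (le_trans _ dpi)// ler_wpM2l.
have a2 : om * d \in `[0, pi].
  by rewrite in_itv/= dpi andbT mulr_ge0// (le_trans t0).
by rewrite leNgt ltr_cos// -leNgt ler_wpM2l.
Qed.

Let cos_far (d t : R) : 0 < d -> d <= t -> t <= T - d -> cos (om * t) <= cos (om * d).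
Proof.
move=> d0 dt td; have omT : om * T = pi *+ 2 by rewrite /om divfK ?gt_eqF.
have half : om * (T / 2) = pi by rewrite mulrA omT -mulr_natl; field.
have [th|th] := leP t (T / 2).
  by apply: cos_arc; [exact: ltW|by []|by rewrite -half ler_wpM2l// ltW].
have -> : cos (om * t) = cos (om * (T - t)).
  by rewrite mulrBr omT [pi *+ 2 + _]addrC cosD2pi cosN.
apply: cos_arc; [exact: ltW|lra|].
by rewrite -half ler_wpM2l ?(ltW om_gt0)//; lra.
Qed.

(* A polynomial in [cos] that approximates the indicator of an arc of length
   [(1 - eta) T / N]: its [N] translates by [T / N] add up to at most
   [1 + N e]. *)
Let short_window (N : nat) (eta : R) : (0 < N)%N -> 0 < eta < 1 ->
  upo h (fun x => mean V (win x (x + (1 - eta) * T / N%:R)) - w V x / N%:R).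
Proof.
move=> N0 /andP[eta0 eta1]; have N0' : 0 < N%:R :> R by rewrite ltr0n.
have [C C0 hC] := V_bigo.
apply: (@upo_eps _ _ h_ge0 _ (4 * C + 3)) => [|e e0]; first by lra.
(* The target window has half-length [d] and a cell of length T / N has half-length [d']; the
   polynomial falls from nearly 1 to nearly 0 between these two distances. *)
have [d' d'E] : exists d', d' = T / N%:R / 2 by eexists.
have [d dE] : exists d, d = (1 - eta) * d' by eexists.
have d'0 : 0 < d' by rewrite d'E divr_gt0// divr_gt0.
have eta1' : 0 < 1 - eta by rewrite subr_gt0.
have d0 : 0 < d by rewrite dE mulr_gt0.
have dd' : d < d' by rewrite dE -[ltRHS]mul1r ltr_pM2r// gtrBl.
have d'T : d' *+ 2 *+ N = T by rewrite d'E -mulr_natr -mulr_natr; field; rewrite gt_eqF.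
have d'T2 : d' <= T / 2.
  by rewrite d'E ler_pM2r// ler_pdivrMr// -[leLHS]mulr1 ler_wpM2l ?ler1n ?(ltW T0).
have omT : om * T = pi *+ 2 by rewrite /om divfK ?gt_eqF.
have half : om * (T / 2) = pi by rewrite mulrA omT -mulr_natl; field.
have om0 := ltW om_gt0.
have omd' : om * d' <= pi by rewrite -half ler_wpM2l.
(* [a] and [b] are the values at [d] and [d'] of (1 - cos (om * y)) / 2, which grows with the
   distance from y to the nearest multiple of [T]. *)
pose a := (1 - cos (om * d)) / 2; pose b := (1 - cos (om * d')) / 2.
have ab : a < b.
  have m1 : om * d \in `[0, pi].
    by rewrite in_itv/= mulr_ge0 ?(ltW d0)//= (le_trans _ omd')// ler_wpM2l// ltW.
  have m2 : om * d' \in `[0, pi] by rewrite in_itv/= omd' andbT mulr_ge0// ltW.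
  by rewrite /a /b ltr_pM2r// ltrD2l ltrN2 ltr_cos// ltr_pM2l.
have a0 : 0 <= a by rewrite /a divr_ge0// subr_ge0 cos_le1.
have b1 : b <= 1 by rewrite /b; have := cos_geN1 (om * d'); lra.
have [n [M step]] := step_polynomial a0 ab b1 e0.
pose p : {poly R} := (1 - ((1 - 'X) * (2^-1)%:P) ^+ n) ^+ M.
pose q y := p.[cos (om * y)].
pose u y := (1 - cos (om * y)) / 2.
have u01 y : 0 <= u y <= 1.
  by rewrite /u; have := cos_geN1 (om * y); have := cos_le1 (om * y); lra.
have qE y : q y = (1 - u y ^+ n) ^+ M.
  by rewrite /q /p !hornerE.
have un y : 0 <= u y ^+ n <= 1.
  by have /andP[? ?] := u01 y; rewrite exprn_ge0// exprn_ile1.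
have q0 y : 0 <= q y by rewrite qE exprn_ge0// subr_ge0; case/andP: (un y).
have q1 y : q y <= 1.
  have /andP[? ?] := un y; rewrite qE exprn_ile1 ?subr_ge0//; lra.
have qnear y : `|y| <= d -> 1 - e <= q y.
  move=> yd; rewrite qE; have [+ _] := step _ (u01 y); apply.
  rewrite /u /a ler_pM2r// lerD2l lerN2.
  have -> : cos (om * y) = cos (om * `|y|).
    by rewrite -[LHS]cos_norm normrM (gtr0_norm om_gt0).
  by apply: cos_arc => //; rewrite (le_trans _ omd')// ler_wpM2l// ltW.
have qfar y : d' <= `|y| -> `|y| <= T - d' -> q y <= e.
  move=> yd yT; rewrite qE; have [_ +] := step _ (u01 y); apply.
  rewrite /u /b ler_pM2r// lerD2l lerN2.
  have -> : cos (om * y) = cos (om * `|y|).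
    by rewrite -[LHS]cos_norm normrM (gtr0_norm om_gt0).
  exact: cos_far.
have bmq : bmf q.
  have bc : bmf (fun y : R => cos (om * y)) by bm.
  have bu : bmf u by rewrite /u; bm; exact: bmf_cst.
  have bun := bmfX n bu.
  rewrite (_ : q = fun y => (1 - u y ^+ n) ^+ M); last by apply/funext => y; rewrite qE.
  by apply: bmfX; bm; exact: bmf_cst.
have [B oB hB] : invariant q := invariant_poly p.
pose c := T / N%:R; have c0 : 0 < c by rewrite divr_gt0.
have c2d : c = 2 * d' by rewrite d'E /c; field; rewrite gt_eqF.
have cN : c *+ N = T by rewrite /c -mulr_natr divfK// gt_eqF.
(* The translate of q centred in the i-th cell is at most 1 there. Elsewhere in the window the
   distance to the centre lies between d' and T - d', so the translate is at most e. *)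
have cell x (i : 'I_N) : windowed q x (x + c *+ i + d') <=
    mean V (win (x + c *+ i) (x + c *+ i + c)) + e * w V x.
  have ciN : c *+ i + c <= T.
    by rewrite -[leRHS]cN -mulrSr; apply: ler_wpMn2l; [exact: ltW|exact: ltn_ord].
  have ci0 : 0 <= c *+ i by rewrite mulrn_wge0// ltW.
  rewrite /windowed /wmass -meanZ; last exact: bmf_win0.
  rewrite -meanD; [|exact: bmf_win0|by bm].
  apply: ler_mean => [||y]; [exact: bq|by bm|].
  have [/andP[xy yT]|nxy] := boolP ((x < y) && (y <= x + T)); last first.
    have -> : win x (x + T) y = 0 by rewrite /win (negbTE nxy).
    by rewrite mul0r mulr0 addr0 win_ge0.
  have -> : win x (x + T) y = 1 by rewrite /win xy yT.
  rewrite mul1r mulr1 /win; have [yi|yi] := leP y (x + c *+ i).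
    by rewrite /= add0r; apply: qfar; rewrite ler0_norm; lra.
  have [yi'|yi'] := leP y (x + c *+ i + c).
    by rewrite /= (le_trans (q1 _))// lerDl ltW.
  by rewrite /= add0r; apply: qfar; rewrite ger0_norm; lra.
have core x : mean V (win (x + (d' - d)) (x + d' + d)) <=
    windowed q x (x + d') + e * w V x.
  rewrite /windowed /wmass -meanZ; last exact: bmf_win0.
  rewrite -meanD; [|exact: bq|by bm].
  apply: ler_mean => [||y]; [exact: bmf_win0|by have := bq x (x + d') bmq => ?; bm|].
  rewrite {1}/win; case: andP => [[y1 y2]|_]; last first.
    by rewrite addr_ge0 ?mulr_ge0 ?win_ge0// ltW.
  have -> : win x (x + T) y = 1.
    rewrite /win; have -> : x < y by move: y1; lra.
    by have -> : y <= x + T by move: y2; lra.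
  rewrite mul1r mulr1 -lerBlDr; apply: qnear; rewrite ler_norml; lra.
(* The integrals of the N translates agree up to [B x], so the first one is bounded by their average
   plus [B x]. *)
have bound x : mean V (win (x + (d' - d)) (x + d' + d)) <= w V x / N%:R + 2 * e * w V x + B x.
  have sum_cells : \sum_(i < N) windowed q x (x + c *+ i + d') <= w V x + N%:R * (e * w V x).
    rewrite (le_trans (ler_sum _ (fun i _ => cell x i)))// big_split/=.
    by rewrite -(mean_win_sum V x N (ltW c0)) cN sumr_const card_ord -[_ *+ N]mulr_natl.
  have sum_inv : N%:R * windowed q x (x + d') <=
      \sum_(i < N) windowed q x (x + c *+ i + d') + N%:R * B x.
    have -> : N%:R * windowed q x (x + d') = \sum_(i < N) windowed q x (x + d').
      by rewrite sumr_const card_ord mulr_natl.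
    have -> : N%:R * B x = \sum_(i < N) B x by rewrite sumr_const card_ord mulr_natl.
    rewrite -big_split/=; apply: ler_sum => i _; rewrite -lerBlDl.
    by rewrite (le_trans (ler_norm _)).
  have := core x.
  have : windowed q x (x + d') <= w V x / N%:R + e * w V x + B x.
    have := le_trans sum_inv (_ : _ <= (w V x + N%:R * (e * w V x)) + N%:R * B x).
    rewrite lerD2r => /(_ sum_cells).
    rewrite -ler_pdivlMl// => /le_trans; apply; rewrite le_eqVlt; apply/predU1l.
    by field; rewrite gt_eqF.
  lra.
(* [bound] concerns the window that starts at x + (d' - d); what follows moves it back to x. *)
have [s sE] : exists s, s = d' - d by eexists.
have oB' := upo_shift h_long (- s) oB e0.
have sl := V_slow (- s) e0.
have hs := h_shift_le h_long (- s).
have hC' := pinfty_shift (- s) hC.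
near=> x.
have := bound (x - s).
rewrite (_ : x - s + (d' - d) = x); last by rewrite sE; ring.
rewrite (_ : x - s + d' + d = x + (1 - eta) * T / N%:R); last first.
  by rewrite sE dE d'E; field; rewrite gt_eqF.
have b1' : B (x - s) <= e * h x by near: x.
have b2 : `|w V x - w V (x - s)| <= e * h x by near: x.
have b3 : w V (x - s) <= C * h (x - s) by near: x.
have b4 : h (x - s) <= 2 * h x by near: x.
have b5 : C * h (x - s) <= C * (2 * h x) by rewrite ler_wpM2l.
have b6 : 2 * e * w V (x - s) <= 2 * e * (C * (2 * h x)).
  by rewrite ler_wpM2l ?mulr_ge0 ?(ltW e0)// (le_trans b3).
have b7 : w V (x - s) / N%:R - w V x / N%:R <= e * h x.
  rewrite -mulrBl ler_pdivrMr// (@le_trans _ _ (e * h x))//.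
    by rewrite (le_trans (ler_norm _))// distrC.
  by rewrite -[leLHS]mulr1 ler_wpM2l ?ler1n// mulr_ge0// ltW.
have b8 : 0 <= e * h x by rewrite mulr_ge0// ltW.
lra.
Unshelve. all: by end_near. Qed.

(** The window is covered by M short windows of length l, each of mass at most w V x / N up to o(h),
    and M / N exceeds t / T by at most e. *)
Let window_upper (t : R) : 0 < t ->
  upo h (fun x => mean V (win x (x + t)) - t / T * w V x).
Proof.
move=> t0; have [C C0 hC] := V_bigo.
apply: (@upo_eps _ _ h_ge0 _ (C + 1)) => [|e e0]; first by lra.
pose r := t / T; have r0 : 0 < r by rewrite divr_gt0.
have den0 : 0 < 4 * r + 2 * e by lra.
(* Chosen so that eta <= 1/2 and r / (1 - eta) <= r + e / 2; the other e / 2 covers the rounding up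
   in M. *)
pose eta := e / (4 * r + 2 * e).
have eta0 : 0 < eta by rewrite divr_gt0.
have etaE : eta * (4 * r + 2 * e) = e by rewrite /eta divfK// gt_eqF.
have eta2 : eta <= 1 / 2 by rewrite /eta ler_pdivrMr//; lra.
have eta1 : 0 < eta < 1 by rewrite eta0/=; lra.
have e1 : 0 < 1 - eta by lra.
pose N := (Num.bound (2 / e)).+1.
have N0 : 0 < N%:R :> R by rewrite ltr0n.
have Ne : N%:R^-1 <= e / 2.
  have q0 : 0 <= 2 / e by rewrite divr_ge0// ltW.
  rewrite -[leRHS]invrK lef_pV2 ?posrE ?invr_gt0 ?divr_gt0// invf_div.
  by rewrite (le_trans (ltW (archi_boundP q0)))// ler_nat.
pose l := (1 - eta) * T / N%:R.
have l0 : 0 < l by rewrite divr_gt0// mulr_gt0.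
have tl0 : 0 <= t / l by rewrite divr_ge0// ltW.
pose M := (Num.truncn (t / l)).+1.
have M1 : t <= l *+ M by rewrite -mulr_natl -ler_pdivrMr// ltW// truncnS_gt.
have M2 : M%:R <= t / l + 1.
  by rewrite /M -natr1 lerD2r truncn_le.
have MN : M%:R / N%:R <= r + e.
  rewrite ler_pdivrMr// (le_trans M2)//.
  have -> : t / l = r / (1 - eta) * N%:R.
    by rewrite /l /r; field; rewrite !gt_eqF.
  have : r / (1 - eta) <= r + e / 2.
    rewrite ler_pdivrMr//; nra.
  move=> /(ler_wpM2r (ltW N0)) h1.
  have : 1 <= e / 2 * N%:R by rewrite -ler_pdivrMr// mul1r.
  by move: h1; rewrite !mulrDl; lra.
have oS : upo h (fun x => \sum_(i < M) ((mean V (win (x + l *+ i) (x + l *+ i + l)) -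
    w V (x + l *+ i) / N%:R) + N%:R^-1 * `|w V x - w V (x + l *+ i)|)).
  apply: (@upo_sum _ _ h_ge0 M (fun i x => (mean V (win (x + l *+ i) (x + l *+ i + l)) -
    w V (x + l *+ i) / N%:R) + N%:R^-1 * `|w V x - w V (x + l *+ i)|)) => i _.
  apply: upoD.
    exact: (upo_shift h_long (l *+ i) (short_window (ltn0Sn _) eta1)).
  by apply: (upoZ h_ge0); [rewrite invr_ge0 ltW|exact: V_slow].
have {}oS := oS _ e0.
near=> x.
have le1 : mean V (win x (x + t)) <= \sum_(i < M) mean V (win (x + l *+ i) (x + l *+ i + l)).
  by rewrite -(mean_win_sum V x M (ltW l0)); apply: le_mean_win => //; rewrite lerD2l.
have le2 : \sum_(i < M) mean V (win (x + l *+ i) (x + l *+ i + l)) <=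
    M%:R / N%:R * w V x + \sum_(i < M) ((mean V (win (x + l *+ i) (x + l *+ i + l)) -
    w V (x + l *+ i) / N%:R) + N%:R^-1 * `|w V x - w V (x + l *+ i)|).
  have -> : M%:R / N%:R * w V x = \sum_(i < M) (N%:R^-1 * w V x).
    by rewrite sumr_const card_ord -[RHS]mulr_natl mulrA.
  rewrite -big_split/=; apply: ler_sum => i _.
  have : N%:R^-1 * (w V (x + l *+ i) - w V x) <= N%:R^-1 * `|w V x - w V (x + l *+ i)|.
    by rewrite ler_wpM2l ?invr_ge0 ?(ltW N0)// distrC ler_norm.
  lra.
have le3 : \sum_(i < M) ((mean V (win (x + l *+ i) (x + l *+ i + l)) -
    w V (x + l *+ i) / N%:R) + N%:R^-1 * `|w V x - w V (x + l *+ i)|) <= e * h x by near: x.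
have le4 : M%:R / N%:R * w V x <= (r + e) * w V x by rewrite ler_wpM2r// wmass_ge0.
have le5 : e * w V x <= e * (C * h x) by rewrite ler_wpM2l ?(ltW e0)//; near: x.
rewrite -/r; lra.
Unshelve. all: by end_near. Qed.

(** The lower bound is the upper bound for the complement: windows of lengths t and [T *+ n - t]
    together fill n windows of length [T], whose mass is n w V x up to o(h). *)
Lemma equidistribution (t : R) : 0 < t ->
  upo h (fun x => `|mean V (win x (x + t)) - t / T * w V x|).
Proof.
move=> t0; have up := window_upper t0.
have down : upo h (fun x => - (mean V (win x (x + t)) - t / T * w V x)).
  pose n := (Num.bound (t / T)).+1.
  have tn : t < T *+ n.
    rewrite -mulr_natl -ltr_pdivrMr//.
    have q0 : 0 <= t / T by rewrite divr_ge0// ltW.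
    by rewrite (lt_le_trans (archi_boundP q0))// ler_nat.
  have t'0 : 0 < T *+ n - t by rewrite subr_gt0.
  have o1 := upo_shift h_long t (window_upper t'0).
  have c0 : 0 <= (T *+ n - t) / T by rewrite divr_ge0// ltW.
  have o2 := upoZ h_ge0 c0 (V_slow t).
  have o3 : upo h (fun x => \sum_(i < n) `|w V x - w V (x + T *+ i)|).
    by apply: (@upo_sum _ _ h_ge0 n (fun i x => `|w V x - w V (x + T *+ i)|)) => i _; exact: V_slow.
  apply: upo_le (upoD o1 (upoD o2 o3)); apply: nearW => x.
  have E1 : mean V (win x (x + t)) + mean V (win (x + t) (x + t + (T *+ n - t))) =
      \sum_(i < n) w V (x + T *+ i).
    rewrite -(mean_win_sum V x n (ltW T0)) (_ : x + t + (T *+ n - t) = x + T *+ n); last by ring.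
    by apply: mean_winD; [lra|rewrite lerD2l ltW].
  have E2 : n%:R * w V x - \sum_(i < n) w V (x + T *+ i) <=
      \sum_(i < n) `|w V x - w V (x + T *+ i)|.
    have -> : n%:R * w V x = \sum_(i < n) w V x by rewrite sumr_const card_ord mulr_natl.
    by rewrite -sumrB; apply: ler_sum => i _; exact: ler_norm.
  have E3 : (T *+ n - t) / T = n%:R - t / T.
    by rewrite mulrBl -[T *+ n]mulr_natl mulfK// gt_eqF.
  have E4 : (T *+ n - t) / T * (w V (x + t) - w V x) <=
      (T *+ n - t) / T * `|w V x - w V (x + t)|.
    by rewrite ler_wpM2l// distrC ler_norm.
  move: E4; rewrite E3 => E4; lra.
move=> e e0; have := up _ e0; have := down _ e0; apply: filterS2 => x.
rewrite ler_norml; lra.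
Qed.

End equidistribution.

(** * Local classes in terms of window masses *)

Section local_mass.
Context {R : realType}.
Implicit Types (V Q : probability R R) (x t s : R).

Definition tail V x : R := fine (V `]x, +oo[%classic).

Lemma fin_num_probability V (A : set R) : measurable A -> V A \is a fin_num.
Proof.
by move=> mA; rewrite ge0_fin_numE// (le_lt_trans (probability_le1 _ _))// ltry.
Qed.

Lemma local_mass_fin V t x : local_mass V t%:E x = (wmass t V x)%:E.
Proof. by rewrite /local_mass delta_fin /wmass mean_win fineK// fin_num_probability. Qed.

Lemma local_mass_pinfty V x : local_mass V +oo%E x = (tail V x)%:E.
Proof. by rewrite /local_mass delta_pinfty /tail fineK// fin_num_probability. Qed.

Lemma tail_ge0 V x : 0 <= tail V x.
Proof. by rewrite fine_ge0. Qed.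

Lemma wmass_le_tail V t x : wmass t V x <= tail V x.
Proof.
rewrite /wmass mean_win /tail fine_le ?fin_num_probability// le_measure ?inE//.
by move=> y /=; rewrite !in_itv/= andbT => /andP[].
Qed.

Lemma wmass_cvg_tail V t x : 0 < t -> wmass (t *+ n) V x @[n --> \oo] --> tail V x.
Proof.
move=> t0; pose A n := `]x, x + t *+ n]%classic : set R.
have tn n k : (n <= k)%N -> t *+ n <= t *+ k by move=> nk; rewrite ler_wpMn2l// ltW.
have bigA : \bigcup_n A n = `]x, +oo[%classic.
  apply/seteqP; split => [y [n _]|y]; rewrite /A/= !in_itv/= andbT; first by case/andP.
  move=> xy; exists (Num.bound ((y - x) / t)) => //=; rewrite in_itv/= xy/=.
  have q0 : 0 <= (y - x) / t by rewrite divr_ge0 ?ltW// subr_gt0.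
  have := archi_boundP q0; rewrite ltr_pdivrMr// mulr_natl; lra.
have ndA : {homo A : n k / (n <= k)%N >-> (n <= k)%O}.
  move=> n k nk; rewrite subsetEset => y; rewrite /A/= !in_itv/= => /andP[-> /le_trans]; apply.
  by rewrite lerD2l tn.
have hc : (V (A n) @[n --> \oo] --> (tail V x)%:E)%E.
  rewrite /tail fineK ?fin_num_probability// -bigA.
  apply: nondecreasing_cvg_mu => // [n|]; first exact: measurable_itv.
  by rewrite bigA; exact: measurable_itv.
move/fine_cvg : hc.
apply: cvg_trans; apply: near_eq_cvg; apply: nearW => n /=.
by rewrite /wmass mean_win.
Qed.

(** A tail is the limit of sums of adjacent windows of length t, so a comparison of all windows
    beyond x passes to tails. This is how T = +oo is reached. *)
Lemma tail_le V Q t s C x : 0 < t -> 0 <= C ->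
  (forall y, x <= y -> wmass t V (y + s) <= C * wmass t Q y) ->
  tail V (x + s) <= C * tail Q x.
Proof.
move=> t0 C0 VQ; have /cvgr_to_le := @wmass_cvg_tail V t (x + s) t0; apply.
apply: nearW => n; apply: (@le_trans _ _ (C * wmass (t *+ n) Q x)); last first.
  by rewrite ler_wpM2l// wmass_le_tail.
rewrite /wmass !(mean_win_sum _ _ _ (ltW t0)) mulr_sumr; apply: ler_sum => i _.
by rewrite addrAC; apply: VQ; rewrite lerDl mulrn_wge0// ltW.
Qed.

(** Only finite windows occur in the hypotheses; the case T = +oo is deduced from windows of length
    1 by [tail_le]. *)
Lemma in_Lloc_wmass V :
  (forall t, 0 < t -> \forall x \near +oo, 0 < wmass t V x) ->
  (forall t s e, 0 < t -> 0 < e -> \forall x \near +oo,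
     `|wmass t V x - wmass t V (x + s)| <= e * wmass t V x) ->
  in_Lloc V.
Proof.
move=> pos slow.
have equiv (a b : R -> R) : (\forall x \near +oo, 0 < b x) ->
    (forall e, 0 < e -> \forall x \near +oo, `|b x - a x| <= e * b x) ->
    equivalent_pinfty (fun x => (a x)%:E) (fun x => (b x)%:E).
  move=> b0 ab; rewrite /equivalent_pinfty.
  have quot : \forall x \near +oo, ((a x)%:E / (b x)%:E = (a x / b x)%:E)%E.
    by move: b0; apply: filterS => x b0; rewrite inver gt_eqF.
  apply: cvg_EFin; first by move: quot; apply: filterS => x ->.
  apply/cvgrPdist_le => e e0; have {}ab := ab _ e0; near=> x.
  have bx : 0 < b x by near: x.
  have abx : `|b x - a x| <= e * b x by near: x.
  have qx : ((a x)%:E / (b x)%:E = (a x / b x)%:E)%E by near: x.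
  rewrite /= qx/=; have -> : 1 - a x / b x = (b x - a x) / b x by rewrite mulrBl divff// gt_eqF.
  by rewrite normrM normfV (gtr0_norm bx) ler_pdivrMr.
case=> [t||//] t0.
- have {}t0 : 0 < t by rewrite -lte_fin.
  split; first by have := pos t t0; apply: filterS => x; rewrite local_mass_fin lte_fin.
  move=> s s0; under eq_fun do rewrite local_mass_fin.
  rewrite (_ : local_mass V t%:E = fun x => (wmass t V x)%:E); last first.
    by apply/funext => x; rewrite local_mass_fin.
  by apply: equiv => [|e e0]; [exact: pos|exact: slow].
split.
  have := pos 1 ltr01; apply: filterS => x; rewrite local_mass_pinfty lte_fin => /lt_le_trans; apply.
  exact: wmass_le_tail.
move=> s s0; under eq_fun do rewrite local_mass_pinfty.
rewrite (_ : local_mass V +oo%E = fun x => (tail V x)%:E); last first.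
  by apply/funext => x; rewrite local_mass_pinfty.
apply: equiv => [|e e0].
  have := pos 1 ltr01; apply: filterS => x /lt_le_trans; apply; exact: wmass_le_tail.
have [M M0 hM] := pinfty_ex (slow 1 (- s) e ltr01 e0).
(* Capped at 1/2 so that 1 - e' is positive and can be inverted. *)
pose e' := Num.min e (1 / 2); have e'0 : 0 < e' by rewrite lt_min e0/=; lra.
have e'e : e' <= e by rewrite ge_min lexx.
have [M' M'0 hM'] := pinfty_ex (slow 1 (- s) e' ltr01 e'0).
apply: (@pinfty_near _ (M + M')) => x xM; have t0' := tail_ge0 V x.
have e1 : 0 <= 1 + e by lra.
have up : tail V (x - s) <= (1 + e) * tail V x.
  apply: (tail_le ltr01) => // y xy.
  have : M <= y by lra.
  by move=> /hM; rewrite ler_norml; lra.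
have down : (1 - e') * tail V x <= tail V (x - s).
  have e'2 : e' <= 1 / 2 by rewrite ge_min lexx orbT.
  have e'1 : 0 < 1 - e' by lra.
  rewrite -ler_pdivlMl//.
  rewrite -[X in tail V X <= _](subrK s).
  apply: (tail_le ltr01); first by rewrite invr_ge0 ltW.
  move=> y xy; rewrite ler_pdivlMl//; have : M' <= y + s by lra.
  by move=> /hM'; rewrite addrK ler_norml; lra.
have : e' * tail V x <= e * tail V x by rewrite ler_wpM2r.
rewrite ler_norml; lra.
Unshelve. all: by end_near. Qed.

Lemma in_OSloc_wmass V :
  (forall t, 0 < t -> \forall x \near +oo, 0 < wmass t V x) ->
  (forall t, 0 < t -> bigo (wmass t V) (wmass t (convp V V))) ->
  in_OSloc V.
Proof.
move=> pos os.
have bound (a b : R -> R) : (\forall x \near +oo, 0 < b x) -> bigo b a ->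
    (limf_esup (fun x => (a x)%:E / (b x)%:E) +oo%R < +oo)%E.
  move=> b0 [C C0 ab].
  apply: (@le_lt_trans _ _ C%:E); last exact: ltry.
  rewrite limf_esupE; pose A := [set x | 0 < b x /\ a x <= C * b x].
  apply: (@le_trans _ _ (ereal_sup ((fun x => ((a x)%:E / (b x)%:E)%E) @` A))).
    by apply: ereal_inf_lbound; exists A => //; exact: filterI.
  apply: ge_ereal_sup => _ [x /= [bx abx] <-].
  by rewrite inver gt_eqF// -EFinM lee_fin ler_pdivrMr.
case=> [t||//] t0.
  have {}t0 : 0 < t by rewrite -lte_fin.
  by under eq_fun do rewrite !local_mass_fin; apply: bound; [exact: pos|exact: os].
under eq_fun do rewrite !local_mass_pinfty.
apply: bound.
  have := pos 1 ltr01; apply: filterS => x /lt_le_trans; apply; exact: wmass_le_tail.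
have [C C0 /pinfty_ex[M M0 hM]] := os 1 ltr01; exists C => //.
apply: (@pinfty_near _ M) => x Mx; rewrite -[X in tail _ X <= _]addr0.
apply: (tail_le ltr01) => // y xy; rewrite addr0; apply: hM.
exact: le_trans xy.
Qed.

Lemma in_Lloc_pos V t : in_Lloc V -> 0 < t -> \forall x \near +oo, 0 < wmass t V x.
Proof.
move=> LV t0; have [+ _] := LV t%:E t0; apply: filterS => x.
by rewrite local_mass_fin lte_fin.
Qed.

(** The class speaks of backward shifts x - r with r > 0; a forward shift s is obtained by reading
    the backward statement at x + s. *)
Lemma in_Lloc_slow V t s e : in_Lloc V -> 0 < t -> 0 < e ->
  \forall x \near +oo, `|wmass t V x - wmass t V (x + s)| <= e * wmass t V x.
Proof.
move=> LV t0.
have back r d : 0 < r -> 0 < d ->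
    \forall x \near +oo, `|wmass t V x - wmass t V (x - r)| <= d * wmass t V x.
  move=> r0 d0; have := (LV t%:E t0).2 r r0.
  rewrite /equivalent_pinfty => /fine_cvg/cvgrPdist_le/(_ _ d0) h.
  have pos := in_Lloc_pos LV t0; near=> x.
  have px : 0 < wmass t V x by near: x.
  have : `|1 - fine (local_mass V t%:E (x - r) / local_mass V t%:E x)%E| <= d by near: x.
  rewrite !local_mass_fin inver gt_eqF// -EFinM/=.
  have -> : 1 - wmass t V (x - r) / wmass t V x =
      (wmass t V x - wmass t V (x - r)) / wmass t V x by rewrite mulrBl divff// gt_eqF.
  by rewrite normrM normfV (gtr0_norm px) ler_pdivrMr.
move=> e0; have [s0|s0|->] := ltgtP s 0.
- by have := back (- s) e; rewrite oppr_gt0 opprK; apply.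
(* The bound d <= 1/2 gives w (x + s) <= 2 w x, and d <= e / 2 then restores the error e. *)
- pose d := Num.min (e / 2) (1 / 2).
  have d0 : 0 < d by rewrite lt_min; apply/andP; split; lra.
  have := pinfty_shift s (back s d s0 d0); apply: filterS => x; rewrite addrK distrC.
  have d1 : d <= e / 2 by rewrite ge_min lexx.
  have d2 : d <= 1 / 2 by rewrite ge_min lexx orbT.
  have w0 := wmass_ge0 t V (x + s); have w1 := wmass_ge0 t V x.
  have : d * wmass t V (x + s) <= e / 2 * wmass t V (x + s) by rewrite ler_wpM2r.
  have : d * wmass t V (x + s) <= 1 / 2 * wmass t V (x + s) by rewrite ler_wpM2r.
  move=> h1 h2 h3.
  have h4 : wmass t V (x + s) <= 2 * wmass t V x.
    by move: h3; rewrite ler_norml; lra.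
  rewrite (le_trans h3)// (le_trans h2)//.
  have := ler_wpM2l (ltW e0) h4; lra.
- by apply: nearW => x; rewrite addr0 subrr normr0 mulr_ge0 ?wmass_ge0// ltW.
Unshelve. all: by end_near. Qed.

Lemma ratio_le (a b C : R) : 0 <= a -> 0 <= b -> (a%:E / b%:E <= C%:E)%E -> a <= C * b.
Proof.
move=> a0 b0; have [->|bN0] := eqVneq b 0.
  rewrite inver eqxx mulr0; have [->//|aN0] := eqVneq a 0.
  by rewrite gt0_muley ?lte_fin ?lt0r ?aN0// leye_eq.
by rewrite inver (negbTE bN0) -EFinM lee_fin ler_pdivrMr// lt0r bN0.
Qed.

(** As 0 / b is 0 in [\bar R], a quotient above c >= 0 has a positive numerator. The liminf
    hypotheses thus also yield the positivity of the windows of F^{*k}. *)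
Lemma ratio_gt (a b c : R) : 0 <= a -> 0 <= b -> 0 <= c -> (c%:E < a%:E / b%:E)%E ->
  0 < a /\ c * b <= a.
Proof.
move=> a0 b0 c0; have [->|aN0] := eqVneq a 0; first by rewrite mul0e lte_fin ltNge c0.
have {aN0}a1 : 0 < a by rewrite lt0r aN0.
have [->|bN0] := eqVneq b 0; first by rewrite mulr0 ltW.
rewrite inver (negbTE bN0) -EFinM lte_fin ltr_pdivlMr; last by rewrite lt0r bN0.
by move=> /ltW.
Qed.

Lemma in_OSloc_bigo V t : in_OSloc V -> 0 < t -> bigo (wmass t V) (wmass t (convp V V)).
Proof.
move=> OV t0; have := OV t%:E t0; rewrite limf_esupE => /ereal_inf_lt[_ [A nA <-]] supA.
have [C CP] : exists C : R, (ereal_sup ((fun x => (local_mass (convpow V 2) t%:E x /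
    local_mass V t%:E x)%E) @` A) <= C%:E)%E.
  move: supA; case: ereal_sup => [r _|//|_]; [by exists r|by exists 0; rewrite leNye].
exists `|C| => //; move: nA; apply: filterS => x Ax.
apply: (@le_trans _ _ (C * wmass t V x)); last by rewrite ler_wpM2r ?wmass_ge0// ler_norm.
apply: ratio_le; [exact: wmass_ge0..|].
apply: le_trans CP; apply: ereal_sup_ubound; exists x => //.
by rewrite !local_mass_fin.
Qed.

Lemma liminf_ratio (a : R -> R) (s c : R) : (forall x, 0 <= a x) -> 0 <= c -> c < 1 ->
  (1 <= limf_einf (fun x => (a (x - s))%:E / (a x)%:E) +oo%R)%E ->
  \forall x \near +oo, 0 < a (x - s) /\ c * a x <= a (x - s).
Proof.
move=> a0 c0 c1 /(lt_le_trans (_ : (c%:E < 1)%E)); rewrite lte_fin => /(_ c1).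
rewrite limf_einfE => /ereal_sup_gt[_ [A nA <-]] infA.
move: nA; apply: filterS => x Ax; apply: ratio_gt => //.
apply: (lt_le_trans infA); apply: ereal_inf_lbound.
by exists x.
Qed.

End local_mass.

(** * The compound Poisson component *)

Section compound_poisson_tail.
Context {R : realType} (T : R) (T0 : 0 < T) (m : {nonneg R}) (m0 : 0 < m%:num)
  (F H H1 : probability R R).
Local Notation H2 := (cpois m F).
Local Notation w := (wmass T).
Local Notation h := (w H).
Local Notation h2 := (w H2).
Local Notation f k := (w (convpow F k)).
Hypothesis H0 : supp_ge0 H.
Hypothesis H10 : supp_ge0 H1.
Hypothesis F0 : supp_ge0 F.
Hypothesis h_pos : \forall x \near +oo, 0 < h x.
Hypothesis h_long : forall t e : R, 0 < e ->
  \forall x \near +oo, `|h x - h (x + t)| <= e * h x.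
Hypothesis h_conv : bigo h (w (convp H H)).
Hypothesis HE : forall g, mean H g = mean (convp H1 H2) g.
Hypothesis f_dec : forall k (t e : R), (1 <= k)%N -> 0 < t -> 0 < e ->
  \forall x \near +oo, f k x <= (1 + e) * f k (x - t).
Hypothesis H1_small : forall e : R, 0 < e ->
  \forall x \near +oo, w H1 x <= e * h2 x.

Let h_ge0 x : 0 <= h x := wmass_ge0 T H x.

Lemma supp_ge0_compound_poisson (q : {nonneg R}) : supp_ge0 (cpois q F).
Proof.
have bi := @bmf_indic R _ (measurable_itv `]-oo, 0[).
suff : mean (cpois q F) (\1_(`]-oo, 0[%classic : set R)) = 0.
  rewrite mean_indic// => h'; rewrite /supp_ge0 -[LHS]fineK ?h'//.
  by rewrite ge0_fin_numE// (le_lt_trans (probability_le1 _ _))// ltry.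
apply: (mulfI (lt0r_neq0 (expR_gt0 q%:num))); rewrite mulr0.
apply/eqP; rewrite eq_le mulr_ge0 ?expR_ge0 ?mean_ge0// andbT.
have /cvgr_to_le := @mean_compound_poisson_cvg _ q F _ bi; apply.
apply: nearW => K; rewrite big1// => k _.
by rewrite mean_indic// (supp_ge0_convpow k F0) mulr0.
Qed.

Let H20 : supp_ge0 H2 := supp_ge0_compound_poisson m.

(** [H] gives to a window enlarged by A on both sides at least 3/4, a lower bound for the mass of
    ]-A, A] under [H1], times the mass of the original window under [H2]. *)
Lemma bigo_compound : bigo h h2.
Proof.
have [A A0 hA] := @mass_bounded _ H1 (1 / 4) 1 ltac:(lra).
apply: (@bigo_le _ _ _ (fun x => 4 / 3 * mean H (win (x + (- A)) (x + (A + T))))).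
  apply: nearW => x; rewrite HE mean_convolution; last exact: bmf_win0.
  have : mean H1 (fun u => h2 x * win (- A) A u) <=
      mean H1 (fun u => mean H2 (fun v => win (x + - A) (x + (A + T)) (u + v))).
    apply: ler_mean => [||u]; [by bm|by bm|].
    rewrite {1}/win; case: andP => [[uA Au]|_]; last by rewrite mulr0; apply: mean_ge0 => v; exact: win_ge0.
    rewrite mulr1; apply: ler_mean => [||v]; [by bm..|].
    rewrite [u + v]addrC win_shift; apply: le_win; lra.
  rewrite meanZ; last exact: bmf_win0.
  have := wmass_ge0 T H2 x; nra.
apply: bigoZ => //; apply: bigo_win => //.
by exists 1 => //; apply: nearW => x; rewrite mul1r.
Qed.

Lemma h_shift (t : R) : \forall x \near +oo, h (x + t) <= 2 * h x.
Proof. exact: h_shift_le. Qed.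

Lemma bigo_compound_double (m2 : {nonneg R}) : m2%:num = 2 * m%:num ->
  bigo h (w (cpois m2 F)).
Proof.
move=> m2E; apply: (@bigo_le _ _ _ (w (convp H2 H2))).
  apply: nearW => x; apply: mean_compound_poisson_double => //.
  exact: bmf_win0.
by apply: bigo_conv => //; exact: bigo_compound.
Qed.

Lemma convpow_le_compound k x :
  expcoeff m%:num k * f k x <= expR m%:num * h2 x.
Proof.
have := @mean_compound_poisson_ge _ m F _ k.+1 (bmf_win0 x (x + T)) (win_ge0 x (x + T)).
apply: le_trans; rewrite big_ord_recr/= lerDr sumr_ge0// => i _.
by rewrite mulr_ge0 ?expcoeff_ge0 ?mean_win_ge0.
Qed.

Lemma expcoeff_gt0 k : 0 < expcoeff m%:num k.
Proof. by rewrite divr_gt0 ?exprn_gt0// ltr0n fact_gt0. Qed.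

Lemma bigo_convpow k : bigo h (f k).
Proof.
apply: (@bigo_le _ _ _ (fun x => (expcoeff m%:num k)^-1 * (expR m%:num * h2 x))).
  by apply: nearW => x; rewrite ler_pdivlMl ?expcoeff_gt0// convpow_le_compound.
apply: bigoZ; first by rewrite invr_ge0 ltW// expcoeff_gt0.
by apply: bigoZ; [exact: expR_ge0|exact: bigo_compound].
Qed.

Lemma compound_tail (e : R) : 0 < e -> exists K0 : nat, forall K, (K0 <= K)%N ->
  \forall x \near +oo,
    `|expR m%:num * h2 x - \sum_(k < K) expcoeff m%:num k * f k x| <= e * h x.
Proof.
move=> e0; have m20 : 0 <= 2 * m%:num :> R by rewrite mulr_ge0.
pose m2 := NngNum m20.
have [C C0 m2C] := @bigo_compound_double m2 erefl.
pose D := expR m2%:num * C.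
have D0 : 0 <= D by rewrite mulr_ge0 ?expR_ge0.
exists (Num.bound (D / e)) => K DK; near=> x.
rewrite (le_trans (@mean_compound_poisson_tail _ m m2 F _ K (bmf_win0 x (x + T)) erefl))//.
have -> : (fun y => `|win x (x + T) y|) = win x (x + T).
  by apply/funext => y; rewrite ger0_norm// win_ge0.
rewrite ler_pdivrMl ?exprn_gt0//.
have hC : w (cpois m2 F) x <= C * h x by near: x.
rewrite (@le_trans _ _ (D * h x))//; first by rewrite -mulrA ler_wpM2l// expR_ge0.
rewrite mulrA ler_wpM2r// -ler_pdivrMr//.
rewrite (le_trans (ltW (archi_boundP (divr_ge0 D0 (ltW e0)))))//.
rewrite (@le_trans _ _ (K%:R))//; first by rewrite ler_nat.
by rewrite -natrX ler_nat ltnW// ltn_expl.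
Unshelve. all: by end_near. Qed.

Lemma convpow0_near : \forall x \near +oo, f 0 x = 0.
Proof.
apply: (@pinfty_near _ 0) => x x0.
by rewrite /wmass mean_convpow0 /win ?ltNge ?x0//; exact: bmf_win0.
Qed.

Lemma convpow_dec k (t : R) : 0 <= t -> upo h (fun x => f k x - f k (x - t)).
Proof.
rewrite le_eqVlt => /predU1P[<-|t0].
  by under [X in upo _ X]funext do rewrite subr0 subrr; exact: upo0.
case: k => [|k].
  apply: upo_le (upo0 h_ge0); have := convpow0_near.
  have := pinfty_shift (- t) convpow0_near; apply: filterS2 => x -> ->.
  by rewrite subrr.
have [C C0 fC] := bigo_shift h_long (- t) (bigo_convpow k.+1).
apply: (upo_eps h_ge0 C0) => e e0; have := f_dec (isT : (0 < k.+1)%N) t0 e0.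
move: fC; apply: filterS2 => x fC; rewrite mulrDl mul1r -lerBlDl => /le_trans; apply.
by rewrite (mulrC C) -mulrA ler_wpM2l// ltW.
Qed.

Lemma compound_dec (t : R) : 0 <= t -> upo h (fun x => h2 x - h2 (x - t)).
Proof.
move=> t0.
suff : upo h (fun x => (expR m%:num)^-1 * (expR m%:num * (h2 x - h2 (x - t)))).
  by apply: upo_le; apply: nearW => x; rewrite mulrA mulVf ?mul1r ?gt_eqF ?expR_gt0.
apply: (upoZ h_ge0); first by rewrite invr_ge0 expR_ge0.
apply: (@upo_eps _ _ h_ge0 _ 4) => // e e0.
have [K /(_ _ (leqnn K)) hK] := compound_tail e0.
have : upo h (fun x => \sum_(k < K) expcoeff m%:num k * (f k x - f k (x - t))).
  apply: (@upo_sum _ _ h_ge0 K (fun k x => expcoeff m%:num k * (f k x - f k (x - t)))).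
  by move=> k _; apply: (upoZ h_ge0); [exact: expcoeff_ge0|exact: convpow_dec].
move=> /(_ _ e0) hS; have hK' := pinfty_shift (- t) hK; have hs := h_shift (- t).
near=> x.
have : \sum_(k < K) expcoeff m%:num k * (f k x - f k (x - t)) <= e * h x by near: x.
under eq_bigr do rewrite mulrBr.
rewrite sumrB.
have : `|expR m%:num * h2 x - \sum_(k < K) expcoeff m%:num k * f k x| <= e * h x.
  by near: x.
have : `|expR m%:num * h2 (x - t) - \sum_(k < K) expcoeff m%:num k * f k (x - t)|
    <= e * h (x - t) by near: x.
have : e * h (x - t) <= e * (2 * h x) by rewrite ler_wpM2l ?(ltW e0)//; near: x.
rewrite !ler_norml => h1 /andP[h2' _] /andP[_ h3] h4; lra.
Unshelve. all: by end_near. Qed.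

(** In H = H1 * H2 the windows of [H1] beyond x0 contribute at most e w (H2 * H2), which the choice
    of e makes at most h / 2. What remains is an [H2] window of fixed length around x, covered by n
    windows that [compound_dec] bounds by h2 (x - x0) + o(h). *)
Lemma compound_large : exists2 c : R, 0 < c & \forall x \near +oo, c * h x <= h2 x.
Proof.
have [D D0 hD] := bigo_conv T0 h_long h_conv H20 H20 bigo_compound bigo_compound.
have e0 : 0 < (2 * (D + 1))^-1 by rewrite invr_gt0; lra.
have [x0 x00 hx0] := pinfty_ex (H1_small e0).
have [n hn] := win_cover T0 H2 (- x0) T.
have o_ : upo h (fun x => \sum_(i < n) (h2 (x + (- x0 + T *+ i)) - h2 (x - x0))).
  apply: (@upo_sum _ _ h_ge0 n (fun i x => h2 (x + (- x0 + T *+ i)) - h2 (x - x0))) => i _.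
  have t0 : 0 <= T *+ i by rewrite mulrn_wge0// ltW.
  have := upo_shift h_long (- x0 + T *+ i) (compound_dec t0).
  by apply: upo_le; apply: nearW => x; rewrite (addrA x) addrK.
have hle : \forall x \near +oo, h x <= 4 * n%:R * h2 (x - x0).
  have /o_ {}o_ : 0 < 1 / 4 :> R by lra.
  near=> x.
  have : h x <= (2 * (D + 1))^-1 * w (convp H2 H2) x +
      mean H2 (win (x - x0) (x + T)).
    rewrite {1}/wmass HE; apply: wmass_conv_split => //; exact: ltW.
  have : mean H2 (win (x - x0) (x + T)) <= \sum_(i < n) h2 (x + (- x0 + T *+ i)) by exact: hn.
  have : \sum_(i < n) (h2 (x + (- x0 + T *+ i)) - h2 (x - x0)) <= 1 / 4 * h x by near: x.
  rewrite sumrB sumr_const card_ord -mulr_natl => a1 a2 a3.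
  have : (2 * (D + 1))^-1 * w (convp H2 H2) x <= 1 / 2 * h x.
    rewrite ler_pdivrMl; last by lra.
    rewrite (@le_trans _ _ (D * h x))//; first by near: x.
    have := h_ge0 x; nra.
  have := h_ge0 x; lra.
exists (8 * n.+1%:R)^-1; first by rewrite invr_gt0 mulr_gt0// ltr0n.
(* The lower bound obtained is for h2 (x - x0); long-tailedness of the gauge removes the shift. *)
have := pinfty_shift x0 hle; have := pinfty_shift x0 (h_shift (- x0)).
apply: filterS2 => x; rewrite addrK => hx1 hx2.
rewrite ler_pdivrMl ?mulr_gt0 ?ltr0n// (le_trans hx1)//.
rewrite (@le_trans _ _ (2 * (4 * n%:R * h2 x)))//; first by rewrite ler_pM2l.
rewrite -natr1; have := wmass_ge0 T H2 x; lra.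
Unshelve. all: by end_near. Qed.

Lemma upo_H1 : upo h (w H1).
Proof.
have [C C0 hC] := bigo_compound; apply: (upo_eps h_ge0 C0) => e e0.
have := H1_small e0; move: hC; apply: filterS2 => x hC /le_trans; apply.
by rewrite (mulrC C) -mulrA ler_wpM2l// ltW.
Qed.

Lemma gauge_mean x : h x = mean H1 (fun y => h2 (x - y)).
Proof. by rewrite -wmass_convE wmass_convC /wmass HE. Qed.

Lemma bigo_gauge : bigo h h.
Proof. by exists 1 => //; apply: nearW => x; rewrite mul1r. Qed.

(* The increments of [h2] are one-sidedly small, and those of [h], which are
   averages of them under [H1], are small on both sides. *)
Lemma compound_slow (t : R) : 0 <= t -> upo h (fun x => h2 x - h2 (x + t)).
Proof.
move=> t0; have [A A0 hA] := @mass_bounded _ H1 (1 / 4) 1 ltac:(lra).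
(* With this s, x - y + s >= x + t for all y in [0, A]. *)
pose s := t + A; pose D (r z : R) := h2 z - h2 (z + r).
have s0 : 0 <= s by rewrite /s; lra.
pose B : set R := `[0, A]%classic.
have mB : measurable B by exact: measurable_itv.
have bB : bmf (\1_B : R -> R) by exact: bmf_indic.
pose p := mean H1 (\1_B).
have p0 : 3 / 4 <= p.
  apply: (@le_trans _ _ (1 - 1 / 4)); first by lra.
  rewrite (le_trans hA)//; apply: ler_mean_supp => // [|x x0]; first exact: bmf_win0.
  rewrite /win indicE mem_setE in_itv/= x0/= ler_nat.
  by case: (_ < _).
have bh2 (r x : R) : bmf (fun y : R => h2 (x - y + r)).
  have := bmf_wmass T H2 (x + r); congr bmf; apply/funext => y.
  by rewrite addrAC.
have bD (r x : R) : bmf (fun y : R => D r (x - y)).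
  have := bmf_wmass T H2 x; have := bh2 r x => ? ?; rewrite /D; bm.
have near_part : upo h (fun x => mean H1 (fun y => \1_B y * (D t x - D s (x - y)))).
  have [C C0 hC] := bigo_win T0 h_long t (t + A + T) bigo_compound.
  have [C1 C10 hC1] := bigo_compound.
  apply: (@mean_upo _ H1 B (fun x y => D t x - D s (x - y)) h (C + C1)) => //.
  - by move=> x; have := bD s x => ?; bm.
  - near=> x => y /=; rewrite /B/= in_itv/= => /andP[y0 yA].
    have : mean H2 (win (x + t) (x + (t + A + T))) <= C * h x by near: x.
    have : h2 x <= C1 * h x by near: x.
    have : h2 (x - y + s) <= mean H2 (win (x + t) (x + (t + A + T))).
      by apply: le_mean_win; rewrite /s; lra.
    have := wmass_ge0 T H2 (x + t); have := wmass_ge0 T H2 (x - y).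
    rewrite /D mulrDl; lra.
  (* D t x - D s (x - y) is the sum of h2 x - h2 (x - y) and h2 (x - y + s) - h2 (x + t), two
     increments of the kind that [compound_dec] bounds from above. *)
  - move=> y; rewrite /B/= in_itv/= => /andP[y0 yA].
    have u1 := compound_dec y0.
    have Ay0 : 0 <= A - y by lra.
    have u2 := upo_shift h_long (t + (A - y)) (compound_dec Ay0).
    apply: upo_le (upoD u1 u2); apply: nearW => x; rewrite /D.
    rewrite (_ : x - y + s = x + (t + (A - y))); last by rewrite /s; ring.
    rewrite (_ : x + (t + (A - y)) - (A - y) = x + t); last by ring.
    lra.
(* Off [0, A] the increment h2 (x - y + s) - h2 (x - y) is bounded by [compound_dec] when x - y is
   large; the other y cost a window of [H1], which is o(h). *)
have far_part : upo h (fun x => mean H1 (fun y => - ((1 - \1_B y) * D s (x - y)))).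
  have [C C0 hC] := bigo_conv T0 h_long h_conv H0 H10 bigo_gauge (upo_bigo upo_H1).
  apply: (@upo_eps _ _ h_ge0 _ (C + 1)); first by rewrite addr_ge0.
  move=> e e0; have := upo_shift h_long s (compound_dec s0).
  move=> /(_ e e0)/pinfty_ex[x0 x00 hx0].
  have oH1 := upo_win T0 h_long (- x0) (s + T) upo_H1 e0.
  near=> x; have bDs := bD s x.
  have : mean H1 (fun y => - ((1 - \1_B y) * D s (x - y))) <=
      e * w (convp H H1) x + 1 * mean H1 (win (x - x0) (x + (s + T))).
    apply: mean_split => //; [by bm; exact: bmf_cst|exact: ltW| |].
    - move=> y yx; have : - D s (x - y) <= e * h (x - y).
        by have := hx0 (x - y); rewrite /D addrK opprB; apply; lra.
      have : 0 <= e * h (x - y) by rewrite mulr_ge0// ltW.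
      rewrite indicE; case: (_ \in _) => /=; lra.
    - move=> y yx; rewrite mul1r; apply: (@le_trans _ _ (h2 (x - y + s))).
        have := wmass_ge0 T H2 (x - y); have := wmass_ge0 T H2 (x - y + s).
        rewrite /D indicE; case: (_ \in _) => /=; lra.
      have [yb|yb] := leP y (x + (s + T)).
        by rewrite /win yx yb/= /wmass mean_win_le1.
      rewrite /wmass mean_win_lt0 ?win_ge0//; lra.
  move=> /le_trans; apply; rewrite mulrDl mulrDl !mul1r lerD//; last by near: x.
  by rewrite (mulrC C) -mulrA ler_wpM2l ?(ltW e0)//; near: x.
have tot : upo h (fun x => p * D t x).
  have o3 : upo h (fun x => h x - h (x + s)).
    move=> e e0; have := h_long s e0; apply: filterS => x; exact: le_trans (ler_norm _).
  apply: upo_le (upoD near_part (upoD far_part o3)); apply: nearW => x.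
  have bDs := bD s x.
  have -> : h x - h (x + s) = mean H1 (fun y => D s (x - y)).
    rewrite meanB; [|exact: bmf_wmass|exact: bh2].
    rewrite !gauge_mean; congr (_ - mean _ _).
    by apply/funext => y; rewrite addrAC.
  rewrite -!meanD; [|by bm..].
  rewrite mulrC -meanZ//; apply: ler_mean => [||y]; [by bm|by bm|lra].
apply: upo_le (upoZ h_ge0 (_ : 0 <= p^-1) tot); last by rewrite invr_ge0; lra.
apply: nearW => x; rewrite mulrA mulVf ?mul1r//; lra.
Unshelve. all: by end_near. Qed.

Lemma convpow_slow n (t : R) : 0 <= t -> upo h (fun x => f n x - f n (x + t)).
Proof.
move=> t0; set c := expcoeff m%:num n; have c0 : 0 < c := expcoeff_gt0 n.
suff : upo h (fun x => c * (f n x - f n (x + t))).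
  have ci : 0 <= c^-1 by rewrite invr_ge0 ltW.
  move=> /(upoZ h_ge0 ci); apply: upo_le; apply: nearW => x.
  by rewrite mulrA mulVf ?mul1r ?gt_eqF.
apply: (@upo_eps _ _ h_ge0 _ 5) => // e e0.
have [K0 hK0] := compound_tail e0; pose K := maxn K0 n.+1.
have nK : (n < K)%N by rewrite leq_max ltnSn orbT.
have hK := hK0 K (leq_maxl _ _); have hK' := pinfty_shift t hK.
have o1 := upoZ h_ge0 (expR_ge0 m%:num) (compound_slow t0) e0.
(* The decrement of the n-th term is the decrement of the whole sum plus the opposite increments of
   the other terms, each of them small from above. *)
pose G k x := if k == n then 0 else expcoeff m%:num k * (f k (x + t) - f k x).
have o2 : upo h (fun x => \sum_(k < K) G k x).
  apply: (upo_sum h_ge0) => k _; rewrite /G; case: eqP => _; first exact: upo0.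
  apply: (upoZ h_ge0); first exact: expcoeff_ge0.
  apply: upo_le (upo_shift h_long t (convpow_dec k t0)); apply: nearW => x.
  by rewrite addrK.
have {}o2 := o2 _ e0; have hs := h_shift t.
near=> x.
have : expR m%:num * (h2 x - h2 (x + t)) <= e * h x by near: x.
have : \sum_(k < K) G k x <= e * h x by near: x.
have : `|expR m%:num * h2 x - \sum_(k < K) expcoeff m%:num k * f k x| <= e * h x.
  by near: x.
have : `|expR m%:num * h2 (x + t) - \sum_(k < K) expcoeff m%:num k * f k (x + t)|
    <= e * h (x + t) by near: x.
have : e * h (x + t) <= e * (2 * h x) by rewrite ler_wpM2l ?(ltW e0)//; near: x.
have -> : \sum_(k < K) G k x = \sum_(k < K) expcoeff m%:num k * f k (x + t) -
    \sum_(k < K) expcoeff m%:num k * f k x + c * (f n x - f n (x + t)).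
  rewrite -sumrB (bigD1 (Ordinal nK))//= [in RHS](bigD1 (Ordinal nK))//=.
  rewrite /G eqxx add0r -/c -mulrBr addrAC -mulrDr addrA subrK subrr mulr0 add0r.
  by apply: eq_bigr => k; rewrite -val_eqE/= => /negPf ->; rewrite mulrBr.
rewrite !ler_norml => h1 /andP[_ h2'] /andP[h3 _] h4 h5; lra.
Unshelve. all: by end_near. Qed.

Lemma upo_norm g : upo h g -> upo h (fun x => - g x) -> upo h (fun x => `|g x|).
Proof.
move=> g1 g2 e e0; have := g1 _ e0; have := g2 _ e0; apply: filterS2 => x.
rewrite ler_norml; lra.
Qed.

Lemma slow_norm A :
  (forall t, 0 <= t -> upo h (fun x => w A x - w A (x - t))) ->
  (forall t, 0 <= t -> upo h (fun x => w A x - w A (x + t))) ->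
  forall t, upo h (fun x => `|w A x - w A (x + t)|).
Proof.
move=> dec slow t; have [t0|/ltW t0] := leP 0 t.
  apply: upo_norm; first exact: slow.
  apply: upo_le (upo_shift h_long t (dec t t0)); apply: nearW => x.
  by rewrite addrK opprB.
have nt0 : 0 <= - t by rewrite oppr_ge0.
apply: upo_norm; first by have := dec _ nt0; rewrite opprK.
apply: upo_le (upo_shift h_long t (slow _ nt0)); apply: nearW => x.
by rewrite addrK opprB.
Qed.

Lemma compound_slow_norm t : upo h (fun x => `|h2 x - h2 (x + t)|).
Proof. exact: slow_norm compound_dec compound_slow t. Qed.

Lemma convpow_slow_norm n t : upo h (fun x => `|f n x - f n (x + t)|).
Proof. exact: slow_norm (convpow_dec n) (convpow_slow n) t. Qed.

(* On [u > A], [u + v \in ]x, x + T]] forces [v <= x - x0], where the windows of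
   [H1] are negligible with respect to those of [H2]. *)
Lemma H1_far : exists2 D : R, 0 <= D & forall e : R, 0 < e -> exists A0 : R,
  forall A, A0 <= A -> \forall x \near +oo,
    mean H1 (fun u => \1_(`]A, +oo[%classic : set R) u * h2 (x - u)) <= (D * e) * h x.
Proof.
have [D D0 hD] := bigo_conv T0 h_long h_conv H20 H20 bigo_compound bigo_compound.
exists D => // e e0; have [x0 x00 hx0] := pinfty_ex (H1_small e0).
exists (x0 + T) => A hA; near=> x.
pose I : R -> R := \1_(`]A, +oo[%classic : set R).
have bI : bmf I by apply: bmf_indic; exact: measurable_itv.
have I1 u : 0 <= I u <= 1 by rewrite /I indicE; case: (_ \in _); rewrite /= ?lexx ?ler01.
have -> : mean H1 (fun u => I u * h2 (x - u)) =
    mean H2 (fun v => mean H1 (fun u => I u * win x (x + T) (u + v))).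
  rewrite -(mean_fubini H1 H2 (f := fun u v => I u * win x (x + T) (u + v))); last by bm.
  congr mean; apply/funext => u; rewrite meanZ; last by bm.
  congr (_ * mean _ _); apply/funext => v.
  by rewrite [u + v]addrC win_shift addrAC.
have : mean H2 (fun v => mean H1 (fun u => I u * win x (x + T) (u + v))) <=
    e * w (convp H2 H2) x + 0 * mean H2 (win (x - x0) (x + T)).
  apply: mean_split => //; [by bm|exact: ltW| |].
  - move=> v vx; apply: (@le_trans _ _ (w H1 (x - v))); last by apply: hx0; lra.
    apply: ler_mean => [||u]; [by bm|exact: bmf_win0|].
    rewrite win_shift addrAC -[leRHS]mul1r ler_wpM2r ?win_ge0//.
    by have /andP[] := I1 u.
  - move=> v vx; rewrite mul0r -[leRHS](mean_cst H1).
    apply: ler_mean => [||u]; [by bm|exact: bmf_cst|].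
    rewrite /I indicE mem_setE in_itv/= andbT /win.
    case: ltP => [Au|_]; last by rewrite mul0r.
    rewrite (_ : (u + v <= x + T) = false) ?andbF ?mulr0//.
    by apply/negbTE; rewrite -ltNge; lra.
move=> /le_trans; apply; rewrite mul0r addr0 (mulrC D) -mulrA ler_wpM2l ?(ltW e0)//.
by near: x.
Unshelve. all: by end_near. Qed.

(** * Transfer of one Fourier mode from [H] to [H2] and to the powers of [F] *)

Section frequency.
Variables (om : R) (omT : forall y th : R, cos (om * (y + T) + th) = cos (om * y + th)).
Hypothesis H_osc : forall th, upo h (fun x => `|osc T H om th x|).
Hypothesis H1_char : 0 < charnorm H1 om.

(** Given the [H1] part u, the mode of [H] at x is the mode of [H2] at x - u with phase om u + th.
    By [osc_slow] x - u may be replaced by x, large u being negligible by [H1_far]; averaging the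
    phase over u then produces the characteristic function of [H1]. *)
Lemma H1_rotation th : upo h (fun x =>
  `|cmean H1 om * osc T H2 om th x + smean H1 om * osc T H2 om (th + pi / 2) x|).
Proof.
have [D D0 far] := H1_far; have [C C0 hC] := bigo_compound.
apply: (@upo_eps _ _ h_ge0 _ (D + C + 2)) => [|e e0]; first by lra.
have [A0 {}far] := far e e0.
have [A A0A hA] := @mass_bounded _ H1 e A0 e0.
have {}far := far A A0A.
pose B : set R := `[0, A]%classic.
have mB : measurable B by exact: measurable_itv.
have bB : bmf (\1_B : R -> R) by exact: bmf_indic.
pose I : R -> R := \1_(`]A, +oo[%classic : set R).
have bI : bmf I by apply: bmf_indic; exact: measurable_itv.
pose g x u := osc T H2 om (om * u + th) (x - u) - osc T H2 om (om * u + th) x.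
have b1 (x : R) : bmf (fun u => osc T H2 om (om * u + th) (x - u)).
  by under [X in bmf X]funext do rewrite osc_shift; bm.
have b2 (x : R) : bmf (fun u => osc T H2 om (om * u + th) x).
  by rewrite /osc; bm.
have bg x : bmf (g x) by have := b1 x; have := b2 x => ? ?; rewrite /g; bm.
have g_le x u : `|g x u| <= h2 (x - u) + h2 x.
  by rewrite (le_trans (ler_normB _ _))// lerD// ler_norm_osc.
have near_part : upo h (fun x => mean H1 (fun u => \1_B u * `|g x u|)).
  have [C2 C20 hC2] := bigo_win T0 h_long (- A) T bigo_compound.
  apply: (@mean_upo _ H1 B (fun x u => `|g x u|) h (C2 + C)) => //.
  - by move=> x; have := bg x => ?; bm.
  - near=> x => u; rewrite /B/= in_itv/= => /andP[u0 uA].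
    rewrite (le_trans (g_le _ _))// mulrDl lerD//; last by near: x.
    apply: (@le_trans _ _ (mean H2 (win (x - A) (x + T)))); last by near: x.
    by apply: le_mean_win; lra.
  - move=> u; rewrite /B/= in_itv/= => /andP[u0 uA].
    have := osc_slow T0 h_long omT (om * u + th) bigo_compound compound_slow_norm u0.
    move=> /(upo_shift h_long (- u)); apply: upo_le; apply: nearW => x.
    by rewrite /g subrK.
have {}near_part := near_part _ e0; have Hosc := H_osc th e0.
near=> x.
have bgx := bg x; have b1x := b1 x; have b2x := b2 x; have bh2x := bmf_wmass T H2 x.
have rotE : mean H1 (fun u => osc T H2 om (om * u + th) x) =
    cmean H1 om * osc T H2 om th x + smean H1 om * osc T H2 om (th + pi / 2) x.
  under [X in mean _ X]funext do rewrite addrC oscD mulrC [X in _ + X]mulrC.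
  have bc := bmf_cost om; have bs := bmf_sint om.
  by rewrite meanD ?meanZ; [rewrite mulrC [X in _ + X]mulrC| by bm..].
have oscE : osc T H om th x = mean H1 (fun u => osc T H2 om (om * u + th) (x - u)).
  rewrite /osc HE mean_convolution; last exact: bmf_osc.
  by congr mean; apply/funext => u; rewrite -osc_shift.
rewrite -rotE.
have -> : mean H1 (fun u => osc T H2 om (om * u + th) x) = osc T H om th x - mean H1 (g x).
  by rewrite oscE /g meanB// subKr.
rewrite (le_trans (ler_normB _ _))//.
have n1 : `|osc T H om th x| <= e * h x by near: x.
have n2 : mean H1 (fun u => \1_B u * `|g x u|) <= e * h x by near: x.
have n3 : mean H1 (fun u => I u * h2 (x - u)) <= (D * e) * h x by near: x.
have n4 : h2 x <= C * h x by near: x.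
have n5 : mean H1 I <= e.
  have : mean H1 I <= mean H1 (fun u => 1 - win (- A) A u).
    apply: ler_mean => [//||u]; first by bm; exact: bmf_cst.
    rewrite /I indicE mem_setE in_itv/= andbT.
    have [Au|uA] := ltP A u; last by rewrite subr_ge0 win_le1.
    by rewrite /win (leNgt u A) Au andbF subr0.
  rewrite meanB ?mean_cst; [|exact: bmf_cst|exact: bmf_win0].
  lra.
have : `|mean H1 (g x)| <= mean H1 (fun u => \1_B u * `|g x u|) +
    (mean H1 (fun u => I u * h2 (x - u)) + h2 x * mean H1 I).
  rewrite (le_trans (ler_norm_mean _ bgx))// -meanZ// -!meanD; [|by bm..].
  apply: ler_mean_supp => //; [by bm|by bm|move=> u u0].
  rewrite /I !indicE !mem_setE !in_itv/= u0 andbT/=.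
  have := g_le x u; case: leP => /=; lra.
have : h2 x * mean H1 I <= (C * h x) * e.
  by rewrite ler_pM ?wmass_ge0// mean_ge0// => u; rewrite /I indicE.
rewrite !mulrDl; lra.
Unshelve. all: by end_near. Qed.

(** [H1_rotation] at the phases th and th + pi / 2 is, up to o(h), a homogeneous linear system in
    the two modes of [H2], with determinant [charnorm H1 om]. *)
Lemma compound_osc th : upo h (fun x => `|osc T H2 om th x|).
Proof.
set C := cmean H1 om; set S := smean H1 om.
have h1 := H1_rotation th; have h2' := H1_rotation (th + pi / 2).
have o := upoD (upoZ h_ge0 (normr_ge0 C) h1) (upoZ h_ge0 (normr_ge0 S) h2').
apply: upo_le (upoZ h_ge0 (_ : 0 <= (charnorm H1 om)^-1) o); last by rewrite invr_ge0 ltW.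
apply: nearW => x; rewrite ler_pdivlMl// -!normrM.
have -> : osc T H2 om (th + pi / 2 + pi / 2) x = - osc T H2 om th x.
  have := oscD T H2 om th pi x; rewrite cospi sinpi mul0r addr0 mulN1r => <-.
  by rewrite -addrA -splitr.
rewrite -{1}(gtr0_norm H1_char) -normrM /charnorm -/C -/S.
rewrite (le_trans _ (ler_normB _ _))// le_eqVlt; apply/predU1l; congr (`| _ |); ring.
Qed.
Let Phi (th x s : R) : R := win x (x + T) s * cos (om * s + th).

Let bPhi th x : bmf (Phi th x). Proof. exact: bmf_osc. Qed.

Let Phi_out th x s : x + T < s -> Phi th x s = 0.
Proof.
by move=> xs; rewrite /Phi /win (leNgt s) xs andbF mul0r.
Qed.

Let bclip (x : R) d (U : measurableType d) (g : U -> R) : 0 <= x ->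
  measurable_fun setT g -> bmf (fun y => clip (x + T) (g y)).
Proof. by move=> x0; apply: bmf_clip; rewrite addr_ge0// ltW. Qed.

(** The mode, on the window at x, of the size-biased law u H2(du) convolved with F^{*q}; the size is
    clipped at the end x + T of the window. *)
Let R_ q th x : R := mean H2 (fun u => mean (convpow F q) (fun v =>
  clip (x + T) u * Phi th x (u + v))).

(** For fixed v the integrand lives on the [H2] window at z = x - v, where the size is z up to [T].
    The integral is thus z times a mode of [H2], small with respect to h z, plus at most T h2 z. As
    z <= x, averaging over F^{*q} gives o(x h). *)
Lemma size_biased_compound q th (e : R) : 0 < e ->
  \forall x \near +oo, `|R_ q th x| <= e * x * h x.
Proof.
have Fq0 := supp_ge0_convpow q F0.
have [C C0 /pinfty_ex[x1 x10 hC]] := bigo_compound.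
have [D D0 hD] := bigo_conv T0 h_long h_conv H0 Fq0 bigo_gauge (bigo_convpow q).
move=> e0; pose e' := e / (4 * (D + 1)).
have e'0 : 0 < e' by rewrite divr_gt0// mulr_gt0//; lra.
have e'_ge0 := ltW e'0; have T_ge0 := ltW T0; have e_ge0 := ltW e0.
have o1 := upoD (compound_osc 0) (compound_osc (pi / 2)).
have /pinfty_ex[x2 x20 ho] := o1 _ e'0.
pose x0 := x1 + x2; have x00 : 0 <= x0 by rewrite /x0; lra.
have [E E0 hE] := bigo_win T0 h_long (- x0) T (bigo_convpow q).
have big : \forall x \near +oo, 2 * (T * C * D + (x0 + T) * E) / e <= x by exact: near_ge.
near=> x.
have xpos : 0 <= x by near: x; exact: near_ge.
have bP := bPhi th x; have xT : 0 <= x + T by rewrite addr_ge0// ltW.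
have bcl := fun (d : measure_display) (U : measurableType d) (g : U -> R) => @bclip x d U g xpos.
have bF : bmf (fun z : R * R => clip (x + T) z.1 * Phi th x (z.1 + z.2)).
  by apply: bmfM; [apply: bcl; mf|bm].
have bF' : bmf (fun z : R * R => clip (x + T) z.2 * Phi th x (z.2 + z.1)).
  by apply: bmfM; [apply: bcl; mf|bm].
pose psi v := mean H2 (fun u => clip (x + T) u * Phi th x (u + v)).
have bpsi : bmf psi by exact: (@bmf_mean _ _ _ _ _ H2 (fun v u => clip (x + T) u * Phi th x (u + v)) bF').
have -> : R_ q th x = mean (convpow F q) psi.
  by rewrite /R_ (mean_fubini H2 (convpow F q) (f := fun u v => clip (x + T) u * Phi th x (u + v))).
rewrite (le_trans (ler_norm_mean _ bpsi))//.
(* Restricting to v >= 0 is what makes z = x - v at most x. *)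
pose J : R -> R := \1_(`[0, +oo[%classic : set R).
have bJ : bmf J by apply: bmf_indic; exact: measurable_itv.
have -> : mean (convpow F q) (fun v => `|psi v|) = mean (convpow F q) (fun v => J v * `|psi v|).
  apply: eq_mean_supp => //; [by bm|by bm|move=> v v0].
  by rewrite /J indicE mem_setE in_itv/= v0 mul1r.
have psiE v : psi v = mean H2 (fun u => clip (x + T) u *
    (win (x - v) (x - v + T) u * cos (om * u + (om * v + th)))).
  congr mean; apply/funext => u; rewrite /Phi win_shift (addrAC x).
  by congr (_ * (_ * cos _)); ring.
have bclip0 : bmf (fun u : R => clip (x + T) u) by apply: bcl; mf.
have cpos : 0 <= e' * x + T * C by apply: addr_ge0; apply: mulr_ge0.
have : mean (convpow F q) (fun v => J v * `|psi v|) <=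
    (e' * x + T * C) * w (convp H (convpow F q)) x +
    (x0 + T) * mean (convpow F q) (win (x - x0) (x + T)).
  apply: mean_split => //; [by bm|exact: addr_ge0| |].
  - move=> v vx; have hz := h_ge0 (x - v).
    rewrite /J indicE mem_setE in_itv/= andbT; have [v0|_] := leP 0 v; last first.
      by rewrite mul0r; apply: mulr_ge0.
    rewrite mul1r psiE; set z := x - v.
    have zx1 : x1 <= z by rewrite /z; move: vx; rewrite /x0; lra.
    have zx2 : x2 <= z by rewrite /z; move: vx; rewrite /x0; lra.
    have z0 : 0 <= z by exact: le_trans zx1.
    have zx : z <= x by rewrite /z; lra.
    have bo := bmf_osc T om (om * v + th) z.
    have -> : mean H2 (fun u => clip (x + T) u * (win z (z + T) u * cos (om * u + (om * v + th)))) =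
        z * osc T H2 om (om * v + th) z +
        mean H2 (fun u => (clip (x + T) u - z) * (win z (z + T) u * cos (om * u + (om * v + th)))).
      rewrite -meanZ// -meanD; [|by bm|by apply: bmfM => //; apply: bmfB => //; exact: bmf_cst].
      by congr mean; apply/funext => u; ring.
    rewrite (le_trans (ler_normD _ _))// [X in _ <= X]mulrDl lerD//.
      rewrite normrM (ger0_norm z0) -(mulrA e') (mulrCA e') ler_pM//.
      by rewrite (le_trans (osc_le _ _ _ _ _))// ho.
    have bd : bmf (fun u => (clip (x + T) u - z) * (win z (z + T) u * cos (om * u + (om * v + th)))).
      by apply: bmfM => //; apply: bmfB => //; exact: bmf_cst.
    rewrite (le_trans (ler_norm_mean _ bd))//.
    rewrite -(mulrA T) (@le_trans _ _ (T * h2 z))//; last first.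
      by rewrite ler_wpM2l// hC.
    rewrite /wmass -meanZ; last exact: bmf_win0.
    apply: ler_mean => [||u]; [by bm|by bm|].
    rewrite !normrM (ger0_norm (win_ge0 _ _ _)) /win.
    case: andP => [[zu uz]|_]; last by rewrite !mul0r !mulr0.
    rewrite mul1r mulr1 -[leRHS]mulr1 ler_pM ?cos_max//.
    rewrite clip_id; first by rewrite ler_norml; lra.
    by apply/andP; split; lra.
  - move=> v vx; rewrite /J indicE mem_setE in_itv/= andbT.
    have x0T : 0 <= x0 + T by rewrite addr_ge0// ltW.
    have [v0|_] := leP 0 v; last by rewrite mul0r mulr_ge0 ?win_ge0.
    rewrite mul1r psiE; set z := x - v.
    have bo := bmf_osc T om (om * v + th) z.
    have bd : bmf (fun u => clip (x + T) u * (win z (z + T) u * cos (om * u + (om * v + th)))).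
      by bm.
    rewrite (le_trans (ler_norm_mean _ bd))//.
    apply: (@le_trans _ _ ((x0 + T) * h2 z)).
      rewrite /wmass -meanZ; last exact: bmf_win0.
      apply: ler_mean => [||u]; [by bm|by bm|].
      rewrite !normrM (ger0_norm (win_ge0 _ _ _)) /win.
      case: andP => [[zu uz]|_]; last by rewrite !mul0r !mulr0.
      rewrite mul1r mulr1 -[leRHS]mulr1 ler_pM ?cos_max// ger0_norm ?clip_ge0//.
      by apply: clip_le_arg => //; move: uz; rewrite /z; lra.
    by rewrite ler_wpM2l//; apply: wmass_le_win.
move=> /le_trans; apply.
have hx := h_ge0 x.
have n1 : w (convp H (convpow F q)) x <= D * h x by near: x.
have n2 : mean (convpow F q) (win (x - x0) (x + T)) <= E * h x by near: x.
have a1 : (e' * x + T * C) * w (convp H (convpow F q)) x <= (e' * x + T * C) * (D * h x).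
  by rewrite ler_wpM2l.
have a2 : (x0 + T) * mean (convpow F q) (win (x - x0) (x + T)) <= (x0 + T) * (E * h x).
  by rewrite ler_wpM2l// addr_ge0// ltW.
have a3 : e' * D <= e / 4.
  have eE : e' * (4 * (D + 1)) = e by rewrite /e' divfK// gt_eqF//; lra.
  lra.
have a4 : e' * D * (x * h x) <= e / 4 * (x * h x) by rewrite ler_wpM2r// mulr_ge0.
have a5 : (T * C * D + (x0 + T) * E) <= e / 2 * x.
  have : 2 * (T * C * D + (x0 + T) * E) / e <= x by near: x.
  rewrite ler_pdivrMr//; lra.
have a6 : (T * C * D + (x0 + T) * E) * h x <= e / 2 * x * h x by rewrite ler_wpM2r.
have a7 : 0 <= e * x * h x by rewrite !mulr_ge0// ltW.
lra.
Unshelve. all: by end_near. Qed.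

Let a_ p th x : R := bias F (x + T) (Phi th x) 1 p.

Let wmass_convpow_add (m2 : {nonneg R}) i p x :
  mean (convpow F i) (fun u => mean (convp (cpois m2 F) (convpow F p))
    (fun y => win x (x + T) (u + y))) =
  w (convp (cpois m2 F) (convpow F (i + p))) x.
Proof.
rewrite /wmass mean_conv2 ?mean_convpowD; [|by bm|exact: bmf_win0].
congr mean; apply/funext => u; rewrite mean_conv2; last by bm.
congr mean; apply/funext => v; congr mean; apply/funext => z.
by congr win; rewrite addrCA.
Qed.

(** The size-bias identity on coefficients: k m^k / k! = m m^(k-1) / (k-1)!. With [bias_mul] the sum
    becomes a partial sum of the series of [expR m * R_ q], whose remainder is bounded by the law of
    doubled intensity. *)
Let bias_partial (m2 : {nonneg R}) q J th x : m2%:num = 2 * m%:num -> 0 <= x ->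
  `|m%:num * \sum_(j < J) expcoeff m%:num j * a_ (j + q) th x| <=
  expR m%:num * `|R_ q th x| +
  2 ^- J * (expR m2%:num * ((x + T) * w (convp (cpois m2 F) (convpow F q)) x)).
Proof.
move=> m2E x0; have xT : 0 <= x + T by rewrite addr_ge0// ltW.
have bP := bPhi th x.
pose g u := mean (convpow F q) (fun v => clip (x + T) u * Phi th x (u + v)).
have bclip0 : bmf (fun u : R => clip (x + T) u) by apply: bclip => //; mf.
have bg : bmf g.
  rewrite (_ : g = fun u => clip (x + T) u * mean (convpow F q) (fun v => Phi th x (u + v))).
    by bm.
  by apply/funext => u; rewrite /g meanZ//; bm.
have E : m%:num * \sum_(j < J) expcoeff m%:num j * a_ (j + q) th x =
    \sum_(k < J.+1) expcoeff m%:num k * mean (convpow F k) g.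
  rewrite big_ord_recl -[mean (convpow F ord0) g]/(bias F (x + T) (Phi th x) 0 q).
  rewrite bias0// mulr0 add0r mulr_sumr; apply: eq_bigr => j _.
  rewrite -[mean _ g]/(bias F (x + T) (Phi th x) j.+1 q) bias_mul//; last exact: Phi_out.
  rewrite -/(a_ (j + q) th x) lift0.
  have -> : expcoeff m%:num j.+1 = m%:num / j.+1%:R * expcoeff m%:num j.
    rewrite /expcoeff exprS factS natrM invfM; ring.
  have j1 : j.+1%:R != 0 :> R by rewrite pnatr_eq0.
  by field.
rewrite E; have := @mean_compound_poisson_tail _ m m2 F g J.+1 bg m2E.
set S := \sum_(k < _) _; rewrite -/(R_ q th x) => tail.
have le1 : mean (cpois m2 F) (fun u => `|g u|) <=
    (x + T) * w (convp (cpois m2 F) (convpow F q)) x.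
  rewrite /wmass mean_convolution; last exact: bmf_win0.
  rewrite -meanZ; last by bm.
  apply: ler_mean => [||u]; [by bm|by bm|].
  have bv : bmf (fun v => clip (x + T) u * Phi th x (u + v)) by bm; exact: bmf_cst.
  rewrite (le_trans (ler_norm_mean _ bv))// -meanZ; last by bm.
  apply: ler_mean => [||v]; [by bm|by bm|].
  rewrite normrM ger0_norm ?clip_ge0// ler_pM ?clip_ge0 ?clip_le//.
  rewrite /Phi normrM ger0_norm ?win_ge0// -[leRHS]mulr1 ler_wpM2l ?win_ge0//.
  exact: cos_max.
have le2 : 2 ^- J.+1 * (expR m2%:num * mean (cpois m2 F) (fun u => `|g u|)) <=
    2 ^- J * (expR m2%:num * ((x + T) * w (convp (cpois m2 F) (convpow F q)) x)).
  rewrite ler_pM ?invr_ge0 ?exprn_ge0 ?mulr_ge0 ?expR_ge0 ?mean_ge0//.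
    by rewrite lef_pV2 ?posrE ?exprn_gt0// exprS ler_peMl ?exprn_ge0// ler1n.
  by rewrite ler_wpM2l// expR_ge0.
have := le_trans tail le2.
rewrite -{2}(ger0_norm (expR_ge0 m%:num)) -normrM.
have := ler_normB (expR m%:num * R_ q th x) (expR m%:num * R_ q th x - S).
rewrite subKr; lra.
Qed.

(** [expcoeff_inversion] expresses a_p through the sums of [bias_partial], whose main terms are o(x
    h). In the remainders 2^-(K - i) = 2^-K 2^i turns the weight m^i / i! into (2 m)^i / i!; these
    weights add up to one more convolution with the law of intensity 2 m, and the total is 2^-K O(x
    h). *)
Lemma bias_small p th (e : R) : 0 < e -> \forall x \near +oo, `|a_ p th x| <= e * x * h x.
Proof.
move=> e0; have m20 : 0 <= 2 * m%:num :> R by rewrite mulr_ge0.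
pose m2 := NngNum m20; pose P2 := cpois m2 F.
have d2 : bigo h (w P2) by exact: bigo_compound_double.
have P20 : supp_ge0 P2 by exact: supp_ge0_compound_poisson.
have Fp0 := supp_ge0_convpow p F0.
have [D D0 hD] := bigo_conv T0 h_long h_conv P20 (supp_ge0_convolution P20 Fp0) d2
  (bigo_conv T0 h_long h_conv P20 Fp0 d2 (bigo_convpow p)).
(* The constant of the remainders: one exponential from [bias_partial], one from the sum over i, and
   the factor 2 from x + T <= 2 x. *)
pose c := m%:num^-1 * (expR m2%:num * (2 * (expR m2%:num * D))).
have c0 : 0 <= c by rewrite !mulr_ge0 ?invr_ge0 ?expR_ge0// ltW.
pose K := (Num.bound (c / (e / 2))).+1.
have cK : 2 ^- K * c <= e / 2.
  rewrite ler_pdivrMl ?exprn_gt0// mulrC -ler_pdivrMl ?divr_gt0// mulrC.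
  have q0 : 0 <= c / (e / 2) by rewrite divr_ge0// divr_ge0// ltW.
  rewrite (le_trans (ltW (archi_boundP q0)))// -natrX ler_nat ltnW//.
  by rewrite (leq_trans _ (ltnW (ltn_expl K (ltnSn 1)))).
(* The terms are o(x h), so the finite sum is taken with respect to this gauge; the norm keeps it
   nonnegative everywhere. *)
pose h' x := `|x| * h x.
have h'0 x : 0 <= h' x by rewrite mulr_ge0.
have o1 : upo h' (fun x => \sum_(i < K) expcoeff m%:num i *
    (m%:num^-1 * (expR m%:num * `|R_ (i + p) th x|))).
  apply: (@upo_sum _ _ h'0 K (fun i x => expcoeff m%:num i *
    (m%:num^-1 * (expR m%:num * `|R_ (i + p) th x|)))) => i _.
  apply: (upoZ h'0); first exact: expcoeff_ge0.
  apply: (upoZ h'0); first by rewrite invr_ge0.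
  apply: (upoZ h'0); first exact: expR_ge0.
  move=> r r0; have := size_biased_compound (i + p) th r0; have := near_ge (0 : R).
  by apply: filterS2 => x x0; rewrite -mulrA /h' (ger0_norm x0).
have {}o1 := o1 (e / 2) ltac:(lra).
near=> x.
have x0 : 0 <= x by near: x; exact: near_ge.
have Tx : T <= x by near: x; exact: near_ge.
have hx := h_ge0 x.
have -> : a_ p th x = \sum_(i < K) expcoeff (- m%:num) i *
    \sum_(j < K - i) expcoeff m%:num j * a_ (j + (i + p)) th x.
  exact: (expcoeff_inversion m%:num (fun q => a_ q th x)).
rewrite (le_trans (ler_norm_sum _ _ _))//.
pose W i := w (convp P2 (convpow F (i + p))) x.
have W0 i : 0 <= W i by exact: wmass_ge0.
have term (i : 'I_K) : `|expcoeff (- m%:num) i * \sum_(j < K - i) expcoeff m%:num j * a_ (j + (i + p)) th x| <=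
    expcoeff m%:num i * (m%:num^-1 * (expR m%:num * `|R_ (i + p) th x|)) +
    2 ^- K * (m%:num^-1 * (expR m2%:num * (x + T))) * (expcoeff m2%:num i * W i).
  rewrite normrM.
  have -> : `|expcoeff (- m%:num) i| = expcoeff m%:num i.
    by rewrite /expcoeff normrM normfV normrX normrN !ger0_norm.
  have := @bias_partial m2 (i + p) (K - i) th x erefl x0.
  rewrite normrM gtr0_norm// -/(W i) -ler_pdivlMl// => hp.
  have := ler_wpM2l (expcoeff_ge0 i (ltW m0)) hp; move=> /le_trans; apply.
  rewrite mulrDr mulrDr lerD// le_eqVlt; apply/predU1l.
  have -> : 2 ^- (K - i) = 2 ^- K * 2 ^+ i :> R.
    have -> : 2 ^+ K = 2 ^+ (K - i) * 2 ^+ i :> R by rewrite -exprD subnK// ltnW.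
    by rewrite invfM -mulrA mulVf ?mulr1// expf_neq0.
  by rewrite expcoeffZ; ring.
rewrite (le_trans (ler_sum _ (fun i _ => term i)))// big_split/= -mulr_sumr.
have sumW : \sum_(i < K) expcoeff m2%:num i * W i <= expR m2%:num * (D * h x).
  apply: (@le_trans _ _ (expR m2%:num * w (convp P2 (convp P2 (convpow F p))) x)).
    rewrite /wmass mean_convolution; last exact: bmf_win0.
    pose G u := mean (convp P2 (convpow F p)) (fun y => win x (x + T) (u + y)).
    have bG : bmf G by rewrite /G; bm.
    have G0 u : 0 <= G u by apply: mean_ge0 => y; exact: win_ge0.
    apply: le_trans (@mean_compound_poisson_ge _ m2 F G K bG G0).
    by apply: ler_sum => i _; rewrite wmass_convpow_add.
  by rewrite ler_wpM2l ?expR_ge0//; near: x.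
have s1 : \sum_(i < K) expcoeff m%:num i * (m%:num^-1 * (expR m%:num * `|R_ (i + p) th x|)) <=
    e / 2 * (x * h x).
  by rewrite -[X in _ * (X * _)](ger0_norm x0); near: x.
have s2 : 2 ^- K * (m%:num^-1 * (expR m2%:num * (x + T))) * (\sum_(i < K) expcoeff m2%:num i * W i)
   <= 2 ^- K * c * (x * h x).
  apply: (@le_trans _ _ (2 ^- K * (m%:num^-1 * (expR m2%:num * (2 * x))) * (expR m2%:num * (D * h x)))).
    rewrite ler_pM ?sumr_ge0 ?mulr_ge0 ?invr_ge0 ?exprn_ge0 ?expR_ge0 ?addr_ge0//; first exact: ltW.
      by move=> i _; rewrite mulr_ge0 ?expcoeff_ge0.
    rewrite ler_wpM2l ?invr_ge0 ?exprn_ge0// ler_wpM2l ?invr_ge0// ler_wpM2l ?expR_ge0//.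
    lra.
  by rewrite /c le_eqVlt; apply/predU1l; ring.
have s3 : 2 ^- K * c * (x * h x) <= e / 2 * (x * h x) by rewrite ler_wpM2r// mulr_ge0.
lra.
Unshelve. all: by end_near. Qed.

Lemma convpow_osc n th : upo h (fun x => `|osc T (convpow F n.+1) om th x|).
Proof.
move=> e e0; have [C C0 hC] := bigo_convpow n.+1.
have n0 : 0 < n.+1%:R :> R by rewrite ltr0n.
have e'0 : 0 < e / (2 * n.+1%:R) by rewrite divr_gt0// mulr_gt0.
have ha := bias_small n th e'0.
near=> x; have x0 : 0 < x by near: x; exact: nbhs_pinfty_gt.
have xC : 2 * (T * C) / e <= x by near: x; exact: near_ge.
have x_ge0 := ltW x0; have hx := h_ge0 x.
have bP := bPhi th x.
have bclip0 : bmf (fun u : R => clip (x + T) u) by apply: bclip => //; mf.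
have bd : bmf (fun u => (clip (x + T) u - x) * Phi th x u).
  by apply: bmfM => //; apply: bmfB => //; exact: bmf_cst.
have xT : 0 <= x + T by rewrite addr_ge0// ltW.
have E : x * osc T (convpow F n.+1) om th x = n.+1%:R * a_ n th x -
    mean (convpow F n.+1) (fun u => (clip (x + T) u - x) * Phi th x u).
  rewrite -(mean_clip F0 xT bP (@Phi_out th x)) /osc -/(Phi th x) -meanZ//.
  rewrite -meanB//; last by bm.
  by congr mean; apply/funext => u; rewrite -/(Phi th x u); ring.
have le1 : `|mean (convpow F n.+1) (fun u => (clip (x + T) u - x) * Phi th x u)| <=
    T * f n.+1 x.
  rewrite (le_trans (ler_norm_mean _ bd))// /wmass -meanZ; last exact: bmf_win0.
  apply: ler_mean => [||u]; [by bm|by bm|].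
  rewrite /Phi !normrM (ger0_norm (win_ge0 _ _ _)) /win.
  case: andP => [[zu uz]|_]; last by rewrite !mul0r !mulr0.
  rewrite mul1r mulr1 -[leRHS]mulr1 ler_pM ?cos_max//.
  rewrite clip_id; first by rewrite ler_norml; have := T0; lra.
  by apply/andP; split => //; rewrite ltW// (lt_trans x0).
have le2 : T * f n.+1 x <= T * (C * h x) by rewrite ler_wpM2l ?(ltW T0)//; near: x.
have le3 : n.+1%:R * `|a_ n th x| <= e / 2 * x * h x.
  rewrite -ler_pdivlMl//; apply: (@le_trans _ _ (e / (2 * n.+1%:R) * x * h x)).
    by near: x.
  by rewrite invfM le_eqVlt; apply/predU1l; ring.
have le4 : T * C <= e / 2 * x by move: xC; rewrite ler_pdivrMr//; lra.
have le5 : T * C * h x <= e / 2 * x * h x by rewrite ler_wpM2r.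
rewrite -(ler_pM2l x0) -[X in X * `|_|](gtr0_norm x0) -normrM E.
rewrite (le_trans (ler_normB _ _))// normrM ger0_norm//.
lra.
Unshelve. all: by end_near. Qed.

End frequency.

(** * Regular laws and the local classes *)

Hypothesis h_loc : forall d t e : R, 0 < d -> 0 < e ->
  \forall x \near +oo, `|wmass d H x - wmass d H (x + t)| <= e * wmass d H x.
Hypothesis f_pos : forall k, (1 <= k)%N -> \forall x \near +oo, 0 < f k x.
Hypothesis H1_char : forall t, 0 < charnorm H1 t.

(** What suffices at the single scale [T] for [equidistribution] to reach all windows with a
    relative error. The frequencies start at [j.+1], mode zero being the mass up to the factor cos
    th. *)
Definition regular (V : probability R R) :=
  [/\ bigo h (w V), forall t, upo h (fun x => `|w V x - w V (x + t)|),
      forall j th, upo h (fun x => `|osc T V (j.+1%:R * (pi *+ 2 / T)) th x|)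
    & exists2 c : R, 0 < c & \forall x \near +oo, c * h x <= w V x].

Let om j : R := j.+1%:R * (pi *+ 2 / T).

Let omTE j : om j * T = pi *+ 2 *+ j.+1.
Proof. by rewrite /om -mulrA divfK ?gt_eqF// mulr_natl. Qed.

Let omT j (y th : R) : cos (om j * (y + T) + th) = cos (om j * y + th).
Proof. by rewrite mulrDr omTE addrAC (periodicn (@cosD2pi R)). Qed.

Lemma gauge_osc j th : upo h (fun x => `|osc T H (om j) th x|).
Proof.
have j0 : 0 < (2 * j.+1%:R : R) by rewrite mulr_gt0// ltr0n.
(* This s is half a period of the cosine of frequency [om j]. *)
apply: (osc_gauge T0 h_long (@omT j) (s := T / (2 * j.+1%:R))) => [||d t e d0 e0].
- by rewrite divr_ge0 ?ltW.
- move=> y th'; rewrite mulrDr addrAC mulrA omTE.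
  have -> : pi *+ 2 *+ j.+1 / (2 * j.+1%:R) = pi :> R.
    rewrite -mulrnA -[pi *+ _]mulr_natr natrM mulfK// gt_eqF//.
  exact: cosDpi.
- exact: h_loc.
Qed.

Lemma regular_compound : regular H2.
Proof.
split => [|||]; [exact: bigo_compound|exact: compound_slow_norm| |exact: compound_large].
move=> j th; exact: (compound_osc (@omT j) (gauge_osc j) (H1_char _) th).
Qed.

Lemma regular_gauge : regular H.
Proof.
split; [exact: bigo_gauge| |exact: gauge_osc|].
  by move=> t e e0; exact: h_loc.
by exists 1 => //; apply: nearW => x; rewrite mul1r.
Qed.

Lemma regular_convpow n : (1 <= n)%N ->
  (exists2 c : R, 0 < c & \forall x \near +oo, c * h x <= f n x) -> regular (convpow F n).
Proof.
case: n => // n _ hc; split => [|||//]; [exact: bigo_convpow|exact: convpow_slow_norm|].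
move=> j th; exact: (convpow_osc (@omT j) (gauge_osc j) (H1_char _) n th).
Qed.

Lemma regular_bigo V t : regular V -> bigo h (wmass t V).
Proof.
move=> [bV _ _ _]; have := bigo_win T0 h_long 0 t bV.
by under [X in bigo _ X]funext do rewrite addr0.
Qed.

Lemma regular_large V t : regular V -> 0 < t ->
  exists2 c : R, 0 < c & \forall x \near +oo, c * h x <= wmass t V x.
Proof.
move=> [bV sV oV [c c0 hc]] t0; have ct0 : 0 < c * (t / T) by rewrite mulr_gt0 ?divr_gt0.
exists (c * (t / T) / 2); first by rewrite divr_gt0.
have ct2 : 0 < c * (t / T) / 2 by rewrite divr_gt0.
have := equidistribution T0 h_long bV sV oV t0 ct2; move: hc; apply: filterS2 => x hx.
have r0 : 0 <= t / T by rewrite divr_ge0// ltW.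
have := ler_wpM2l r0 hx.
rewrite -/(wmass t V x) ler_norml; lra.
Qed.

Lemma regular_class V : supp_ge0 V -> regular V -> in_Lloc_OSloc V.
Proof.
move=> V0 rV; have [bV sV oV _] := rV.
have pos t : 0 < t -> \forall x \near +oo, 0 < wmass t V x.
  move=> t0; have [c c0 hc] := regular_large rV t0.
  by move: hc h_pos; apply: filterS2 => x hc hx; rewrite (lt_le_trans _ hc)// mulr_gt0.
split.
  apply: in_Lloc_wmass pos _ => t s e t0 e0.
  have [c c0 hc] := regular_large rV t0.
  have r0 : 0 <= t / T by rewrite divr_ge0// ltW.
  have o1 := equidistribution T0 h_long bV sV oV t0.
  have o2 := upo_shift h_long s o1.
  have ce0 : 0 < c * e by rewrite mulr_gt0.
  have := upoD o1 (upoD (upoZ h_ge0 r0 (sV s)) o2) ce0.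
  move: hc; apply: filterS2 => x hc; rewrite -!/(wmass _ _ _) => hx.
  apply: (@le_trans _ _ (c * e * h x)); last first.
    by rewrite (mulrC c) -mulrA ler_wpM2l// ltW.
  apply: le_trans hx; rewrite -[X in _ <= _ + (X * _ + _)](ger0_norm r0) -normrM.
  rewrite [X in _ <= _ + (_ + X)]distrC.
  rewrite (le_trans _ (lerD (lexx _) (ler_normD _ _)))// (le_trans _ (ler_normD _ _))//.
  by rewrite le_eqVlt; apply/predU1l; congr (`| _ |); ring.
apply: in_OSloc_wmass pos _ => t t0.
have [c c0 hc] := regular_large rV t0.
have bVV := bigo_win T0 h_long 0 t (bigo_conv T0 h_long h_conv V0 V0 bV bV).
have [C C0 hC] := bVV.
exists (C / c); first by rewrite divr_ge0// ltW.
move: hc hC; apply: filterS2 => x hc; rewrite addr0 => /le_trans; apply.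
by rewrite -mulrA ler_wpM2l// ler_pdivlMl.
Qed.

Lemma regular_same_order V t : regular V -> (0 < t)%E ->
  same_order (local_mass V t) (local_mass H t).
Proof.
move=> rV.
have le A B (r : R) : regular A -> regular B -> 0 < r -> bigo (wmass r B) (wmass r A).
  move=> rA rB r0; have [c c0 hc] := regular_large rB r0.
  have [C C0 hC] := regular_bigo r rA; exists (C / c); first by rewrite divr_ge0// ltW.
  move: hc hC; apply: filterS2 => x hc /le_trans; apply.
  by rewrite -mulrA ler_wpM2l// ler_pdivlMl.
have big A B : regular A -> regular B -> forall r, (0 < r)%E ->
    bigO_pinfty (local_mass A r) (local_mass B r).
  move=> rA rB [r| |//] r0.
    have {}r0 : 0 < r by rewrite -lte_fin.
    have [C C0 hC] := le A B r rA rB r0; exists C; move: hC; apply: filterS => x.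
    rewrite !local_mass_fin /= !ger0_norm ?wmass_ge0//.
  have [C C0 /pinfty_ex[M M0 hM]] := le A B 1 rA rB ltr01; exists C.
  apply: (@pinfty_near _ M) => x Mx; rewrite !local_mass_pinfty/= !ger0_norm ?tail_ge0//.
  rewrite -EFinM lee_fin -[X in tail _ X <= _](addr0 x); apply: (tail_le ltr01) => // y xy.
  by rewrite addr0; apply: hM; exact: le_trans xy.
by move=> t0; split; apply: big => //; exact: regular_gauge.
Qed.

Lemma wmass_convpowD j k x : f (j + k) x = mean (convpow F j) (fun u => f k (x - u)).
Proof.
rewrite /wmass mean_convpowD; last exact: bmf_win0.
congr mean; apply/funext => u; congr mean; apply/funext => v.
by rewrite [u + v]addrC win_shift addrAC.
Qed.

Let large P := exists2 c : R, 0 < c & \forall x \near +oo, c * h x <= w P x.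

(** The gauge is here the window of F^{*k} itself, which for small k is not known to be comparable
    with h. *)
Lemma convpow_dec_upo k (s t : R) : (1 <= k)%N -> s <= t ->
  upo (fun x => f k (x - s)) (fun x => f k (x - s) - f k (x - t)).
Proof.
move=> k1; rewrite le_eqVlt => /predU1P[<- e e0|st e e0].
  by apply: nearW => x; rewrite subrr mulr_ge0 ?wmass_ge0// ltW.
have ts : 0 < t - s by rewrite subr_gt0.
have := pinfty_shift (- s) (f_dec k1 ts e0); apply: filterS => x.
rewrite (_ : x - s - (t - s) = x - t); last by ring.
have [|d0] := leP (f k (x - s) - f k (x - t)) 0.
  by move=> /le_trans + _; apply; rewrite mulr_ge0 ?wmass_ge0// ltW.
have : e * f k (x - t) <= e * f k (x - s) by rewrite ler_wpM2l//; lra.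
lra.
Qed.

(** In F^{*n} = F^{*k} * F^{*(n-k)} the second summand is kept in [0, A], of mass at least 3/4.
    There f k (x - y) falls short of f k x by little, f k x / 4 on average, so half of f k x
    remains. The bound is not uniform in y, hence [mean_upo]. *)
Lemma convpow_le n k : (1 <= k <= n)%N -> \forall x \near +oo, f k x <= 2 * f n x.
Proof.
move=> /andP[k1 kn]; pose P := convpow F (n - k).
have e4 : 0 < 1 / 4 :> R by lra.
have [A A0] := mass_bounded P 0 e4.
pose B := `[0, A]%classic : set R.
have mB : measurable B by exact: measurable_itv.
have bB : bmf (\1_B : R -> R) := bmf_indic mB.
have P0 : supp_ge0 P by exact: supp_ge0_convpow.
have massB : mean P (win (- A) A) <= mean P (\1_B).
  apply: ler_mean_supp => // [|x x0]; first exact: bmf_win0.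
  rewrite indicE mem_setE /win in_itv/= x0/=; case: (x <= A); rewrite ?andbF//.
  by rewrite lern1 leq_b1.
move=> /le_trans/(_ massB) massA.
have kB : upo (f k) (fun x => mean P (fun y => \1_B y * (f k x - f k (x - y)))).
  apply: (@mean_upo _ P B (fun x y => f k x - f k (x - y)) (f k) 1) => //.
  - by move=> x; have := bmf_wmass T (convpow F k) x => ?; bm.
  - exact: f_pos.
  - apply: nearW => x y _; have := wmass_ge0 T (convpow F k) (x - y); lra.
  - move=> y; rewrite /B/= in_itv/= => /andP[y0 _].
    have := @convpow_dec_upo k 0 y k1 y0.
    by under eq_fun do rewrite subr0; under [X in upo _ X -> _]eq_fun do rewrite subr0.
have := kB _ e4; apply: filterS => x.
have bk := bmf_wmass T (convpow F k) x.
have -> : mean P (fun y => \1_B y * (f k x - f k (x - y))) =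
    f k x * mean P (\1_B) - mean P (fun y => \1_B y * f k (x - y)).
  rewrite -(meanZ P (f k x) bB) -meanB; [|by bm..].
  by congr mean; apply/funext => y; ring.
have : mean P (fun y => \1_B y * f k (x - y)) <= f n x.
  rewrite -[X in f X x](subnK kn) wmass_convpowD; apply: ler_mean => [||y]; [by bm|by[]|].
  by rewrite ler_piMl ?wmass_ge0// indicE; case: (_ \in _).
have := ler_wpM2l (wmass_ge0 T (convpow F k) x) massA; lra.
Qed.

Lemma convpow_large : exists2 n0 : nat, (1 <= n0)%N &
  forall n, (n0 <= n)%N -> large (convpow F n).
Proof.
have [c c0 hc] := compound_large.
(* Half of the lower bound c h <= h2 is given up to the truncation of the series. *)
have e0 : 0 < expR m%:num * (c / 2) by rewrite mulr_gt0 ?expR_gt0// divr_gt0.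
have [K hK] := compound_tail e0; exists K.+1 => // n Kn.
have [C C0 hC] : bigo (f n) (fun x => \sum_(k < K.+1) expcoeff m%:num k * f k x).
  apply: (@bigo_sum _ _ K.+1 (fun k x => expcoeff m%:num k * f k x)) => k kK.
  apply: bigoZ; first exact: expcoeff_ge0.
  case: k kK => [|k] kK.
    by exists 0 => //; apply: filterS convpow0_near => x ->; rewrite mul0r.
  by exists 2 => //; apply: convpow_le; rewrite /= (leq_trans _ Kn)// ltnW.
exists (expR m%:num * (c / 2) / (C + 1)); first by rewrite divr_gt0//; lra.
have := hK _ (leqnSn K); move: hc hC; apply: filterS3 => x hc hC.
rewrite ler_norml => /andP[_ tx].
have C1 : 0 < C + 1 by lra.
rewrite mulrAC ler_pdivrMr// mulrC.
have := ler_wpM2l (expR_ge0 m%:num) hc.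
have := wmass_ge0 T (convpow F n) x; lra.
Qed.

(** * Descent to a power in OS_loc *)

Section subexponential_power.
Variables (l : nat) (l1 : (1 <= l)%N).
Hypothesis OSl : in_OSloc (convpow F l).
Let g := f l.
Let os : bigo g (w (convp (convpow F l) (convpow F l))) := in_OSloc_bigo OSl T0.

(** Forward shifts are controlled by [f_dec]; backward ones use OS_loc. In F^{*l} * F^{*l} one
    summand is kept in ]z, z + T] with z >= s and g z > 0; there g (x - y) is at least g (x - s) up
    to a small error on average, so g (x - s) g z / 2 <= C g x. *)
Lemma bigo_convpow_shift (t : R) : bigo g (fun x => g (x + t)).
Proof.
have [t0|t0] := ltP 0 t.
  exists 2 => //; have := pinfty_shift t (f_dec l1 t0 ltr01).
  by apply: filterS => x; rewrite addrK.
pose s := - t; have s0 : 0 <= s by rewrite oppr_ge0.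
have [z [sz gz]] : exists z, s <= z /\ 0 < g z.
  have /pinfty_ex[M _ hM] := f_pos l1; exists (Num.max s M); split.
    by rewrite le_max lexx.
  by apply: hM; rewrite le_max lexx orbT.
pose P := convpow F l; pose B := `]z, z + T]%classic : set R.
have mB : measurable B by exact: measurable_itv.
have bB : bmf (\1_B : R -> R) := bmf_indic mB.
have PB : mean P (\1_B) = g z by rewrite -winE.
have kB : upo (fun x => g (x - s))
    (fun x => mean P (fun y => \1_B y * (g (x - s) - g (x - y)))).
  apply: (@mean_upo _ P B (fun x y => g (x - s) - g (x - y)) (fun x => g (x - s)) 1) => //.
  - by move=> x; have := bmf_wmass T P x => ?; bm.
  - exact: pinfty_shift (f_pos l1).
  - apply: nearW => x y _; have := wmass_ge0 T P (x - y); rewrite -/(g _); lra.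
  - move=> y; rewrite /B/= in_itv/= => /andP[zy _].
    by apply: convpow_dec_upo => //; rewrite (le_trans sz)// ltW.
have [C C0 hC] := os.
exists (2 / g z * C); first by rewrite mulr_ge0// divr_ge0// ltW.
have gz2 : 0 < g z / 2 by rewrite divr_gt0.
have := kB _ gz2; move: hC; apply: filterS2 => x hC.
have bk := bmf_wmass T P x.
have -> : mean P (fun y => \1_B y * (g (x - s) - g (x - y))) =
    g (x - s) * g z - mean P (fun y => \1_B y * g (x - y)).
  rewrite -PB -(meanZ P _ bB) -meanB; [|by bm..].
  by congr mean; apply/funext => y; ring.
have : mean P (fun y => \1_B y * g (x - y)) <= C * g x.
  apply: le_trans hC; rewrite wmass_convE; apply: ler_mean => [||y]; [by bm|by[]|].
  by rewrite ler_piMl ?wmass_ge0// indicE; case: (_ \in _).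
rewrite opprK => h1 h2.
have h3 : g z / 2 * g (x + t) <= C * g x by lra.
have -> : 2 / g z * C * g x = C * g x / (g z / 2).
  by rewrite invf_div [X in _ = X]mulrC mulrA.
by rewrite ler_pdivlMr// mulrC.
Qed.

(** As in Kesten's bound, one factor F^{*l} is added at a time: where the added summand stays away
    from x the previous bound reduces to F^{*l} * F^{*l}, and near x only shifts of g occur. *)
Lemma bigo_convpow_mul j : bigo g (f (j.+1 * l)).
Proof.
elim: j => [|j [C C0 /pinfty_ex[M M0 hM]]].
  by rewrite mul1n; exists 1 => //; apply: nearW => x; rewrite mul1r.
have Fl0 : supp_ge0 (convpow F l) by exact: supp_ge0_convpow.
apply: (@bigo_le _ _ _ (fun x => C * w (convp (convpow F l) (convpow F l)) x +
    1 * mean (convpow F l) (win (x - M) (x + T)))).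
  apply: nearW => x; rewrite mulSn wmass_convpowD; apply: mean_split => //.
  - exact: bmf_wmass.
  - by move=> y yx; apply: hM; lra.
  - by move=> y yx; rewrite mul1r wmass_le_win//; exact: supp_ge0_convpow.
apply: bigoD; first exact: bigoZ.
apply: bigoZ => //; have [n hn] := win_cover T0 (convpow F l) (- M) T.
apply: bigo_le; first exact: nearW hn.
apply: (@bigo_sum _ _ n (fun i x => g (x + (- M + T *+ i)))) => i _.
exact: bigo_convpow_shift.
Qed.

Lemma subexponential_power_large n : (l <= n)%N -> large (convpow F n).
Proof.
move=> ln; have [N N1 hN] := convpow_large.
have [c c0 hc] : large (convpow F (N * l)) by apply: hN; rewrite leq_pmulr.
have [C C0 hC] : bigo g (f (N * l)) by case: N N1 {hN hc} => // N _; exact: bigo_convpow_mul.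
have C1 : 0 < 2 * (C + 1) by lra.
exists (c / (2 * (C + 1))); first by rewrite divr_gt0.
have l_n : (1 <= l <= n)%N by rewrite l1.
have := convpow_le l_n; move: hc hC; apply: filterS3 => x hc hC hn.
rewrite mulrAC ler_pdivrMr// (le_trans hc)// (le_trans hC)//.
have := ler_wpM2l C0 hn; have := wmass_ge0 T (convpow F n) x; rewrite -/(g x); lra.
Qed.

End subexponential_power.

Lemma compound_poisson_root :
  [/\ in_Lloc_OSloc H2,
      forall t : \bar R, (0 < t)%E -> same_order (local_mass H2 t) (local_mass H t),
      exists n0 : nat, [/\ (1 <= n0)%N,
        forall n, (n0 <= n)%N -> in_Lloc_OSloc (convpow F n)
        & (2 <= n0)%N -> forall l0 : nat, (1 <= l0 <= n0 - 1)%N ->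
          in_OSloc (convpow F l0) ->
          forall n, (l0 <= n)%N -> in_Lloc_OSloc (convpow F n)]
      & in_OSloc F -> in_Lloc F /\ in_OSloc F].
Proof.
have class n : (1 <= n)%N -> large (convpow F n) -> in_Lloc_OSloc (convpow F n).
  by move=> n1 hn; apply: regular_class; [exact: supp_ge0_convpow|exact: regular_convpow].
have power l n : (1 <= l)%N -> (l <= n)%N -> in_OSloc (convpow F l) ->
    in_Lloc_OSloc (convpow F n).
  move=> l1 ln OSl; apply: class; first exact: leq_trans ln.
  exact: (subexponential_power_large l1 OSl).
split.
- exact: regular_class H20 regular_compound.
- by move=> t t0; apply: regular_same_order => //; exact: regular_compound.
- have [n0 n01 hn0] := convpow_large; exists n0; split => //.
    by move=> n n0n; apply: class; [exact: leq_trans n0n|exact: hn0].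
  by move=> _ l /andP[l1 _] OSl n ln; exact: power OSl.
- by move=> OSF; exact: (power 1%N 1%N isT isT OSF).
Qed.

End compound_poisson_tail.

Lemma supp_ge0_levy_spectral {R : realType} (nu : {measure set R -> \bar R}) :
  (0 < nu `]1%R, +oo[%classic < +oo)%E -> supp_ge0 (levy_spectral nu).
Proof.
move=> /andP[nu0 nuoo]; rewrite /supp_ge0 /= /mnormalize /= {1 2}/mrestr setTI.
rewrite gt_eqF// lt_eqF//= /mrestr (_ : _ `&` _ = set0) ?measure0 ?mul0e//.
apply/seteqP; split => // y /=; rewrite !in_itv/= andbT => -[y0 y1].
by have := lt_trans y1 (lt_trans y0 ltr01); rewrite ltxx.
Qed.

Unset Implicit Arguments.
Local Open Scope ereal_scope.

Theorem theorem4p1 (R : realType)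
    (a : R) (nu : {measure set R -> \bar R})
    (H H1 : probability R R) (T0 : R) :
  let F : probability R R := levy_spectral nu in
  let H2 : probability R R := compound_poisson (levy_mass nu) F in
  (0 <= a)%R ->
  nu `]-oo, 0%R]%classic = 0 ->
  0 < nu `]1%R, +oo[%classic < +oo ->
  \int[nu]_(y in `]0%R, 1%R]) y%:E < +oo ->
  id_law a nu H ->
  id_law a (small_jumps nu) H1 ->
  (exists2 b : R, (0 < b)%R &
    bigO_pinfty (local_mass H1 +oo) (fun x => (expR (- (b * x)))%:E)) ->
  (forall A, measurable A -> H A = convolution H1 H2 A) ->
  (0 < T0)%R ->
  (forall k, (1 <= k)%N -> forall t : R, (0 < t)%R ->
    1 <= limf_einf (fun x => local_mass (convpow F k) T0%:E (x - t) /
                             local_mass (convpow F k) T0%:E x) +oo%R) ->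
  in_Lloc_OSloc H ->
  littleo_pinfty (local_mass H1 T0%:E) (local_mass H2 T0%:E) ->
  [/\ in_Lloc_OSloc H2,
      forall T : \bar R, 0 < T -> same_order (local_mass H2 T) (local_mass H T),
      exists n0 : nat, [/\ (1 <= n0)%N,
        forall n, (n0 <= n)%N -> in_Lloc_OSloc (convpow F n)
        & (2 <= n0)%N -> forall l0 : nat, (1 <= l0 <= n0 - 1)%N ->
          in_OSloc (convpow F l0) ->
          forall n, (l0 <= n)%N -> in_Lloc_OSloc (convpow F n)]
      & in_OSloc F -> in_Lloc F /\ in_OSloc F].
Proof.
move=> F H2 _ _ nu1 _ [H0 _ _] [H10 idH1 _] _ HE T00 ratioF [LH OSH] H1H2.
have m0 : (0 < (levy_mass nu)%:num)%R.
  by have /andP[nu0 nuoo] := nu1; rewrite /= fine_gt0// nu0.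
have dec k (t e : R) : (1 <= k)%N -> (0 < t)%R -> (0 < e)%R ->
    \forall x \near +oo%R, (0 < wmass T0 (convpow F k) (x - t) /\
      wmass T0 (convpow F k) x <= (1 + e) * wmass T0 (convpow F k) (x - t))%R.
  move=> k1 t0 e0; have e1 : (0 < 1 + e)%R by rewrite addr_gt0.
  have := ratioF k k1 t t0; under eq_fun do rewrite !local_mass_fin.
  move=> /(@liminf_ratio _ _ t (1 + e)^-1%R (fun x => wmass_ge0 T0 (convpow F k) x)) lim.
  have := lim; rewrite invr_ge0 ltW// invf_lt1// ltrDl e0 => /(_ isT isT).
  by apply: filterS => x [? ?]; split => //; rewrite -ler_pdivrMl.
apply: (@compound_poisson_root _ T0 T00 (levy_mass nu) m0 F H H1) => //.
- exact: supp_ge0_levy_spectral.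
- exact: in_Lloc_pos LH T00.
- by move=> t e; exact: in_Lloc_slow LH T00.
- exact: in_OSloc_bigo OSH T00.
- by move=> g; exact: eq_probability_mean.
- by move=> k t e k1 t0 e0; have := dec k t e k1 t0 e0; apply: filterS => x [].
- move=> e e0; have := H1H2 e e0; apply: filterS => x.
  by rewrite !local_mass_fin /= !ger0_norm ?wmass_ge0.
- by move=> d t e d0; exact: in_Lloc_slow LH d0.
(* Positivity at x is the first half of [dec] with t = 1, read at x + 1. *)
- move=> k k1; have := pinfty_shift 1%R (dec k 1%R 1%R k1 ltr01 ltr01).
  by apply: filterS => x; rewrite addrK => -[].
- by move=> t; exact: infinitely_divisible_charnorm.
Qed.
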